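(* Let $V$ be a finite-dimensional highest weight module over $Y_\hbar(\mathfrak g)$ and let $i\in\mathbf I$. Let $\lambda\in\mathfrak h^*$ be the $\mathfrak g$-weight of its highest weight space and denote by $f_i^+(u)$ the eigenvalue of the transfer operator $T_i(u)$ on $V_\lambda$. Then the normalized transfer operator $\overline T_i(u)=f_i^+(u)^{-1}T_i(u)$ has the following properties: (1) It is an element of $\mathrm{End}(V)[u]$ with monic eigenvalues. (2) If $\mu\in\mathfrak h^*$ is a $\mathfrak g$-weight of $V$, then the restriction $\overline T_i(u)|_{V_\mu}$ is an $\mathrm{End}(V_\mu)$-valued monic polynomial of degree $(\lambda-\mu)(\varpi_i^\vee)$. (3) Let $\mathcal Z_i(V)$ denote the set of zeroes of the eigenvalues of $\overline T_i(u)$. Then $\mathcal Z_i(V)=\sigma_i(V)$. (4) Let $\mathcal Q^{\mathfrak g}_{i,V}(u)\in\mathbb C[u]$ be the monic polynomial which is the eigenvalue of $\overline T_i(u)$ on the lowest weight space $V_{w_0(\lambda)}$. Then the set of roots of $\mathcal Q^{\mathfrak g}_{i,V}(u)$ is equal to $\sigma_i(V)$.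
   Context: Let $\mathfrak g$ be a finite-dimensional simple Lie algebra over $\mathbb C$ with Cartan subalgebra $\mathfrak h$, simple roots $\{\alpha_i\}_{i\in\mathbf I}$, invariant form $(\cdot,\cdot)$ normalized so that short roots have squared length $2$, Cartan matrix $a_{ij}=2(\alpha_i,\alpha_j)/(\alpha_i,\alpha_i)$, $d_i=(\alpha_i,\alpha_i)/2$, and $w_0$ the longest Weyl group element. Fix $\hbar\in\mathbb C^\times$. The Yangian $Y_\hbar(\mathfrak g)$ is the unital associative $\mathbb C$-algebra generated by $\xi_{i,r},x_{i,r}^\pm$ ($i\in\mathbf I$, $r\in\mathbb Z_{\ge0}$) with relations, for all $i,j\in\mathbf I$, $r,s\ge0$: $[\xi_{i,r},\xi_{j,s}]=0$; $[\xi_{i,0},x_{j,s}^\pm]=\pm d_ia_{ij}x_{j,s}^\pm$; $[\xi_{i,r+1},x_{j,s}^\pm]-[\xi_{i,r},x_{j,s+1}^\pm]=\pm\hbar\frac{d_ia_{ij}}2(\xi_{i,r}x_{j,s}^\pm+x_{j,s}^\pm\xi_{i,r})$; $[x^\pm_{i,r+1},x_{j,s}^\pm]-[x^\pm_{i,r},x_{j,s+1}^\pm]=\pm\hbar\frac{d_ia_{ij}}2(x^\pm_{i,r}x_{j,s}^\pm+x_{j,s}^\pm x^\pm_{i,r})$; $[x_{i,r}^+,x_{j,s}^-]=\delta_{ij}\xi_{i,r+s}$; and for $i\ne j$, $m=1-a_{ij}$, $\sum_{\pi\in S_m}[x^\pm_{i,r_{\pi(1)}},[x^\pm_{i,r_{\pi(2)}},\cdots[x^\pm_{i,r_{\pi(m)}},x^\pm_{j,s}]\cdots]]=0$.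 $U(\mathfrak g)\subset Y_\hbar(\mathfrak g)$ via $x_i^\pm\mapsto x_{i,0}^\pm$, $d_ih_i\mapsto\xi_{i,0}$ ($h_i$ the simple coroots, $x_i^\pm\in\mathfrak g_{\pm\alpha_i}$ with $[x_i^+,x_i^-]=d_ih_i$). Set $\xi_i(u)=1+\hbar\sum_{r\ge0}\xi_{i,r}u^{-r-1}$, $x_i^\pm(u)=\hbar\sum_{r\ge0}x_{i,r}^\pm u^{-r-1}$. On a finite-dimensional representation $V$ these are expansions at $u=\infty$ of $\mathrm{End}(V)$-valued rational functions; $\sigma_i(V)\subset\mathbb C$ is the set of all poles of $\xi_i(u),x_i^+(u),x_i^-(u)$. A highest weight module is one generated by a nonzero $\Omega$ with $x_i^+(u)\Omega=0$, $\xi_i(u)\Omega=\mu_i(u)\Omega$ for all $i$, some $\mu_i(u)\in1+u^{-1}\mathbb C[[u^{-1}]]$. If it is finite-dimensional and $\Omega$ has $\mathfrak g$-weight $\lambda$, then $V_\lambda$ (highest weight space) and $V_{w_0(\lambda)}$ (lowest weight space) are one-dimensional. Transfer operators. $\kappa$ is $1/4$ times the eigenvalue of the Casimir element on the adjoint representation ($\kappa=\frac12mh^\vee$, $m=1,2,3$ for types ADE, BCF, G). With $[n]_q=\frac{q^n-q^{-n}}{q-q^{-1}}$ and $\mathbf B(q)=([d_ia_{ij}]_q)_{i,j\in\mathbf I}$, write $\mathbf B(q)^{-1}=\frac1{[2\kappa]_q}(c_{ij}(q))_{i,j}$; then $c_{ij}(q)=\sum_{r\in\mathbb Z}c_{ij}^{(r)}q^r\in\mathbb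 Z_{\ge0}[q,q^{-1}]$. Define $A_i(u)=\prod_{j\in\mathbf I,\,r\in\mathbb Z}\xi_j\!\left(u+\kappa\hbar+\frac\hbar2r\right)^{-c_{ij}^{(r)}}$, which acts on $V$ as a rational $\mathrm{End}(V)$-valued function with expansion $1-2\kappa\hbar\varpi_i^\vee u^{-1}+\cdots$ at $\infty$, where $\varpi_i^\vee\in\mathfrak h$ is the fundamental coweight ($\alpha_k(\varpi_i^\vee)=\delta_{ik}$). $T_i(u)$ is the $\mathrm{End}(V)$-valued meromorphic function of $u$ uniquely determined by: $T_i(u+2\kappa\hbar)=A_i(u)T_i(u)$; $T_i(u)$ is holomorphic and invertible for $\mathrm{Re}(u/\hbar)\gg0$; and $T_i(u)$ is asymptotic to $u^{-\varpi_i^\vee}$ as $|u|\to\infty$ in the zone $\mathrm{Re}(u/\hbar)\gg0$ (for a fixed branch of $\log u$ there). *)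

(* Defs.v *)
From HB Require Import structures.
From mathcomp Require Import all_boot all_order all_algebra all_fingroup.
From mathcomp Require Import finmap complex.
From mathcomp Require Import all_classical all_reals all_analysis.
Set Implicit Arguments.
Unset Strict Implicit.
Unset Printing Implicit Defensive.
Import Order.TTheory GRing.Theory Num.Theory.
Import numFieldNormedType.Exports.
Local Open Scope classical_set_scope.
Local Open Scope complex_scope.
Local Open Scope ring_scope.

(* Packed as a numClosedFieldType so that the generic topology and norm of
   numeric fields are found on it; they are not found on R[i] directly. *)
Definition Cx (R : realType) : numClosedFieldType := R[i].

Section PolyEval.
Variables (K : numClosedFieldType) (N : nat).

Definition evalmx (P : 'M[{poly K}]_N) (u : K) : 'M[K]_N :=
  map_mx (horner_eval u) P.

Definition coefmx (P : 'M[{poly K}]_N) (k : nat) : 'M[K]_N :=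
  map_mx (coefp k) P.

End PolyEval.

Section ComplexAnalysis.
Variable R : realType.
Notation C := (Cx R).

Definition cexp (z : C) : C :=
  let: x +i* y := z in (expR x * cos y) +i* (expR x * sin y).

Variable N : nat.

Definition expmx (A : 'M[C]_N) : 'M[C]_N :=
  \matrix_(p, q)
    lim ((fun m : nat => \sum_(k < m) (k`!%:R^-1 * (A ^+ k) p q)) @ \oo).

Definition holomorphic_at (F : C -> 'M[C]_N) (z : C) : Prop :=
  \forall u \near z, forall p q, derivable (fun w : C => F w p q) u 1.

(* A meromorphic function is represented by a total function, whose values at
   the poles are irrelevant; [mero_eq] is equality of such functions. *)
Definition mero_eq (T : Type) (F G : C -> T) : Prop :=
  forall z : C, \forall u \near z^', F u = G u.

Definition meromorphic (F : C -> 'M[C]_N) : Prop :=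
  forall z : C, exists (k : nat) (G : C -> 'M[C]_N),
    holomorphic_at G z /\
    \forall u \near z^', F u = ((u - z) ^+ k)^-1 *: G u.

(* F : nat -> 'M stands for the formal series \sum_k F k u^-k. It is the
   expansion at infinity of P(u) / D(u): compare the coefficients of u^m and of
   u^-(k+1) in D(u) F(u) = P(u). *)
Definition expansion_of (F : nat -> 'M[C]_N) (P : 'M[{poly C}]_N)
    (D : {poly C}) : Prop :=
  (forall m : nat, \sum_(m <= j < size D) D`_j *: F (j - m)%N
                   = coefmx P m) /\
  (forall k : nat, \sum_(j < size D) D`_j *: F (j + k.+1)%N = 0).

Definition rat_poles (F : nat -> 'M[C]_N) : set C :=
  [set z | forall P D, expansion_of F P D -> root D z].

(* value at z of the rational function with expansion F (0 at its poles) *)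
Definition rat_val (F : nat -> 'M[C]_N) (z : C) : 'M[C]_N :=
  xget 0 [set M | exists P D, [/\ expansion_of F P D, D.[z] != 0
                               & M = D.[z]^-1 *: evalmx P z]].

End ComplexAnalysis.

Section Lie.
Variables (K : numClosedFieldType) (g : vectType K) (br : g -> g -> g).

Definition lie_bracket : Prop :=
  [/\ forall a x y z, br (a *: x + y) z = a *: br x z + br y z,
      forall a x y z, br z (a *: x + y) = a *: br z x + br z y,
      forall x, br x x = 0
    & forall x y z, br x (br y z) + br y (br z x) + br z (br x y) = 0].

Definition lie_simple : Prop :=
  (exists x y, br x y != 0) /\
  forall U : {vspace g}, (forall x y, y \in U -> br x y \in U) ->
    U = 0%VS \/ U = fullv.

(* nilpotent self-normalizing subalgebra *)
Definition cartan_subalgebra (h : {vspace g}) : Prop :=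
  [/\ forall x y, x \in h -> y \in h -> br x y \in h,
      exists k : nat, forall (s : seq g) y,
        size s = k -> all (fun x => x \in h) s -> y \in h -> foldr br y s = 0
    & forall x, (forall y, y \in h -> br x y \in h) -> x \in h].

Definition invariant_form (form : g -> g -> K) : Prop :=
  [/\ forall a x y z, form (a *: x + y) z = a * form x z + form y z,
      forall x y, form x y = form y x,
      forall x y z, form (br x y) z = form x (br y z)
    & forall x, (forall y, form x y = 0) -> x = 0].

Variable h : {vspace g}.
Notation hdual := 'Hom(subvs_of h, K^o).

Definition is_root (b : hdual) : Prop :=
  b != 0 /\ exists2 x : g, x != 0 &
    forall t : subvs_of h, br (vsval t) x = (b t : K) *: x.

Definition is_base (n : nat) (alpha : 'I_n -> hdual) : Prop :=
  [/\ forall i, is_root (alpha i), free [seq alpha i | i <- enum 'I_n]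
    & forall b, is_root b -> exists m : 'I_n -> nat,
        b = \sum_i alpha i *+ m i \/ b = - \sum_i alpha i *+ m i].

End Lie.

Record simple_lie (K : numClosedFieldType) := SimpleLie {
  lie : vectType K;
  lbr : lie -> lie -> lie;
  lbrP : lie_bracket lbr;
  lbr_simple : lie_simple lbr;
  csa : {vspace lie};
  csaP : cartan_subalgebra lbr csa;
  rank : nat;
  alpha : 'I_rank -> 'Hom(subvs_of csa, K^o);
  alphaP : is_base lbr alpha;
  iform : lie -> lie -> K;
  iformP : invariant_form lbr iform;
  (* the isomorphism h^* -> h given by the form *)
  sharp : 'Hom(subvs_of csa, K^o) -> subvs_of csa;
  sharpP : forall b t, iform (vsval (sharp b)) (vsval t) = b t;
  (* the shortest roots have squared length 2 *)
  form_normalized :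
    (exists2 b, is_root lbr b & iform (vsval (sharp b)) (vsval (sharp b)) = 2) /\
    (forall b, is_root lbr b ->
       2 <= iform (vsval (sharp b)) (vsval (sharp b)));
  cartan : 'I_rank -> 'I_rank -> int;
  cartanP : forall i j, (cartan i j)%:~R =
    2 * iform (vsval (sharp (alpha i))) (vsval (sharp (alpha j)))
      / iform (vsval (sharp (alpha i))) (vsval (sharp (alpha i)));
  dsym : 'I_rank -> nat;
  dsymP : forall i, (dsym i)%:R =
    iform (vsval (sharp (alpha i))) (vsval (sharp (alpha i))) / 2;
  varpi : 'I_rank -> subvs_of csa;
  varpiP : forall i k, alpha k (varpi i) = (k == i)%:R;
  (* 2 * kappa: the Casimir element acts on the adjoint representation by
     4 * kappa *)
  kappa2 : nat;
  kappa2P : forall (m : nat) (X Y : m.-tuple lie),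
    basis_of fullv X -> basis_of fullv Y ->
    (forall p q : 'I_m, iform (tnth X p) (tnth Y q) = (p == q)%:R) ->
    forall z, \sum_(p < m) lbr (tnth X p) (lbr (tnth Y p) z)
              = (2 * kappa2)%:R *: z
}.

Section RootData.
Variables (K : numClosedFieldType) (L : simple_lie K).
Notation n := (rank L).
Notation hdual := 'Hom(subvs_of (csa L), K^o).

Definition coroot (i : 'I_n) : subvs_of (csa L) :=
  (dsym i)%:R^-1 *: sharp (alpha i).

Definition kappa : K := (kappa2 L)%:R / 2.

Definition reflection (i : 'I_n) (mu : hdual) : hdual :=
  mu - (mu (coroot i) : K) *: alpha i.

(* Weyl group elements are products of simple reflections. *)
Definition weyl_word (s : seq 'I_n) (mu : hdual) : hdual :=
  foldr reflection mu s.

Definition reduced_word (s : seq 'I_n) : Prop :=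
  forall s', weyl_word s' =1 weyl_word s -> (size s <= size s')%N.

Definition longest_word (s : seq 'I_n) : Prop :=
  reduced_word s /\ forall s', reduced_word s' -> (size s' <= size s)%N.

(* The rational function field Q(q), with q the indeterminate. *)
Definition Qq : fieldType := {fraction {poly rat}}.
Definition qvar : Qq := tofrac 'X.
Definition qint (m : int) : Qq := (qvar ^ m - qvar ^ (- m)) / (qvar - qvar^-1).

Definition Bq : 'M[Qq]_n := \matrix_(i, j) qint ((dsym i)%:Z * cartan i j).

(* c i j r is the coefficient of q^r in c_ij(q). *)
Definition inverse_qcartan (c : 'I_n -> 'I_n -> {fsfun int -> nat with 0%N})
    : Prop :=
  Bq \in unitmx /\
  invmx Bq = (qint (kappa2 L)%:Z)^-1 *:
    \matrix_(i, j) \sum_(r <- finsupp (c i j)) qvar ^ r *+ c i j r.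

End RootData.

Definition comm_mx_bracket (K : numClosedFieldType) (N : nat)
  (A B : 'M[K]_N) : 'M[K]_N := A *m B - B *m A.
Local Notation "[! A , B ]" := (comm_mx_bracket A B) (at level 0).

Definition sgnb (K : numClosedFieldType) (e : bool) : K := if e then 1 else -1.

(* A representation, on the space of column vectors K^N, of the algebra
   presented by the generators xi_{i,r}, x^+_{i,r} = xpm true i r,
   x^-_{i,r} = xpm false i r. *)
Record yangian_rep (K : numClosedFieldType) (L : simple_lie K) (hbar : K)
    (N : nat) := YangianRep {
  xi : 'I_(rank L) -> nat -> 'M[K]_N;
  xpm : bool -> 'I_(rank L) -> nat -> 'M[K]_N;
  xi_xi : forall i j r s, [! xi i r, xi j s] = 0;
  xi0_x : forall e i j s,
    [! xi i 0%N, xpm e j s] = (sgnb K e * (dsym i)%:R * (cartan i j)%:~R) *: xpm e j s;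
  xi_x : forall e i j r s,
    [! xi i r.+1, xpm e j s] - [! xi i r, xpm e j s.+1] =
    (sgnb K e * hbar * ((dsym i)%:R * (cartan i j)%:~R / 2)) *:
      (xi i r *m xpm e j s + xpm e j s *m xi i r);
  x_x : forall e i j r s,
    [! xpm e i r.+1, xpm e j s] - [! xpm e i r, xpm e j s.+1] =
    (sgnb K e * hbar * ((dsym i)%:R * (cartan i j)%:~R / 2)) *:
      (xpm e i r *m xpm e j s + xpm e j s *m xpm e i r);
  xp_xm : forall i j r s,
    [! xpm true i r, xpm false j s] = if i == j then xi i (r + s)%N else 0;
  serre : forall e i j (m : nat) (r : 'I_m -> nat) (s : nat),
    i != j -> m%:Z = 1 - cartan i j ->
    \sum_(p : 'S_m)
      foldr (fun k B => [! xpm e i (r (p k)), B]) (xpm e j s) (enum 'I_m) = 0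
}.

Section Yangian.
Variables (R : realType) (L : simple_lie (Cx R)) (hbar : Cx R) (N : nat).
Notation C := (Cx R).
Notation n := (rank L).
Notation hdual := 'Hom(subvs_of (csa L), C^o).
Variable V : yangian_rep L hbar N.

(* coefficients in u^-1 of the series xi_i(u) and x^+-_i(u) *)
Definition xi_series (i : 'I_n) (k : nat) : 'M[C]_N :=
  if k is r.+1 then hbar *: xi V i r else 1%:M.

Definition x_series (e : bool) (i : 'I_n) (k : nat) : 'M[C]_N :=
  if k is r.+1 then hbar *: xpm V e i r else 0.

Definition sigma (i : 'I_n) : set C :=
  rat_poles (xi_series i) `|` rat_poles (x_series true i)
    `|` rat_poles (x_series false i).

(* The action of h through U(g) -> Y_hbar(g): the elements d_i h_i form a basis
   of h, and d_i h_i acts by xi_{i,0}. *)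
Definition dcoroots : n.-tuple (subvs_of (csa L)) :=
  [tuple (dsym i)%:R *: coroot i | i < n].

Definition h_act (t : subvs_of (csa L)) : 'M[C]_N :=
  \sum_i coord dcoroots i t *: xi V i 0%N.

Definition weight_space (mu : hdual) : set 'cV[C]_N :=
  [set v | forall t, h_act t *m v = (mu t : C) *: v].

Definition is_weight (mu : hdual) : Prop :=
  exists2 v, weight_space mu v & v != 0.

Definition highest_weight_vector (Omega : 'cV[C]_N) : Prop :=
  [/\ Omega != 0,
      forall i r, xpm V true i r *m Omega = 0,
      exists m : 'I_n -> nat -> C, forall i r, xi V i r *m Omega = m i r *: Omega
    & forall U : {vspace 'cV[C]_N}, Omega \in U ->
        (forall i r v, v \in U -> xi V i r *m v \in U) ->
        (forall e i r v, v \in U -> xpm V e i r *m v \in U) -> U = fullv].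

(* A_i(u). The values of the xi_j commute, so the order of the factors is
   irrelevant. *)
Definition A_op (c : 'I_n -> 'I_n -> {fsfun int -> nat with 0%N}) (i : 'I_n)
    (u : C) : 'M[C]_N :=
  \prod_(j < n) \prod_(r <- finsupp (c i j))
    invmx (rat_val (xi_series j) (u + kappa L * hbar + hbar / 2 * r%:~R))
      ^+ c i j r.

(* a branch of the logarithm on the half-plane Re(u / hbar) > 0 *)
Definition log_branch (lg : C -> C) : Prop :=
  forall u : C, 0 < complex.Re (u / hbar) ->
    cexp (lg u) = u /\ {for u, continuous lg}.

(* The last clause says that T(u) = u^(- varpi_i) (1 + o(1)). Comparing from
   the left, u^(varpi_i) T(u) --> 1, is what makes T unique: it forces the
   2 kappa hbar-periodic quotient T(u)^-1 T'(u) of two solutions to be 1. *)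
Definition transfer_operator
    (c : 'I_n -> 'I_n -> {fsfun int -> nat with 0%N})
    (lg : C -> C) (i : 'I_n) (T : C -> 'M[C]_N) : Prop :=
  [/\ meromorphic T,
      mero_eq (fun u => T (u + 2 * kappa L * hbar)) (fun u => A_op c i u *m T u),
      exists M : R, forall u : C, M < complex.Re (u / hbar) ->
        holomorphic_at T u /\ T u \in unitmx
    & exists2 M : R, 0 < M & forall eps : R, 0 < eps -> exists B : R,
        forall u : C, M < complex.Re (u / hbar) -> B%:C < `|u| ->
        forall p q, `|(expmx (lg u *: h_act (varpi i)) *m T u - 1%:M) p q|
                    < eps%:C].

End Yangian.

Section PolyMatrix.
Variables (K : numClosedFieldType) (N : nat).

(* P restricts to a monic End(U)-valued polynomial of degree deg *)
Definition monic_on (U : set 'cV[K]_N) (P : 'M[{poly K}]_N) (deg : nat) : Prop :=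
  forall v, U v ->
    [/\ forall k, U (coefmx P k *m v), coefmx P deg *m v = v
      & forall k, (deg < k)%N -> coefmx P k *m v = 0].

(* The eigenvalues of P, with multiplicity, are the monic polynomials in s. *)
Definition monic_eigenvalues (P : 'M[{poly K}]_N) : Prop :=
  exists2 s : seq {poly K}, all (fun p => p \is monic) s &
    char_poly P = \prod_(p <- s) ('X - p%:P).

Definition eigenvalue_zeros (P : 'M[{poly K}]_N) : set K :=
  [set z | exists2 p : {poly K}, root (char_poly P) p & root p z].

Definition poly_eigenvalue_on (U : set 'cV[K]_N) (P : 'M[{poly K}]_N)
    (Q : {poly K}) : Prop :=
  (exists2 v, U v & v != 0) /\
  forall v, U v -> P *m map_mx polyC v = Q *: map_mx polyC v.

End PolyMatrix.

(* Main.v *)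
Require Import Defs.
From HB Require Import structures.
From mathcomp Require Import all_boot all_order all_algebra all_fingroup.
From mathcomp Require Import finmap complex ring zify.
From mathcomp Require Import all_classical all_reals all_analysis.
Import Order.TTheory GRing.Theory Num.Theory.
Import numFieldNormedType.Exports.
Set Implicit Arguments.
Unset Strict Implicit.
Unset Printing Implicit Defensive.
Local Open Scope classical_set_scope.
Local Open Scope ring_scope.

(* Put [p = 2 kappa hbar] and [x_k[q] = sum_s q_s x^-_{k,s}] for a polynomial [q].
   The difference equation and the q-Cartan identity behind [c] give
   [A(u) x_i[(u - X) q] = x_i[(u + p - X) q] A(u)], so the defect
   [x_i[(u - X) q] T(u) - T(u) x_i[q]] is [T(u)] times a p-periodic function, which
   tends to 0 at infinity by the asymptotics of [T]; hence it vanishes. Applied to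
   words on [Omega], the resulting relation shows that [f^-1 T] agrees with a
   matrix polynomial [P] on a half-plane, and the difference equation propagates
   this to all of C. The relation between [P] and the [x^-_k] makes the
   coefficients of [P] commute, gives the degrees on the weight spaces, and
   identifies the zeros of [det P] with the poles: where [P(z)] is invertible it
   lets one cancel powers of [X - z] in an annihilator of [x^+-_i]; where [z] is
   not a pole, the image of [P(z)] is stable under the [x^-_k] and contains
   [Omega]. A nonzero eigenvalue of [P(z)] on the lowest weight space suffices
   for invertibility because that space generates V under the [x^+_k]. *)

(** * Killing form and Cartan subalgebra *)

(** The Cartan subalgebra, base and form of [L] are given by axioms only, so structural facts are
    derived first: the Casimir eigenvalue makes the Killing form a nonzero multiple of [iform], and
    trace arguments then show that [csa L] is abelian with basis the [sharp (alpha i)]. A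
    representation consists of matrices, with no map from [lie L]; roots are therefore read off the
    Lie algebra generated by the [x^+-_{k,0}] inside the endomorphisms of V. The exchange argument
    for words makes the longest word send these simple roots to negative ones, whence the [x^-] kill
    the lowest weight space. Only the commutation of [A(u)] with the [x^-] is computed. The
    relations of the normalized operator with [xi] and [x^+] follow by induction along words in the
    [x^-] on [Omega]. In the relation with [x^+] the factor [u - X] sits on the other side, so the
    image of [P(z)] is stable under the [x^+] at every [z]; this is why the lowest weight space
    detects all zeros. [A] and [T] are controlled only away from exceptional points, so identities
    live on punctured neighbourhoods or off the zeros of a polynomial until [P] is available. *)

(** [A] and [B] preserve the [a]-eigenspace of [U], on which [U] is the scalar [a]. Being a
    commutator there, it has trace zero, and in characteristic zero this forces [a = 0]. *)
Lemma central_commutator_eigenvalue (K : numClosedFieldType) n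
    (A B U : 'M[K]_n) (a : K) :
  U = A *m B - B *m A -> comm_mx A U -> comm_mx B U ->
  eigenvalue U a -> a = 0.
Proof.
move=> defU cAU cBU Ua; set E := row_base (eigenspace U a).
have fE : row_free E by apply: row_base_free.
have EU : (E <= eigenspace U a)%MS by rewrite eq_row_base.
have st M : comm_mx M U -> stablemx E M.
  by move=> cM; rewrite stablemx_row_base comm_mx_stable_eigenspace.
have := congr1 mxtrace (conjmx_eigenvalue EU fE).
have -> : conjmx E U = conjmx E A *m conjmx E B - conjmx E B *m conjmx E A.
  by rewrite -!conjmxM ?inE ?st // -[RHS]mulmxBl -mulmxBr -defU.
rewrite linearB /= mxtrace_mulC subrr mxtrace_scalar.
move=> /esym/eqP; rewrite mulrn_eq0 mxrank_eq0 => /orP[/eqP E0|/eqP //].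
by move: Ua; rewrite /eigenvalue E0 eqxx.
Qed.

(** In a simultaneous triangular form [A] has zero diagonal, hence so has the product. *)
Lemma mxtrace_comm_nilpotent (K : numClosedFieldType) n (A B : 'M[K]_n) :
  comm_mx A B -> (forall a, eigenvalue A a -> a = 0) -> \tr (A *m B) = 0.
Proof.
move=> cAB A0; have [P Pu /andP[tA tB]] := cotrigonalization2 cAB.
have Punit := unitarymx_unit Pu.
have fP : row_free P by rewrite row_free_unit.
have sP M : stablemx P M by rewrite stablemx_full // row_full_unit.
have -> : \tr (A *m B) = \tr (conjmx P A *m conjmx P B).
  rewrite -conjmxM ?inE ?sP // conjumx //.
  by rewrite [RHS]mxtrace_mulC mulmxA mulVmx // mul1mx.
have dA i : conjmx P A i i = 0.
  apply: A0; apply: (eigenvalue_conjmx (sP A) fP).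
  rewrite -[_ \in _]/(eigenvalue _ _) eigenvalue_root_char char_poly_trig //.
  rewrite -(big_map _ predT (fun x => _ - x%:P)) root_prod_XsubC.
  by apply/mapP; exists i; rewrite ?mem_index_enum.
rewrite /mxtrace big1 // => i _; rewrite mxE big1 // => j _.
have [ij|ij|/val_inj <-] := ltngtP i j.
- by rewrite (is_trig_mxP tA) // mul0r.
- by rewrite (is_trig_mxP tB) // mulr0.
- by rewrite dA mul0r.
Qed.

Lemma mulrV_ext (K : nzRingType) m n (A B : 'M[K]_(m, n)) :
  (forall u : 'rV_m, u *m A = u *m B) -> A = B.
Proof. by move=> AB; apply/row_matrixP => i; rewrite !rowE. Qed.

Lemma free_mktuple (K : fieldType) (vT : vectType K) n (F : 'I_n -> vT) :
  (forall k : 'I_n -> K, \sum_p k p *: F p = 0 -> forall p, k p = 0) ->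
  free [tuple F p | p < n].
Proof.
move=> H; apply/freeP => k E; apply: H; rewrite -[RHS]E.
by apply: eq_bigr => p _; rewrite -tnth_nth tnth_mktuple.
Qed.

Section LieTheory.
Import VectorInternalTheory.
Variables (K : numClosedFieldType) (L : simple_lie K).
Notation g := (lie L).
Notation br := (@lbr K L).
Notation form := (@iform K L).
Notation d := (dim g).

Definition ad (x : g) : g -> g := br x.

Lemma ad_is_linear x : linear (ad x).
Proof. by move=> a y z; case: (lbrP L) => _ + _ _; apply. Qed.

HB.instance Definition _ x :=
  GRing.isLinear.Build K g g *:%R (ad x) (ad_is_linear x).

(** Coordinates are row vectors, so composition of operators reverses the order of the matrices;
    hence the order of the products in [adm_br]. *)
Definition adm (x : g) : 'M[K]_d := lin1_mx (v2r \o ad x \o r2v).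

Lemma v2r_br x v : v2r (br x v) = v2r v *m adm x.
Proof. by rewrite /adm mul_rV_lin1 /= v2rK. Qed.

Lemma brDl a x y z : br (a *: x + y) z = a *: br x z + br y z.
Proof. by case: (lbrP L). Qed.

Lemma br_anti x y : br x y = - br y x.
Proof.
case: (lbrP L) => Dl Dr xx _.
have := xx (1 *: x + y); rewrite Dl !Dr !xx !scale1r add0r addr0.
by move/eqP; rewrite addr_eq0 => /eqP.
Qed.

Lemma adm_lin a x y : adm (a *: x + y) = a *: adm x + adm y.
Proof.
apply: mulrV_ext => u; rewrite -(r2vK u) -v2r_br mulmxDr -scalemxAr -!v2r_br.
by rewrite brDl linearP.
Qed.

Lemma adm0 : adm 0 = 0.
Proof.
apply: mulrV_ext => u; rewrite -(r2vK u) -v2r_br br_anti.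
by rewrite -[br _ _]/(ad _ _) linear0 oppr0 linear0 mulmx0.
Qed.

Lemma adm_br x y : adm (br x y) = adm y *m adm x - adm x *m adm y.
Proof.
apply: mulrV_ext => u; rewrite -(r2vK u) mulmxBr !mulmxA -!v2r_br -linearB.
congr v2r; set z := r2v u; case: (lbrP L) => _ _ _ /(_ x y z) /eqP.
rewrite addr_eq0 => /eqP E; rewrite [LHS]br_anti -E.
by rewrite (br_anti z x) -[br y (- _)]/(ad y _) linearN.
Qed.

Lemma iformDl a x y z : form (a *: x + y) z = a * form x z + form y z.
Proof. by case: (iformP L). Qed.
Lemma iformC x y : form x y = form y x.
Proof. by case: (iformP L). Qed.

Lemma iform0l z : form 0 z = 0.
Proof. by have := iformDl (-1) 0 0 z; rewrite scaler0 addr0 mulN1r addNr. Qed.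
Lemma iformZl a x z : form (a *: x) z = a * form x z.
Proof. by have := iformDl a x 0 z; rewrite iform0l !addr0. Qed.
Lemma iformNl x z : form (- x) z = - form x z.
Proof. by rewrite -scaleN1r iformZl mulN1r. Qed.
Lemma iform_suml (I : Type) (r : seq I) (F : I -> g) z :
  form (\sum_(i <- r) F i) z = \sum_(i <- r) form (F i) z.
Proof.
elim: r => [|i r IH]; first by rewrite !big_nil iform0l.
by rewrite !big_cons -IH -[F i]scale1r iformDl mul1r scale1r.
Qed.

Lemma iform_ndeg x : (forall y, form x y = 0) -> x = 0.
Proof. by case: (iformP L) => _ _ _; apply. Qed.

Let e (p : 'I_d) : g := r2v (delta_mx 0 p).
(** The Gram matrix of the form; its inverse yields the dual basis [Y], so that [kappa2P] can be
    applied to the pair [e], [Y]. *)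
Let G : 'M[K]_d := \matrix_(p, q) form (e p) (e q).
Let Y (q : 'I_d) : g := \sum_r invmx G r q *: e r.

Let coordE v : v = \sum_p v2r v 0 p *: e p.
Proof.
rewrite -[LHS]v2rK {1}[v2r v]row_sum_delta linear_sum /=.
by apply: eq_bigr => p _; rewrite linearZ.
Qed.

Let G_unit : G \in unitmx.
Proof.
rewrite unitmxE unitfE; apply/negP => /det0P [v v0 vG].
have : r2v v = 0.
  apply: iform_ndeg => y; rewrite (coordE y) iformC iform_suml big1 // => q _.
  rewrite iformZl iformC (coordE (r2v v)) iform_suml.
  have /rowP/(_ q) := vG; rewrite !mxE => E.
  rewrite (_ : \sum__ _ = 0) ?mulr0 // -[RHS]E; apply: eq_bigr => p _.
  by rewrite iformZl r2vK mxE.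
by move=> E; move: v0; rewrite -(r2vK v) E linear0 eqxx.
Qed.

Let dualY p q : form (e p) (Y q) = (p == q)%:R.
Proof.
have /matrixP/(_ p q) := mulmxV G_unit; rewrite !mxE => <-.
rewrite iformC /Y iform_suml; apply: eq_bigr => r _.
by rewrite iformZl mxE iformC mulrC.
Qed.

(** Coordinate [p] of a vector is its pairing with [Y p]. Invariance of the form moves both brackets
    in the trace onto the dual bases, where they add up to the Casimir element applied to [x]. *)
Lemma killing_iform x y :
  \tr (adm y *m adm x) = (2 * kappa2 L)%:R * form y x.
Proof.
pose Xt := [tuple e p | p < d]; pose Yt := [tuple Y p | p < d].
have dualXY p q : form (tnth Xt p) (tnth Yt q) = (p == q)%:R.
  by rewrite !tnth_mktuple dualY.
have bX : basis_of fullv Xt.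
  rewrite basisEfree size_tuple dimvf leqnn subvf !andbT.
  apply: free_mktuple => k E p; have := iform0l (Y p); rewrite -E iform_suml.
  rewrite (bigD1 p) //= iformZl dualY eqxx mulr1 big1 ?addr0 // => q qp.
  by rewrite iformZl dualY (negPf qp) mulr0.
have bY : basis_of fullv Yt.
  rewrite basisEfree size_tuple dimvf leqnn subvf !andbT.
  apply: free_mktuple => k E p; have := iform0l (e p); rewrite -E iform_suml.
  rewrite (bigD1 p) //= iformZl iformC dualY eqxx mulr1 big1 ?addr0 // => q qp.
  by rewrite iformZl iformC dualY eq_sym (negPf qp) mulr0.
rewrite -[RHS]/(_ * _) [form y x]iformC -iformZl -(kappa2P bX bY dualXY).
rewrite iform_suml; apply: eq_bigr => p _; rewrite !tnth_mktuple.
transitivity (v2r (br x (br y (e p))) 0 p).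
  by rewrite !v2r_br /e r2vK -mulmxA -rowE [RHS]mxE.
transitivity (form (br x (br y (e p))) (Y p)).
  rewrite [in RHS](coordE (br x (br y (e p)))) iform_suml (bigD1 p) //=.
  rewrite iformZl dualY eqxx mulr1 big1 ?addr0 // => q qp.
  by rewrite iformZl dualY (negPf qp) mulr0.
have inv a b c : form (br a b) c = form a (br b c) by case: (iformP L).
rewrite br_anti iformNl inv inv -iformNl iformC.
rewrite (br_anti x (Y p)) -[br (e p) (- _)]/(ad (e p) _) linearN /= !iformNl.
by rewrite iformC iformNl opprK iformC.
Qed.

Notation h := (csa L).

Lemma vsval_dual_eq0 (t : subvs_of h) :
  (forall b : 'Hom(subvs_of h, K^o), b t = 0) -> t = 0.
Proof.
move=> bt; rewrite (coord_vbasis (memvf t)) big1 // => p _.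
have /(_ (linfun (coord (vbasis fullv) p : subvs_of h -> K^o))) := bt.
by rewrite lfunE /= => ->; rewrite scale0r.
Qed.

(** By [sharpP] every functional on [h] is a pairing with an element of [h], so a vector in the
    radical is killed by all functionals. *)
Lemma iform_csa_ndeg (t : subvs_of h) :
  (forall s : subvs_of h, form (vsval t) (vsval s) = 0) -> t = 0.
Proof. by move=> E; apply: vsval_dual_eq0 => b; rewrite -sharpP iformC E. Qed.

Hypothesis k2_neq0 : kappa2 L != 0%N.

(** The trace of [adm u *m adm t] vanishes for all [t] in [h]; by [killing_iform] this puts [u] into
    the radical of the form on [h]. *)
Lemma nilpotent_ad_csa0 (u : g) : u \in h ->
  (forall t, t \in h -> comm_mx (adm u) (adm t)) ->
  (forall a, eigenvalue (adm u) a -> a = 0) -> u = 0.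
Proof.
move=> uh cu u0; suff : vsproj h u = 0.
  by move/(congr1 (@vsval _ _ _)); rewrite vsprojK // linear0.
apply: iform_csa_ndeg => s; rewrite vsprojK //.
have := killing_iform (vsval s) u; rewrite (mxtrace_comm_nilpotent (cu _ (subvsP s)) u0).
by move/esym/eqP; rewrite mulf_eq0 pnatr_eq0 muln_eq0 (negPf k2_neq0) => /eqP.
Qed.

Lemma csa_closed x y : x \in h -> y \in h -> br x y \in h.
Proof. by case: (csaP L) => + _ _; apply. Qed.

(* The last nonzero term of the lower central series of [h] is central and
   consists of commutators, so it acts nilpotently. *)
Lemma csa_abelian x y : x \in h -> y \in h -> br x y = 0.
Proof.
pose Q m := forall (s : seq g) z, size s = m -> all (fun x => x \in h) s ->
  z \in h -> foldr br z s = 0.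
have Qstep m : Q m.+2 -> Q m.+1.
  move=> Qm [//|w s] z [sm] /= /andP[wh sh] zh; set u' := foldr br z s.
  have u'h : u' \in h.
    rewrite /u'; elim: (s) sh => [//|v s' IH] /= /andP[vh s'h].
    by rewrite csa_closed ?IH.
  have cu t : t \in h -> comm_mx (adm t) (adm (br w u')).
    move=> th; apply/eqP; rewrite -subr_eq0 -adm_br.
    have := Qm [:: t, w & s] z; rewrite /= sm th wh sh => E.
    by rewrite br_anti E // oppr0 adm0.
  apply: nilpotent_ad_csa0 => [|t th|a]; first exact: csa_closed.
    exact/comm_mx_sym/cu.
  apply: central_commutator_eigenvalue (adm_br w u') _ _; exact: cu.
case: (csaP L) => _ [k Qk] _.
have Q1 : Q 1%N.
  have : Q k.+1.
    move=> [//|w s] z [sk] /= /andP[wh sh] zh; rewrite (Qk s) //.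
    by rewrite -[br w 0]/(ad w 0) linear0.
  by elim: k {Qk} => [//|k IH] /Qstep.
by move=> xh yh; have := Q1 [:: x] y; rewrite /= xh; apply.
Qed.

Lemma adm_csa_comm x y : x \in h -> y \in h -> comm_mx (adm x) (adm y).
Proof.
by move=> xh yh; apply/eqP; rewrite -subr_eq0 -adm_br csa_abelian // adm0.
Qed.

(** If [t] is nonzero then [ad t] has an eigenvalue [a != 0]. Since [h] is abelian, its eigenspace
    contains a common eigenvector of [ad h], that is, a root [b] with [b t = a]. But [b] is an
    integral combination of the simple roots, which all vanish at [t]. *)
Lemma alpha_separates (t : subvs_of h) : (forall j, alpha j t = 0) -> t = 0.
Proof.
move=> at0; suff : vsval t = 0 by move=> E; apply: subvs_inj; rewrite E linear0.
apply: nilpotent_ad_csa0 => [|s sh|a ta]; first exact: subvsP.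
  by apply: adm_csa_comm; rewrite ?subvsP.
apply/eqP/negPn/negP => a0; set E := row_base (eigenspace (adm (vsval t)) a).
have stE s : s \in h -> stablemx E (adm s).
  move=> sh; rewrite stablemx_row_base comm_mx_stable_eigenspace //.
  by apply: adm_csa_comm; rewrite ?subvsP.
pose As := [seq conjmx E (adm s) | s <- vbasis h].
have [||w w0 /allP wP] := @common_eigenvector _ _ As.
- by rewrite lt0n mxrank_eq0.
- move=> _ _ /mapP[s /vbasis_mem sh ->] /mapP[r /vbasis_mem rh ->].
  by rewrite /comm_mx -!conjmxM ?inE ?stE // adm_csa_comm.
pose v := w *m E.
have v0 : v != 0 by rewrite mulmx_free_eq0 ?row_base_free.
have stv s : s \in h -> stablemx v (adm s).
  move=> sh; rewrite (coord_vbasis sh).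
  apply: (big_ind (fun s => stablemx v (adm s))).
  - by rewrite adm0 mulmx0 sub0mx.
  - move=> x y xv yv; rewrite -[x]scale1r adm_lin scale1r mulmxDr.
    by rewrite addmx_sub.
  - move=> p _; rewrite -[_ *: _]addr0 adm_lin adm0 addr0 -scalemxAr scalemx_sub //.
    have bp : (vbasis h)`_p \in vbasis h by rewrite mem_nth // size_tuple.
    have /wP : conjmx E (adm (vbasis h)`_p) \in As.
      exact: (map_f (fun s => conjmx E (adm s)) bp).
    rewrite stablemx_restrict // -stablemx_row_base; apply: stE.
    exact: vbasis_mem.
have [p vp] : exists p, v 0 p != 0.
  have /matrix0Pn [q [p]] := v0; rewrite [q]ord1; by exists p.
(* The eigenvalue is read off at a coordinate where [v] does not vanish, which makes its linearity
   in [s] evident. *)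
pose bf (s : subvs_of h) : K^o := (v *m adm (vsval s)) 0 p / v 0 p.
have bf_lin : linear bf.
  move=> c x y; rewrite /bf linearP adm_lin mulmxDr -scalemxAr !mxE mulrDl.
  by rewrite -mulrA.
pose bL := GRing.isLinear.Build K (subvs_of h) K^o *:%R bf bf_lin.
pose bl : {linear subvs_of h -> K^o} := HB.pack bf bL.
pose b := linfun bl.
have vb s : v *m adm (vsval s) = (b s : K) *: v.
  have /sub_rVP [c cE] := stv _ (subvsP s).
  suff -> : (b s : K) = c by [].
  by rewrite lfunE /= /bf cE [(c *: v) 0 p]mxE mulfK.
have bt : b t = a.
  have : (v <= eigenspace (adm (vsval t)) a)%MS.
    by rewrite (submx_trans (submxMl _ _)) ?eq_row_base.
  move/eigenspaceP; rewrite vb => /rowP/(_ p).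
  by rewrite [in LHS]mxE [in RHS]mxE => /(mulIf vp).
have b_root : is_root (@lbr K L) b.
  split; first by apply: contraNneq a0 => E0; rewrite -bt E0 lfunE.
  exists (r2v v) => [|s].
    by apply: contraNneq v0 => E0; rewrite -(r2vK v) E0 linear0.
  by apply: v2r_inj; rewrite v2r_br r2vK vb linearZ /= r2vK.
have [_ _ /(_ _ b_root) [m bE]] := alphaP L.
have sum0 : (\sum_i alpha i *+ m i : 'Hom(subvs_of h, K^o)) t = 0.
  rewrite sum_lfunE big1 // => j _; elim: (m j) => [|n IH].
    by rewrite mulr0n lfunE.
  by rewrite mulrS add_lfunE at0 IH addr0.
move: a0; rewrite -bt; case: bE => ->; rewrite ?opp_lfunE sum0 ?oppr0 eqxx //.
Qed.

Lemma norm_alpha_ge2 i :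
  2 <= form (vsval (sharp (alpha i))) (vsval (sharp (alpha i))).
Proof.
by case: (form_normalized L) => _; apply; case: (alphaP L) => + _ _; apply.
Qed.

Lemma dsym_neq0 (i : 'I_(rank L)) : (dsym i)%:R != 0 :> K.
Proof.
rewrite dsymP mulf_neq0 ?invr_eq0 ?pnatr_eq0 // gt_eqF //.
by rewrite (lt_le_trans _ (norm_alpha_ge2 i)).
Qed.

Lemma alpha_sharp (i j : 'I_(rank L)) :
  (alpha j (sharp (alpha i)) : K) = (dsym i)%:R * (cartan i j)%:~R.
Proof.
have n0 : form (vsval (sharp (alpha i))) (vsval (sharp (alpha i))) != 0.
  by rewrite gt_eqF // (lt_le_trans _ (norm_alpha_ge2 i)).
rewrite -sharpP iformC dsymP cartanP; field.
by rewrite n0.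
Qed.

Lemma alpha_free (k : 'I_(rank L) -> K) :
  \sum_p k p *: alpha p = 0 -> forall p, k p = 0.
Proof.
case: (alphaP L) => _ + _.
have -> : [seq alpha i | i <- enum 'I_(rank L)] = [tuple alpha p | p < rank L].
  by rewrite /= /mktuple.
move=> /freeP H E; apply: H; rewrite -[RHS]E.
by apply: eq_bigr => p _; rewrite -tnth_nth tnth_mktuple.
Qed.

(** Independence is that of the simple roots. For the dimension, the simple roots map [h]
    injectively into a space of dimension [rank L] by [alpha_separates]. *)
Lemma sharp_basis : basis_of fullv [tuple sharp (@alpha K L i) | i < rank L].
Proof.
rewrite basisEfree subvf size_tuple /=; apply/andP; split.
  apply: free_mktuple => k E; apply: alpha_free; apply/lfunP => t.
  rewrite zero_lfunE sum_lfunE; have := iform0l (vsval t).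
  rewrite -{1}(linear0 (@vsval _ _ h)) -E linear_sum iform_suml => {2}<-.
  by apply: eq_bigr => p _; rewrite scale_lfunE linearZ iformZl sharpP.
pose F (t : subvs_of h) : 'rV[K]_(rank L) := \row_j (alpha j t : K).
have Flin : linear F.
  by move=> c x y; apply/rowP => j; rewrite !mxE linearP.
pose FL := GRing.isLinear.Build K (subvs_of h) 'rV[K]_(rank L) *:%R F Flin.
pose Fl : {linear subvs_of h -> 'rV[K]_(rank L)} := HB.pack F FL.
rewrite -(@limg_dim_eq _ _ _ (linfun Fl)) ?dimvf.
  by rewrite (leq_trans (dimvS (subvf _))) // dimvf /dim /= mul1n.
apply/eqP; rewrite -subv0; apply/subvP => t; rewrite memv_cap memv_ker lfunE /=.
move=> /andP[_ /eqP /rowP Ft]; rewrite memv0; apply/eqP/alpha_separates => j.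
by have := Ft j; rewrite !mxE.
Qed.

End LieTheory.

(** * Polynomial combinations of the generators *)

Section PolyFunctional.
Variables (K : nzRingType) (M : lmodType K) (F : nat -> M).

Definition peval (p : {poly K}) : M := \sum_(s < size p) p`_s *: F s.

Lemma peval_wide n (p : {poly K}) :
  (size p <= n)%N -> peval p = \sum_(s < n) p`_s *: F s.
Proof.
move=> pn; rewrite /peval (big_ord_widen n (fun s => p`_s *: F s)) //.
rewrite [RHS](bigID (fun s : 'I_n => (s < size p)%N)) /= [X in _ = _ + X]big1.
  by rewrite addr0.
by move=> s; rewrite -leqNgt => sp; rewrite nth_default ?scale0r.
Qed.

Lemma peval_is_linear : linear peval.
Proof.
move=> a p q; pose n := maxn (size p) (maxn (size q) (size (a *: p + q))).
rewrite !(@peval_wide n) ?leq_max ?leqnn ?orbT //.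
rewrite scaler_sumr -big_split /=; apply: eq_bigr => s _.
by rewrite coefD coefZ scalerDl scalerA.
Qed.

HB.instance Definition _ :=
  GRing.isLinear.Build K {poly K} M *:%R peval peval_is_linear.

Lemma pevalXn n : peval 'X^n = F n.
Proof.
rewrite (@peval_wide n.+1) ?size_polyXn // big_ord_recr /= coefXn eqxx scale1r.
by rewrite big1 ?add0r // => s _; rewrite coefXn ltn_eqF // scale0r.
Qed.

End PolyFunctional.

Lemma scaler_combB (K : nzRingType) (M : lmodType K) (a : K) (x y z t : M) :
  a *: x + y - (a *: z + t) = a *: (x - z) + (y - t).
Proof. by rewrite scalerBr opprD addrACA. Qed.

Lemma poly_lin_ind (K : nzRingType) (Q : {poly K} -> Prop) :
  (forall a p q, Q p -> Q q -> Q (a *: p + q)) -> (forall n, Q 'X^n) ->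
  forall p, Q p.
Proof.
move=> Ql Qn p.
have Q0 : Q 0 by have := Ql (-1) _ _ (Qn 0%N) (Qn 0%N); rewrite scaleN1r addNr.
rewrite -[p]coefK poly_def; apply: (big_ind Q) => // [x y Qx Qy|i _].
  by rewrite -[x]scale1r; apply: Ql.
by rewrite -[_ *: _]addr0; apply: Ql.
Qed.

(** For a [t] separating the weight of [F y] from [mu], the operator [H t - m y t] removes [F y]
    from the sum and multiplies [v] by a nonzero scalar, so induction applies to the shorter sum. *)
Lemma weight_vectors_independent (K : fieldType) (M : lmodType K) (T : Type)
    (H : T -> {linear M -> M}) (I : eqType) (s : seq I) (m : I -> T -> K)
    (F : I -> M) (mu : T -> K) (v : M) :
  (forall x, x \in s -> forall t, H t (F x) = m x t *: F x) ->
  (forall x, x \in s -> exists t, m x t != mu t) ->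
  (forall t, H t v = mu t *: v) -> v = \sum_(x <- s) F x -> v = 0.
Proof.
elim: s F v => [|y s IH] F v HF sep Hv; first by rewrite big_nil.
rewrite big_cons => vE.
have [t yt] := sep y (mem_head _ _).
suff : (mu t - m y t) *: v = 0.
  by move/eqP; rewrite scaler_eq0 subr_eq0 eq_sym (negPf yt) => /eqP.
apply: (IH (fun x => (m x t - m y t) *: F x)).
- by move=> x xs r; rewrite linearZ /= HF ?in_cons ?xs ?orbT // !scalerA mulrC.
- by move=> x xs; apply: sep; rewrite in_cons xs orbT.
- by move=> r; rewrite linearZ /= Hv !scalerA mulrC.
- rewrite scalerBl -Hv vE linearD linear_sum HF ?mem_head //= scalerDr opprD.
  rewrite addrACA subrr add0r scaler_sumr -sumrB.
  by apply: eq_big_seq => x xs; rewrite HF ?in_cons ?xs ?orbT // scalerBl.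
Qed.

(** If [kappa2 L] were zero, the convention [0^-1 = 0] would make the stated inverse of [Bq] the
    zero matrix; the index [i] guarantees that the matrix is not empty. *)
Lemma kappa2_neq0 (K : numClosedFieldType) (L : simple_lie K)
    (c : 'I_(rank L) -> 'I_(rank L) -> {fsfun int -> nat with 0%N}) :
  inverse_qcartan c -> 'I_(rank L) -> kappa2 L != 0%N.
Proof.
move=> [uB iB] i; apply/eqP => k0.
have B0 : invmx (Bq L) = 0.
  by rewrite iB k0 /qint oppr0 expr0z subrr mul0r invr0 scale0r.
have := mulmxV uB; rewrite B0 mulmx0 => /matrixP/(_ i i); rewrite !mxE eqxx.
by move/eqP; rewrite eq_sym oner_eq0.
Qed.

(** * Action of the Cartan subalgebra and cyclic generation *)

Section YangianAlgebra.
Variables (C : numClosedFieldType) (L : simple_lie C) (hbar : C) (N : nat).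
Notation n := (rank L).
Notation h := (csa L).
Notation hdual := 'Hom(subvs_of h, C^o).
Variable V : yangian_rep L hbar N.
Hypothesis k2_neq0 : kappa2 L != 0%N.
Notation "[! A , B ]" := (comm_mx_bracket A B) (at level 0).

Definition sharps : n.-tuple (subvs_of h) := [tuple sharp (alpha i) | i < n].

(* [cartan_act], [wt_space], and below [expands], [xi_ser], [x_ser], [poles], [Aop]
   restate over an arbitrary [K] the notions defined for [K = Cx R]. *)
Definition cartan_act (t : subvs_of h) : 'M[C]_N :=
  \sum_i coord sharps i t *: xi V i 0%N.

Definition wt_space (mu : hdual) : set 'cV[C]_N :=
  [set v | forall t, cartan_act t *m v = (mu t : C) *: v].

Lemma coord_sharps (t : subvs_of h) :
  t = \sum_i coord (sharps) i t *: sharp (alpha i).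
Proof.
rewrite {1}(@coord_basis _ _ fullv _ sharps t) ?memvf //; last exact: sharp_basis.
by apply: eq_bigr => i _; rewrite -tnth_nth tnth_mktuple.
Qed.

Lemma cartan_act_is_linear : linear (cartan_act).
Proof.
move=> a x y; rewrite /cartan_act scaler_sumr -big_split /=; apply: eq_bigr => i _.
by rewrite linearP scalerDl scalerA.
Qed.

HB.instance Definition _ :=
  GRing.isLinear.Build C (subvs_of h) 'M[C]_N *:%R (cartan_act) cartan_act_is_linear.

Lemma cartan_act_sharp k : cartan_act (sharp (alpha k)) = xi V k 0.
Proof.
have fd : free sharps by apply: (@basis_free _ _ fullv); exact: sharp_basis.
have -> : sharp (alpha k) = sharps`_k by rewrite -tnth_nth tnth_mktuple.
rewrite /cartan_act (bigD1 k) //= coord_free // eqxx scale1r big1 ?addr0 // => j jk.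
by rewrite coord_free // eq_sym (negPf jk) scale0r.
Qed.

Lemma cartan_act_x t e j s :
  cartan_act t *m xpm V e j s =
  xpm V e j s *m cartan_act t + (sgnb C e * (alpha j t : C)) *: xpm V e j s.
Proof.
have -> : (alpha j t : C) =
    \sum_i coord (sharps) i t * ((dsym i)%:R * (cartan i j)%:~R).
  rewrite {1}(coord_sharps t) linear_sum; apply: eq_bigr => i _.
  by rewrite linearZ /= alpha_sharp.
rewrite mulr_sumr scaler_suml.
rewrite /cartan_act mulmx_suml mulmx_sumr -big_split /=; apply: eq_bigr => i _.
rewrite -scalemxAl -scalemxAr.
have := xi0_x V e i j s; rewrite /comm_mx_bracket => /eqP.
rewrite subr_eq => /eqP ->; rewrite scalerDr addrC scalerA; congr (_ + _ *: _).
by rewrite !mulrA [sgnb _ _ * _]mulrC.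
Qed.

Lemma cartan_act_xi t j s : cartan_act t *m xi V j s = xi V j s *m cartan_act t.
Proof.
rewrite /cartan_act mulmx_suml mulmx_sumr; apply: eq_bigr => i _.
rewrite -scalemxAl -scalemxAr; congr (_ *: _).
by apply/eqP; rewrite -subr_eq0; apply/eqP/(xi_xi V).
Qed.

Lemma x_weight e k s (mu : hdual) v : wt_space mu v ->
  wt_space (mu + sgnb C e *: alpha k) (xpm V e k s *m v).
Proof.
move=> muv t; rewrite mulmxA cartan_act_x mulmxDl -mulmxA muv -scalemxAl -scalemxAr.
by rewrite -scalerDl lfunE /= scale_lfunE.
Qed.

(* Multiplying [p] by ['X] shifts the index [s] of the generators [x_{k,s}]. *)
Definition xs e k (p : {poly C}) : 'M[C]_N := peval (xpm V e k) p.
Definition xis k (p : {poly C}) : 'M[C]_N := peval (xi V k) p.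
Definition ac e (j k : 'I_n) : C :=
  sgnb C e * hbar * ((dsym j)%:R * (cartan j k)%:~R / 2).

HB.instance Definition _ e k := GRing.Linear.copy (xs e k) (peval (xpm V e k)).
HB.instance Definition _ k := GRing.Linear.copy (xis k) (peval (xi V k)).

Lemma xsXn e k s : xs e k 'X^s = xpm V e k s. Proof. exact: pevalXn. Qed.
Lemma xisXn k s : xis k 'X^s = xi V k s. Proof. exact: pevalXn. Qed.

Lemma cartan_act_xs t e j p :
  cartan_act t *m xs e j p =
  xs e j p *m cartan_act t + (sgnb C e * (alpha j t : C)) *: xs e j p.
Proof.
elim/poly_lin_ind: p => [a p q Ep Eq|s]; last by rewrite xsXn cartan_act_x.
rewrite linearP mulmxDr mulmxDl -scalemxAl -scalemxAr Ep Eq.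
by rewrite !scalerDr !scalerA addrACA [_ * a]mulrC.
Qed.

Lemma xi0_xs e j k p :
  xi V j 0 *m xs e k p =
  xs e k p *m xi V j 0 + (sgnb C e * (dsym j)%:R * (cartan j k)%:~R) *: xs e k p.
Proof. by rewrite -cartan_act_sharp cartan_act_xs alpha_sharp !mulrA. Qed.

(** The defining relation with all terms in [xi_{j,r}] collected on one side. It lowers the index of
    [xi] at the price of a factor [X + a] or [X - a] in the argument, which drives the inductions on
    [r]. *)
Lemma xi_xs e j k r p :
  xi V j r.+1 *m xs e k p - xs e k p *m xi V j r.+1 =
  xi V j r *m xs e k (('X + (ac e j k)%:P) * p)
  - xs e k (('X - (ac e j k)%:P) * p) *m xi V j r.
Proof.
elim/poly_lin_ind: p => [a p q Ep Eq|s].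
  have E c : xs e k (c * (a *: p + q)) = a *: xs e k (c * p) + xs e k (c * q).
    by rewrite mulrDr -scalerAr linearP.
  rewrite !E linearP /= !mulmxDr !mulmxDl -!scalemxAl -!scalemxAr.
  by rewrite scaler_combB [RHS]scaler_combB Ep Eq.
have := xi_x V e j k r s; rewrite /comm_mx_bracket => /eqP; rewrite subr_eq => /eqP.
rewrite !xsXn mulrDl mulrBl -exprS !mul_polyC (linearD (xs e k)) (linearB (xs e k)) /= !(linearZ_LR (xs e k)) /= !xsXn.
move=> ->; rewrite mulmxDr mulmxBl -scalemxAr -scalemxAl -/(ac e j k) scalerDr.
by rewrite opprB [LHS](AC (2*2) ((3*1)*(2*4))).
Qed.

Lemma xs_xs_bracket j k p q :
  xs true j p *m xs false k q - xs false k q *m xs true j p =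
  if j == k then xis j (p * q) else 0.
Proof.
elim/poly_lin_ind: p => [a p p' Ep Ep'|r].
  rewrite linearP mulmxDl mulmxDr -scalemxAl -scalemxAr opprD addrACA -scalerBr.
  rewrite Ep Ep'; case: eqP => _; rewrite ?scaler0 ?addr0 //.
  by rewrite mulrDl -scalerAl linearP.
elim/poly_lin_ind: q => [a p p' Ep Ep'|s].
  rewrite linearP mulmxDl mulmxDr -scalemxAl -scalemxAr opprD addrACA -scalerBr.
  rewrite Ep Ep'; case: eqP => _; rewrite ?scaler0 ?addr0 //.
  by rewrite mulrDr -scalerAr linearP.
rewrite !xsXn -exprD xisXn; have := xp_xm V j k r s; rewrite /comm_mx_bracket => ->.
by [].
Qed.

(* Vectors obtained from [v0] by the operators [x^e] form a submodule, by
   induction on the number of operators. *)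
Lemma generated_ind e (v0 : 'cV[C]_N) :
  (forall k r, xpm V (~~ e) k r *m v0 = 0) ->
  (forall k r, exists m : C, xi V k r *m v0 = m *: v0) ->
  (forall U : {vspace 'cV[C]_N}, v0 \in U ->
    (forall i r v, v \in U -> xi V i r *m v \in U) ->
    (forall e i r v, v \in U -> xpm V e i r *m v \in U) -> U = fullv) ->
  forall Q : 'cV[C]_N -> Prop, Q v0 ->
  (forall a v w, Q v -> Q w -> Q (a *: v + w)) ->
  (forall k r v, Q v -> Q (xpm V e k r *m v)) ->
  forall v, Q v.
Proof.
move=> killed eigen gen Q Q0 Qlin Qx.
pose wv (w : seq ('I_n * nat)) := foldr (fun kr v => xpm V e kr.1 kr.2 *m v) v0 w.
(* Finitely many words suffice: as long as some word vector lies outside the span, adding it raises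
   the dimension, which is bounded by that of the whole space. *)
have [ws wsP] : exists ws, forall w, wv w \in <<map wv ws>>%VS.
  have H m : (exists ws, forall w, wv w \in <<map wv ws>>%VS) \/
      exists ws, (m <= \dim <<map wv ws>>)%N.
    elim: m => [|m [IH|[ws mws]]]; [by right; exists [::] | by left |].
    have [E|/existsNP[w /negP ww]] := pselect (forall w, wv w \in <<map wv ws>>%VS).
      by left; exists ws.
    right; exists (w :: ws); rewrite /= span_cons (leq_ltn_trans mws) //.
    rewrite ltnNge; apply: contra ww => ww.
    have := eqEdim <<map wv ws>>%VS (<[wv w]> + <<map wv ws>>)%VS.
    by rewrite addvSr ww => /eqP ->; rewrite (subvP (addvSl _ _)) ?memv_line.
  have [//|[ws]] := H (\dim {:'cV[C]_N}).+1.
  by rewrite ltnNge (dimvS (subvf _)).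
set U := <<map wv ws>>%VS in wsP.
have stab (A : 'M[C]_N) : (forall w, A *m wv w \in U) ->
    forall v, v \in U -> A *m v \in U.
  move=> AU v; rewrite -[A *m v]/(mulmx A v) -lfunE memv_preim.
  apply/subvP; apply/span_subvP => _ /mapP[w _ ->].
  by rewrite -memv_preim lfunE; apply: AU.
have xU k r v : v \in U -> xpm V e k r *m v \in U.
  by apply: stab => w; apply: (wsP ((k, r) :: w)).
have xsU k p v : v \in U -> xs e k p *m v \in U.
  move=> vU; elim/poly_lin_ind: p => [a p q Ep Eq|s]; last by rewrite xsXn xU.
  by rewrite linearP mulmxDl -scalemxAl rpredD ?rpredZ.
have xiU w : forall k r, xi V k r *m wv w \in U.
  elim: w => [|[j s] w IH] k r.
    by have [m /= ->] := eigen k r; rewrite rpredZ // (wsP [::]).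
  rewrite /= -xsXn; move: ('X^s) => p; elim: r p => [|r IHr] p.
    rewrite mulmxA xi0_xs mulmxDl -scalemxAl -mulmxA.
    by rewrite rpredD ?rpredZ ?xsU // (wsP w).
  rewrite mulmxA; have /eqP := xi_xs e k j r p; rewrite subr_eq => /eqP ->.
  rewrite mulmxDl mulmxBl -!mulmxA.
  by rewrite rpredD ?rpredB ?xsU ?IHr.
have x'U w : forall k r, xpm V (~~ e) k r *m wv w \in U.
  elim: w => [|[j s] w IH] k r; first by rewrite /= killed rpred0.
  have : [! xpm V (~~ e) k r, xpm V e j s] *m wv w \in U.
    case: (e); rewrite /= /comm_mx_bracket -!xsXn.
      rewrite -opprB xs_xs_bracket mulNmx rpredN.
      case: eqP => _; last by rewrite mul0mx rpred0.
      by rewrite -exprD xisXn.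
    rewrite xs_xs_bracket.
    case: eqP => _; last by rewrite mul0mx rpred0.
    by rewrite -exprD xisXn.
  rewrite /comm_mx_bracket mulmxBl -!mulmxA => H.
  by rewrite -(subrK (xpm V e j s *m (xpm V (~~ e) k r *m wv w)) (_ *m _)) rpredD ?xU.
have Ufull : U = fullv.
  apply: gen; first exact: (wsP [::]).
    by move=> i r; apply: stab.
  move=> e' i r; apply: stab => w.
  have [->|->] : e' = e \/ e' = ~~ e by case: (e) (e') => [] []; auto.
    exact: xU.
  exact: x'U.
have Qz : Q 0 by have := Qlin (-1) _ _ Q0 Q0; rewrite scaleN1r addNr.
have Qw w : Q (wv w) by elim: w => [//|kr w IH] /=; apply: Qx.
move=> v; have : v \in U by rewrite Ufull memvf.
rewrite /U -[map wv ws]/(tval (in_tuple (map wv ws))) => /coord_span ->.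
apply: (big_ind Q) => // [x y Qx' Qy|i _].
  by rewrite -[x]scale1r; apply: Qlin.
rewrite -[_ *: _]addr0; apply: Qlin => //.
rewrite (nth_map [::]); first exact: Qw.
by rewrite -[size ws](size_map wv); exact: ltn_ord.
Qed.

End YangianAlgebra.

(** * Weyl group symmetry of weights *)

Section Sl2.
Variables (K : numFieldType) (M : lmodType K) (E F H : {linear M -> M}).
Variable d : nat.
Hypothesis EF : forall v, E (F v) = F (E v) + H v.
Hypothesis HE : forall v, H (E v) = E (H v) + (2 * d)%:R *: E v.
Hypothesis HF : forall v, H (F v) = F (H v) - (2 * d)%:R *: F v.

Lemma iter_linB (G : {linear M -> M}) p a x y :
  iter p G (x - a *: y) = iter p G x - a *: iter p G y.
Proof. by elim: p => [|p IH] //=; rewrite IH linearB linearZ. Qed.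

(** [H] plays the role of [d] times a coroot, as [xi_{k,0}] does, hence steps of [2 * d]. *)
Lemma sl2_iterE p v (m : K) : H v = m *: v ->
  H (iter p E v) = (m + (2 * d * p)%:R) *: iter p E v.
Proof.
move=> Hv; elim: p => [|p IH] /=; first by rewrite muln0 addr0.
by rewrite HE IH linearZ -scalerDl -addrA -natrD mulnSr.
Qed.

Lemma sl2_iterF p v (m : K) : H v = m *: v ->
  H (iter p F v) = (m - (2 * d * p)%:R) *: iter p F v.
Proof.
move=> Hv; elim: p => [|p IH] /=; first by rewrite muln0 subr0.
by rewrite HF IH linearZ -scalerBl -addrA -opprD -natrD mulnSr.
Qed.

(** The polynomial with root list [l], evaluated at the operator [F E] and applied to [v]. *)
Fixpoint factors (l : seq K) (v : M) : M :=
  if l is a :: l' then factors l' (F (E v) - a *: v) else v.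

Lemma factors_FE l a v :
  factors l (F (E v) - a *: v) = F (E (factors l v)) - a *: factors l v.
Proof.
elim: l v => [|b l IH] v //=; rewrite -IH; congr factors.
have FEB c u w : F (E (u - c *: w)) = F (E u) - c *: F (E w).
  by rewrite (linearB E) (linearB F) (linearZ_LR E) (linearZ_LR F).
rewrite !FEB !scalerBr !scalerA !opprB [b * a]mulrC.
by rewrite [LHS](AC (2*2) ((1*4)*(3*2))).
Qed.

Lemma factors_eigen a l v : F (E v) = a *: v ->
  factors l v = (\prod_(b <- l) (a - b)) *: v.
Proof.
elim: l v => [|b l IH] v Ev /=; first by rewrite big_nil scale1r.
rewrite Ev -scalerBl IH; first by rewrite scalerA big_cons mulrC.
by rewrite !linearZ /= Ev !scalerA mulrC.
Qed.

(** The vector [(F E - a) v] is killed by both shorter products, so it is zero by induction. Then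
    [v] is an eigenvector of [F E] with eigenvalue [a], on which the factors of [l'] act by nonzero
    scalars. *)
Lemma factors_coprime (l l' : seq K) v :
  (forall a b, a \in l -> b \in l' -> a != b) ->
  factors l v = 0 -> factors l' v = 0 -> v = 0.
Proof.
elim: l v => [|a l IH] v ll' //= la l'v.
have aE : F (E v) = a *: v.
  apply/eqP; rewrite -subr_eq0; apply/eqP/IH => //.
    by move=> x y xl; apply: ll'; rewrite in_cons xl orbT.
  by rewrite factors_FE l'v !linear0 ?scaler0 ?subr0 ?oppr0 ?addr0.
apply/eqP; move/eqP: l'v; rewrite (factors_eigen _ aE) scaler_eq0 => /orP[|//].
rewrite prodf_seq_eq0 => /hasP[b bl']; rewrite subr_eq0 /= => /eqP ab.
by have := ll' a b (mem_head _ _) bl'; rewrite ab eqxx.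
Qed.

Lemma factors_iterE p v (m : nat) : H v = (d * m)%:R *: v ->
  iter p F (iter p E v) =
  factors (rev [seq (d * (j * (m + j.+1)))%:R | j <- iota 0 p]) v.
Proof.
(* Moving [F] past [q] copies of [E] collects the eigenvalues [d m + 2 d j] of [H] for [j] from 1 to
   [q], whose sum is [d q (m + q + 1)]. *)
have FEe q w : H w = (d * m)%:R *: w ->
    F (E (iter q E w)) = iter q E (F (E w) - (d * (q * (m + q.+1)))%:R *: w).
  move=> Hw; elim: q => [|q IH]; first by rewrite mul0n muln0 scale0r subr0.
  have FE u : F (E u) = E (F u) - H u by rewrite EF addrK.
  rewrite FE {1}iterS IH.
  rewrite (sl2_iterE q.+1 Hw) -iterS !iter_linB -addrA -opprD -scalerDl -!natrD.
  congr (_ - (_)%:R *: _).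
  by lia.
elim: p v => [|p IH] v Hv //.
rewrite -addn1 iotaD map_cat rev_cat /= add0n addn1 -IH.
  by rewrite [iter p.+1 F _]iterSr iterS FEe.
rewrite linearB linearZ /= HF HE Hv [E (_ *: v)]linearZ linearD linearZ /=.
by rewrite linearZ /= addrK scalerBr !scalerA [_ * (d * m)%:R]mulrC.
Qed.

Lemma factors_iterF p v (m : nat) : (p <= m)%N -> H v = (d * m)%:R *: v ->
  iter p E (iter p F v) =
  factors (rev [seq - (d * (j.+1 * (m - j)))%:R | j <- iota 0 p]) v.
Proof.
(* Here the eigenvalues [d m - 2 d j] for [j] from 0 to [q] are collected, with sum
   [d (q + 1) (m - q)]; the bound on [q] makes the truncated subtraction exact. *)
have EFf q w : (q <= m)%N -> H w = (d * m)%:R *: w ->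
    E (F (iter q F w)) = iter q F (F (E w) - (- (d * (q.+1 * (m - q)))%:R) *: w).
  move=> qm Hw; elim: q qm => [|q IH] qm.
    by rewrite /= EF Hw scaleNr opprK mul1n subn0.
  rewrite EF {1}iterS IH 1?ltnW //.
  rewrite (sl2_iterF q.+1 Hw) -iterS !iter_linB -addrA; congr (_ + _).
  rewrite !scaleNr !opprK -scalerDl; congr (_ *: _).
  by rewrite addrA -natrD -natrB; [congr _%:R|]; nia.
elim: p v => [|p IH] v pm Hv //.
rewrite -addn1 iotaD map_cat rev_cat /= add0n addn1 -IH 1?ltnW //.
  by rewrite [iter p.+1 E _]iterSr iterS EFf 1?ltnW.
rewrite linearB linearZ /= HF HE Hv [E (_ *: v)]linearZ linearD linearZ /=.
by rewrite linearZ /= addrK scalerBr !scalerA [_ * (d * m)%:R]mulrC.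
Qed.

(* [F^m] is injective on the vectors of weight [m]: both [F^p E^p] and [E^m F^m]
   are polynomials in [F E] there, with no common root. *)
Lemma sl2_reflect (m p : nat) v : (0 < d)%N -> H v = (d * m)%:R *: v ->
  iter p E v = 0 -> iter m F v = 0 -> v = 0.
Proof.
move=> d0 Hv Ev Fv.
have i0 (G : {linear M -> M}) q : iter q G 0 = 0.
  by elim: q => [|q IH] //=; rewrite IH linear0.
apply: (@factors_coprime (rev [seq (d * (j * (m + j.+1)))%:R | j <- iota 0 p])
  (rev [seq - (d * (j.+1 * (m - j)))%:R | j <- iota 0 m])); last 2 first.
- by rewrite -(factors_iterE p Hv) Ev i0.
- by rewrite -(factors_iterF (leqnn m) Hv) Fv i0.
(* The roots of the first product are nonnegative; those of the second are strictly negative because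
   [q < m] and [0 < d]. *)
move=> a b; rewrite !mem_rev => /mapP[j _ ->] /mapP[q].
rewrite mem_iota add0n => /andP[_ qm] ->.
rewrite -subr_eq0 opprK -natrD pnatr_eq0 addn_eq0 negb_and [X in _ || X](_ : _ = true) ?orbT //.
by rewrite -lt0n !muln_gt0 d0 subn_gt0 qm.
Qed.

End Sl2.

(** Nonzero iterates would be eigenvectors of [H] for pairwise distinct eigenvalues, hence more
    independent vectors than the dimension allows. *)
Lemma iter_weight_nilpotent (K : numFieldType) (M : vectType K) (X H : {linear M -> M})
    (m c : K) (v : M) :
  c != 0 -> (forall p, H (iter p X v) = (m + c * p%:R) *: iter p X v) ->
  exists p, iter p X v = 0.
Proof.
move=> c0 HX; apply: contrapT => /forallNP N.
pose w (p : 'I_(\dim {:M}).+1) := iter p X v.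
suff : free [tuple w p | p < (\dim {:M}).+1].
  rewrite /free size_tuple => /eqP E.
  by have := dimvS (subvf <<[tuple w p | p < (\dim {:M}).+1]>>%VS); rewrite E ltnn.
apply: free_mktuple => k E p; apply/eqP/negPn/negP => kp.
have : k p *: w p = 0.
  apply: (@weight_vectors_independent _ _ unit (fun _ => H) _
    [seq q <- index_enum _ | q != p] (fun q _ => m + c * q%:R)
    (fun q : 'I_(\dim {:M}).+1 => - (k q *: w q)) (fun _ => m + c * p%:R)).
  - by move=> q _ _; rewrite linearN linearZ /= HX scalerN !scalerA mulrC.
  - move=> q; rewrite mem_filter => /andP[qp _]; exists tt.
    by rewrite (inj_eq (addrI _)) (inj_eq (mulfI c0)) eqr_nat.
  - by move=> _; rewrite linearZ /= HX !scalerA mulrC.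
  - rewrite big_filter sumrN; apply/eqP; rewrite -addr_eq0.
    by move: E; rewrite (bigD1 p) //= => ->.
by move/eqP; rewrite scaler_eq0 (negPf kp) => /eqP /N.
Qed.

Lemma sl2_reflection (K : numFieldType) (M : vectType K) (E F H : {linear M -> M})
    (d m : nat) v :
  (0 < d)%N -> (forall v, E (F v) = F (E v) + H v) ->
  (forall v, H (E v) = E (H v) + (2 * d)%:R *: E v) ->
  (forall v, H (F v) = F (H v) - (2 * d)%:R *: F v) ->
  H v = (d * m)%:R *: v -> iter m F v = 0 -> v = 0.
Proof.
move=> d0 EF HE HF Hv.
have [p Ep] : exists p, iter p E v = 0.
  apply: (@iter_weight_nilpotent _ _ E H (d * m)%:R (2 * d)%:R).
    by rewrite pnatr_eq0 -lt0n muln_gt0.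
  by move=> p; rewrite (sl2_iterE HE p Hv) [(2 * d * p)%:R]natrM.
exact: (sl2_reflect EF HE HF d0 Hv Ep).
Qed.

(** * Simple reflections and integral weights *)

Section Weyl.
Variables (K : numClosedFieldType) (L : simple_lie K).
Notation n := (rank L).
Notation h := (csa L).
Notation hdual := 'Hom(subvs_of h, K^o).

Lemma reflection_is_linear (k : 'I_n) : linear (@reflection K L k).
Proof.
move=> a x y; rewrite /reflection add_lfunE scale_lfunE scalerDl opprD addrACA.
by rewrite scalerBr scalerA.
Qed.

HB.instance Definition _ k :=
  GRing.isLinear.Build K hdual hdual *:%R (@reflection K L k)
    (reflection_is_linear k).

Lemma alpha_coroot (j k : 'I_n) : (alpha j (coroot k) : K) = (cartan k j)%:~R.
Proof. by rewrite linearZ /= alpha_sharp; apply: mulKf; apply: dsym_neq0. Qed.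

Lemma cartan_diag (k : 'I_n) : cartan k k = 2.
Proof.
apply: (@intr_inj K); rewrite cartanP mulfK //.
by rewrite gt_eqF // (lt_le_trans _ (norm_alpha_ge2 k)).
Qed.

Lemma reflection_alpha (k : 'I_n) : reflection k (alpha k) = - alpha k.
Proof.
rewrite /reflection alpha_coroot cartan_diag.
by apply/eqP; rewrite -subr_eq0 opprK addrAC -mulr2n -scaler_nat subrr.
Qed.

Lemma reflectionK (k : 'I_n) : involutive (@reflection K L k).
Proof.
move=> mu; rewrite {2}/reflection linearB linearZ /= reflection_alpha scalerN opprK.
by rewrite /reflection subrK.
Qed.

Lemma weyl_word_cat s t (mu : hdual) :
  weyl_word (s ++ t) mu = weyl_word s (weyl_word t mu).
Proof. exact: foldr_cat. Qed.

Lemma weyl_word_revK s (mu : hdual) : weyl_word (rev s) (weyl_word s mu) = mu.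
Proof.
elim: s mu => [|k s IH] mu //.
by rewrite rev_cons -cats1 weyl_word_cat /= reflectionK IH.
Qed.

Lemma weyl_wordK s (mu : hdual) : weyl_word s (weyl_word (rev s) mu) = mu.
Proof. by rewrite -{1}[s]revK weyl_word_revK. Qed.

Lemma weyl_wordB s : {morph @weyl_word K L s : x y / x - y}.
Proof. by elim: s => [|k s IH] x y //=; rewrite IH linearB. Qed.

Lemma weyl_wordZ s a x : @weyl_word K L s (a *: x) = a *: weyl_word s x.
Proof. by elim: s => [|k s IH] //=; rewrite IH linearZ. Qed.

Lemma weyl_wordN s x : @weyl_word K L s (- x) = - weyl_word s x.
Proof. by rewrite -[in LHS]scaleN1r weyl_wordZ scaleN1r. Qed.

Definition dual_form (x y : hdual) : K := x (sharp y).

Lemma dual_formC x y : dual_form x y = dual_form y x.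
Proof. by rewrite /dual_form -!sharpP iformC. Qed.

Lemma dual_formBl x y z : dual_form (x - y) z = dual_form x z - dual_form y z.
Proof. by rewrite /dual_form add_lfunE opp_lfunE. Qed.
Lemma dual_formZl a x z : dual_form (a *: x) z = a * dual_form x z.
Proof. by rewrite /dual_form scale_lfunE. Qed.

Lemma eval_coroot (x : hdual) k :
  (x (coroot k) : K) = (dsym k)%:R^-1 * dual_form x (alpha k).
Proof. by rewrite linearZ. Qed.

Lemma dual_form_alpha k : dual_form (alpha k) (alpha k) = 2 * (dsym k)%:R :> K.
Proof. by rewrite /dual_form alpha_sharp cartan_diag mulrC. Qed.

Lemma reflection_isometry k x y :
  dual_form (reflection k x) (reflection k y) = dual_form x y.
Proof.
have Br u v w : dual_form u (v - w) = dual_form u v - dual_form u w.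
  by rewrite dual_formC dual_formBl ![dual_form _ u]dual_formC.
have Zr a u v : dual_form u (a *: v) = a * dual_form u v.
  by rewrite dual_formC dual_formZl dual_formC.
rewrite /reflection !dual_formBl !dual_formZl !Br !Zr dual_form_alpha.
rewrite [dual_form (alpha k) y]dual_formC !eval_coroot.
by field; rewrite dsym_neq0.
Qed.

Lemma weyl_isometry s x y :
  dual_form (weyl_word s x) (weyl_word s y) = dual_form x y.
Proof. by elim: s => [|k s IH] //=; rewrite reflection_isometry IH. Qed.

Definition integral_weight (mu : hdual) := forall k, exists z : int, (mu (coroot k) : K) = z%:~R.

Lemma integral_alpha j : integral_weight (alpha j).
Proof. by move=> k; exists (cartan k j); rewrite alpha_coroot. Qed.

Lemma integral_weightD x y : integral_weight x -> integral_weight y -> integral_weight (x + y).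
Proof.
move=> Ix Iy k; have [a xE] := Ix k; have [b yE] := Iy k.
by exists (a + b); rewrite add_lfunE xE yE rmorphD.
Qed.

Lemma integral_weightZ (z : int) x : integral_weight x -> integral_weight (z%:~R *: x).
Proof.
move=> Ix k; have [a xE] := Ix k.
by exists (z * a); rewrite scale_lfunE xE rmorphM.
Qed.

Lemma integral_reflection k x : integral_weight x -> integral_weight (reflection k x).
Proof.
move=> Ix; have [a xE] := Ix k; rewrite /reflection xE -scaleNr.
by rewrite -rmorphN; apply: integral_weightD => //; apply/integral_weightZ/integral_alpha.
Qed.

Lemma integral_weyl s x : integral_weight x -> integral_weight (weyl_word s x).
Proof. by move=> Ix; elim: s => [|k s IH] //=; apply: integral_reflection. Qed.

(** * Lifting reflections to a module, applied to [V] and to the adjoint action on its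
    endomorphisms *)

Section CartanModule.
Variables (M : vectType K) (X : bool -> 'I_n -> {linear M -> M}).
Variable (A : subvs_of h -> {linear M -> M}).
Hypothesis AX : forall t e k v,
  A t (X e k v) = X e k (A t v) + (sgnb K e * (alpha k t : K)) *: X e k v.
Hypothesis XX : forall k v,
  X true k (X false k v) = X false k (X true k v) + A (sharp (alpha k)) v.

Definition wt (mu : hdual) (v : M) := forall t, A t v = (mu t : K) *: v.

Lemma wtX e k mu v : wt mu v -> wt (mu + sgnb K e *: alpha k) (X e k v).
Proof.
move=> muv t; rewrite AX muv linearZ -scalerDl add_lfunE scale_lfunE.
by [].
Qed.

Lemma wt_iterX e k mu v m : wt mu v ->
  wt (mu + (sgnb K e * m%:R) *: alpha k) (iter m (X e k) v).
Proof.
move=> muv; elim: m => [|m IH]; first by rewrite mulr0 scale0r addr0.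
have := wtX e k IH; rewrite -addrA -scalerDl.
by rewrite -[in X in wt _ X -> _]/(iter m.+1 (X e k) v) -[m.+1]addn1 natrD mulrDr mulr1.
Qed.

Lemma coroot_sharp (mu : hdual) k :
  (mu (sharp (alpha k)) : K) = (dsym k)%:R * (mu (coroot k) : K).
Proof. by rewrite eval_coroot mulVKf // dsym_neq0. Qed.

(** A power of the lowering or raising operator, according to the sign of [mu (coroot k)]. The
    choice depends on [mu] alone, so a single linear map is injective on the whole weight space; the
    dimension count for the lowest weight space rests on this. *)
Lemma wt_reflection k mu : integral_weight mu -> exists e m, forall v, wt mu v ->
  wt (reflection k mu) (iter m (X e k) v) /\ (iter m (X e k) v = 0 -> v = 0).
Proof.
move=> Imu; have [z zE] := Imu k.
have d0 : (0 < dsym k)%N by rewrite lt0n -(@pnatr_eq0 K) dsym_neq0.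
have AXk e v : A (sharp (alpha k)) (X e k v) =
    X e k (A (sharp (alpha k)) v) + (sgnb K e * (2 * dsym k)%:R) *: X e k v.
  by rewrite AX alpha_sharp cartan_diag natrM [_%:R * 2]mulrC.
have refl e m : (z%:~R : K) = - (sgnb K e * m%:R) -> forall v, wt mu v ->
    wt (reflection k mu) (iter m (X e k) v).
  move=> zm v /(wt_iterX e k m); rewrite /reflection zE zm scaleNr opprK //.
case: z zE refl => m zE refl.
  exists false, m => v muv; split; first by apply: refl => //; rewrite mulN1r opprK.
  apply: (@sl2_reflection _ _ (X true k) _ (A (sharp (alpha k))) (dsym k)) => //.
  - by move=> w; rewrite AXk mul1r.
  - by move=> w; rewrite AXk mulN1r scaleNr.
  - by rewrite muv coroot_sharp zE natrM.
(* The negative case exchanges the two operators and replaces [H] by its opposite; [Negz m] stands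
   for [- (m + 1)]. *)
exists true, m.+1 => v muv; split; first by apply: refl => //; rewrite mul1r NegzE rmorphN.
apply: (@sl2_reflection _ _ (X false k) _ (\- A (sharp (alpha k))) (dsym k)) => //.
- by move=> w; rewrite XX /= addrK.
- by move=> w /=; rewrite AXk mulN1r scaleNr opprD opprK linearN.
- by move=> w /=; rewrite AXk mul1r opprD linearN.
- by rewrite /= muv coroot_sharp zE natrM NegzE rmorphN mulrN scaleNr opprK.
Qed.

Definition ops (l : seq (bool * 'I_n)) (v : M) : M :=
  foldr (fun ek v => X ek.1 ek.2 v) v l.

Lemma ops_cat l l' v : ops (l ++ l') v = ops l (ops l' v).
Proof. exact: foldr_cat. Qed.

Lemma ops_is_linear l : linear (ops l).
Proof. by move=> a x y; elim: l => [|ek l IH] //=; rewrite IH linearP. Qed.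

Lemma wt_weyl s mu : integral_weight mu -> exists l, forall v, wt mu v ->
  wt (weyl_word s mu) (ops l v) /\ (ops l v = 0 -> v = 0).
Proof.
move=> Imu; elim: s => [|k s [l lP]]; first by exists [::].
have [e [m mP]] := wt_reflection k (integral_weyl s Imu).
exists (nseq m (e, k) ++ l) => v muv; rewrite ops_cat.
have -> u : ops (nseq m (e, k)) u = iter m (X e k) u.
  by elim: m {mP} => [|m IH] //=; rewrite IH.
have [wl il] := lP v muv; have [ws it] := mP _ wl.
by split=> // /it /il.
Qed.

End CartanModule.

End Weyl.

Section Adjoint.
Variables (K : numClosedFieldType) (N : nat).

Definition adX (B Y : 'M[K]_N) : 'M[K]_N := B *m Y - Y *m B.

Lemma adX_is_linear B : linear (adX B).
Proof.
by move=> a x y; rewrite /adX mulmxDr mulmxDl -scalemxAr -scalemxAl scaler_combB.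
Qed.

HB.instance Definition _ B :=
  GRing.isLinear.Build K 'M[K]_N 'M[K]_N *:%R (adX B) (adX_is_linear B).

Lemma adX_jacobi B D Y : adX B (adX D Y) = adX D (adX B Y) + adX (adX B D) Y.
Proof.
rewrite /adX !mulmxBr !mulmxBl !mulmxA !opprB.
rewrite [RHS](AC ((2*2)*(2*2)) (((5*4)*(7*2))*((1*6)*(3*8)))) /=.
by rewrite !subrr !addr0.
Qed.

End Adjoint.

(** * Nonnegative combinations of simple roots *)

Section RootSums.
Variables (K : numClosedFieldType) (L : simple_lie K).
Notation n := (rank L).
Notation hdual := 'Hom(subvs_of (csa L), K^o).

Definition rsum (s : seq 'I_n) : hdual := \sum_(j <- s) alpha j.

Lemma rsum_varpi s i : (rsum s (varpi i) : K) = (count_mem i s)%:R.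
Proof.
rewrite /rsum sum_lfunE; elim: s => [|j s IH]; first by rewrite big_nil.
by rewrite big_cons IH varpiP natrD.
Qed.

(** Positivity only; being a root is recorded separately by [groot]. *)
Definition posr (b : hdual) := exists2 s, s != [::] & b = rsum s.

Lemma posr_asym b : posr b -> posr (- b) -> False.
Proof.
move=> [[//|i s] _ bE] [s' _ b'E].
have : (rsum (i :: s) + rsum s') (varpi i) = 0 :> K.
  by rewrite -b'E -bE subrr lfunE.
by rewrite add_lfunE !rsum_varpi -natrD /= eqxx => /eqP; rewrite pnatr_eq0.
Qed.

Lemma posr0 : ~ posr 0.
Proof. by move=> p0; apply: (posr_asym p0); rewrite oppr0. Qed.

Definition qsum (m : {ffun 'I_n -> nat}) : hdual := \sum_i alpha i *+ m i.

Lemma qsum_varpi m i : (qsum m (varpi i) : K) = (m i)%:R.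
Proof.
have E j k : ((alpha j *+ k : hdual) (varpi i) : K) = (j == i)%:R *+ k.
  by elim: k => [|k IH]; rewrite ?mulr0n ?lfunE // !mulrS add_lfunE IH varpiP.
rewrite /qsum sum_lfunE (bigD1 i) //= E eqxx big1 ?addr0 // => j ji.
by rewrite E (negPf ji) mul0rn.
Qed.

Lemma qsum_inj : injective qsum.
Proof.
move=> m m' E; apply/ffunP => i; apply/eqP; rewrite -(@eqr_nat K) -!qsum_varpi.
by rewrite E.
Qed.

Lemma qsum0 : qsum [ffun=> 0%N] = 0.
Proof. by rewrite /qsum big1 // => i _; rewrite ffunE. Qed.

Definition incr (m : {ffun 'I_n -> nat}) k : {ffun 'I_n -> nat} :=
  [ffun i => (m i + (i == k))%N].

Lemma qsum_incr m k : qsum (incr m k) = qsum m + alpha k.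
Proof.
rewrite /qsum (bigD1 k) //= [\sum_i alpha i *+ m i](bigD1 k) //= ffunE eqxx addn1.
rewrite mulrSr addrAC; congr (_ + _ + _); apply: eq_bigr => i ik.
by rewrite ffunE (negPf ik) addn0.
Qed.

End RootSums.

(** * Roots of the Lie algebra generated inside the endomorphisms of [V], and the longest word *)

Section Roots.
Variables (K : numClosedFieldType) (L : simple_lie K) (hbar : K) (N : nat).
Notation n := (rank L).
Notation h := (csa L).
Notation hdual := 'Hom(subvs_of h, K^o).
Variable V : yangian_rep L hbar N.
Hypothesis k2_neq0 : kappa2 L != 0%N.

Definition adx e k : {linear 'M[K]_N -> 'M[K]_N} := adX (xpm V e k 0).
Definition adh t : {linear 'M[K]_N -> 'M[K]_N} := adX (cartan_act V t).

Lemma bracket_x0 k j :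
  adX (xpm V true k 0) (xpm V false j 0) = if k == j then xi V k 0 else 0.
Proof. by have := xp_xm V k j 0 0. Qed.

Lemma adh_adx t e k Y :
  adh t (adx e k Y) = adx e k (adh t Y) + (sgnb K e * (alpha k t : K)) *: adx e k Y.
Proof.
rewrite /adh /adx /= adX_jacobi; congr (_ + _).
have -> : adX (cartan_act V t) (xpm V e k 0) =
    (sgnb K e * (alpha k t : K)) *: xpm V e k 0.
  by rewrite /adX cartan_act_x // addrC addKr.
by rewrite /adX -scalemxAl -scalemxAr scalerBr.
Qed.

Lemma adx_adx k Y :
  adx true k (adx false k Y) = adx false k (adx true k Y) + adh (sharp (alpha k)) Y.
Proof.
rewrite /adh /adx /= adX_jacobi; congr (_ + _).
by rewrite bracket_x0 eqxx cartan_act_sharp.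
Qed.

(* Spanning set of the Lie algebra generated by the [x^+-_{k,0}]. *)
Definition gen (t : 'I_n + bool * 'I_n * seq 'I_n) : 'M[K]_N :=
  match t with
  | inl k => xi V k 0
  | inr (e, k, s) => foldr (fun j Y => adx e j Y) (xpm V e k 0) s
  end.

Definition genwt (t : 'I_n + bool * 'I_n * seq 'I_n) : hdual :=
  match t with
  | inl k => 0
  | inr (e, k, s) => sgnb K e *: rsum (k :: s)
  end.

Notation awt := (@wt _ _ _ adh).

Lemma gen_wt t : awt (genwt t) (gen t).
Proof.
case: t => [k|[[e k] s]] t /=.
  by rewrite /adX cartan_act_xi subrr lfunE scale0r.
elim: s => [|j s IH] /=.
  rewrite /adX cartan_act_x // addrC addKr scale_lfunE /rsum big_seq1.
  by [].
rewrite -[adX _ _]/(adh t (adx e j _)) adh_adx [adh t _]IH linearZ -scalerDl.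
congr (_ *: _); rewrite !scale_lfunE /rsum !big_cons !add_lfunE.
by rewrite -mulrDr -!addrA [alpha j t + _]addrC.
Qed.

(** The linear span of the selected generators, as a predicate because their index type is
    infinite. *)
Inductive spanG (P : 'I_n + bool * 'I_n * seq 'I_n -> Prop) : 'M[K]_N -> Prop :=
| spanG0 : spanG P 0
| spanGD a t Y : P t -> spanG P Y -> spanG P (a *: gen t + Y).

Lemma spanG_gen P t : P t -> spanG P (gen t).
Proof.
by move=> Pt; rewrite -[gen t]addr0 -[gen t]scale1r; apply: spanGD => //; apply: spanG0.
Qed.

Lemma spanG_lin P a Y Z : spanG P Y -> spanG P Z -> spanG P (a *: Y + Z).
Proof.
elim=> [|b t Y' Pt _ IH] PZ; first by rewrite scaler0 add0r.
by rewrite scalerDr scalerA -addrA; apply: spanGD => //; apply: IH.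
Qed.

Lemma spanGZ P a Y : spanG P Y -> spanG P (a *: Y).
Proof.
by move=> PY; rewrite -[_ *: _]addr0; apply: spanG_lin => //; apply: spanG0.
Qed.

Lemma spanG_sub (P Q : _ -> Prop) Y : (forall t, P t -> Q t) -> spanG P Y -> spanG Q Y.
Proof. by move=> PQ; elim=> [|a t Z /PQ Qt _ IH]; [apply: spanG0 | apply: spanGD]. Qed.

Lemma spanG_map P Q (f : {linear 'M[K]_N -> 'M[K]_N}) Y :
  (forall t, P t -> spanG Q (f (gen t))) -> spanG P Y -> spanG Q (f Y).
Proof.
move=> PQ; elim=> [|a t Z Pt _ IH]; first by rewrite linear0; apply: spanG0.
by rewrite linearP; apply: spanG_lin => //; apply: PQ.
Qed.

(** The generators selected here span the Borel part of sign [e], the Cartan part included. *)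
Definition same_sign e (t : 'I_n + bool * 'I_n * seq 'I_n) : Prop :=
  if t is inr (e', _, _) then e' = e else True.

Lemma same_sign_adx e i Y : spanG (same_sign e) Y -> spanG (same_sign e) (adx e i Y).
Proof.
apply: spanG_map => -[k _|[[e' k] s] /= ->].
  have -> : adx e i (gen (inl k)) =
     - (sgnb K e * (alpha i (sharp (alpha k)) : K)) *: gen (inr (e, i, [::])).
    rewrite /= /adX -cartan_act_sharp // cartan_act_x // opprD addrA subrr add0r.
    by rewrite scaleNr.
  exact/spanGZ/spanG_gen.
exact: (@spanG_gen _ (inr (e, k, i :: s))).
Qed.

(** The Jacobi identity pushes [x^e_j] inside the iterated bracket. Its bracket with a generator of
    the opposite sign lies in the Cartan part, which acts on the remaining bracket, a weight vector,
    by a scalar. *)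
Lemma opp_sign_adx e j k s :
  spanG (same_sign (~~ e)) (adx e j (gen (inr (~~ e, k, s)))).
Proof.
have xx i : adX (xpm V e j 0) (xpm V (~~ e) i 0) =
    if i == j then sgnb K e *: xi V j 0 else 0.
  case: (e); rewrite /= ?scale1r; first by rewrite bracket_x0 eq_sym.
  have -> (A B : 'M[K]_N) : adX A B = - adX B A by rewrite /adX opprB.
  by rewrite bracket_x0; case: eqP => [->|_]; rewrite ?oppr0 // scaleN1r.
elim: s => [|i s IH] /=.
  rewrite xx; case: eqP => _; last exact: spanG0.
  by apply: spanGZ; apply: (@spanG_gen _ (inl j)).
rewrite adX_jacobi addrC -[X in spanG _ (X + _)]scale1r; apply: spanG_lin; last first.
  exact: same_sign_adx.
rewrite xx; case: eqP => [_|_]; last first.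
  by rewrite /adX mulmx0 mul0mx subrr; apply: spanG0.
have -> (Y : 'M[K]_N) : adX (sgnb K e *: xi V j 0) Y =
    sgnb K e *: adh (sharp (alpha j)) Y.
  by rewrite /= /adX cartan_act_sharp // -scalemxAl -scalemxAr scalerBr.
by rewrite (gen_wt (inr (~~ e, k, s))); apply/spanGZ/spanGZ/spanG_gen.
Qed.

Lemma spanG_ops l Y : spanG (fun=> True) Y -> spanG (fun=> True) (ops adx l Y).
Proof.
move=> GY; elim: l => [//|[e k] l IH] /=.
apply: (@spanG_map (fun=> True) _ (adx e k)) IH => -[j _|[[e' j] s] _].
  apply: (@spanG_sub (same_sign e)) => //; apply: same_sign_adx.
  exact: (@spanG_gen _ (inl j)).
have [->|->] : e' = e \/ e' = ~~ e by case: (e) (e') => [] []; auto.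
  exact: (@spanG_gen _ (inr (e, j, k :: s))).
by apply: (@spanG_sub (same_sign (~~ e))) => //; apply: opp_sign_adx.
Qed.

(** A weight, possibly zero, of the Lie algebra generated by the [x^+-_{k,0}] in its adjoint action;
    it replaces the roots of [L], whose root vectors have no given image in the endomorphisms of
    [V]. *)
Definition groot (b : hdual) :=
  exists Y, [/\ Y != 0, spanG (fun=> True) Y & awt b Y].

Lemma groot_weyl b s : integral_weight b -> groot b -> groot (weyl_word s b).
Proof.
move=> Ib [Y [Y0 GY bY]].
have [l /(_ Y bY) [wl li]] := wt_weyl adh_adx adx_adx s Ib.
exists (ops adx l Y); split => //; last exact: spanG_ops.
by apply: contra Y0 => /eqP /li ->.
Qed.

(** The generators are weight vectors themselves. If all nonzero ones had weights other than [b], a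
    vector of weight [b] in their span would vanish by independence. *)
Lemma groot_gen b : groot b -> exists t, genwt t = b /\ gen t != 0.
Proof.
move=> [Y [Y0 GY bY]]; apply: contrapT => /forallNP Nt.
have [s YE] : exists s : seq (K * ('I_n + bool * 'I_n * seq 'I_n)),
    Y = \sum_(x <- s) x.1 *: gen x.2.
  elim: GY => [|a t Z _ _ [s ->]]; first by exists [::]; rewrite big_nil.
  by exists ((a, t) :: s); rewrite big_cons.
move/eqP: Y0; apply.
apply: (@weight_vectors_independent _ _ _ adh _ [seq x <- s | gen x.2 != 0]
   (fun x t => genwt x.2 t) (fun x => x.1 *: gen x.2) (fun t => b t)) => //.
- by move=> x _ t; rewrite linearZ /= gen_wt !scalerA mulrC.
- move=> x; rewrite mem_filter => /andP[x0 _].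
  have : genwt x.2 != b by apply/eqP => xb; apply: (Nt x.2).
  by move/lfunPn => [t tb]; exists t.
- rewrite YE big_filter [LHS](bigID (fun x => gen x.2 != 0)) /=.
  rewrite [X in _ + X]big1 ?addr0 // => x /negPn /eqP ->; exact: scaler0.
Qed.

Lemma groot_sign b : groot b -> b != 0 -> posr b \/ posr (- b).
Proof.
move=> /groot_gen [[k|[[[] k] s]] [<- _]] b0; first by rewrite eqxx in b0.
  by left; exists (k :: s); rewrite //= scale1r.
by right; exists (k :: s); rewrite //= scaleN1r opprK.
Qed.

(** The reflection changes only the coefficient of [alpha a], so a sign change leaves no other
    simple root in [b]. A nonzero generator of this weight involves [x_a] alone, and brackets of
    [x_a] with itself vanish, so the multiplicity is one. *)
Lemma groot_simple b a : groot b -> integral_weight b -> posr b ->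
  posr (- reflection a b) -> b = alpha a.
Proof.
move=> gb Ib pb [s' s'0 rE]; have [s s0 bE] := pb.
have sa i : i \in s -> i = a.
  move=> ins; apply/eqP/negPn/negP => ia.
  have : (reflection a b (varpi i) : K) = (count_mem i s)%:R.
    rewrite /reflection add_lfunE opp_lfunE scale_lfunE varpiP.
    by rewrite eq_sym (negPf ia) scaler0 subr0 bE rsum_varpi.
  rewrite -[reflection a b]opprK rE opp_lfunE rsum_varpi => /eqP.
  rewrite eq_sym -addr_eq0 -natrD pnatr_eq0 addn_eq0 => /andP[/eqP c0 _].
  by move: ins; rewrite -has_pred1 has_count c0.
have [[k|[[[] k] s1]] [wE g0]] := groot_gen gb.
- by move: pb; rewrite -wE => /posr0.
- have ss1 : k :: s1 =i s.
    move=> i; rewrite -!has_pred1 !has_count -!(@ltr_nat K) -!rsum_varpi -bE -wE /=.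
    by rewrite scale1r.
  have ka : k = a by apply: sa; rewrite -ss1 mem_head.
  case: s1 wE g0 ss1 => [|j s1] wE g0 ss1.
    by rewrite -wE /= scale1r /rsum big_seq1 ka.
  have all_a : all (pred1 a) (j :: s1).
    by apply/allP => i ij; apply/eqP/sa; rewrite -ss1 in_cons ij orbT.
  case/eqP: g0; rewrite /gen ka (all_pred1P _ _ all_a).
  elim: (size (j :: s1)) (isT : 0 < size (j :: s1))%N => [//|[|q] IH] _.
    by rewrite /= /adX subrr.
  by rewrite /= in IH *; rewrite IH // linear0.
- case: (posr_asym pb); exists (k :: s1) => //.
  by rewrite -wE /= scaleN1r opprK.
Qed.

Lemma groot_alpha k : xpm V true k 0 != 0 -> groot (alpha k).
Proof.
move=> x0; exists (xpm V true k 0); split=> //.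
  exact: (@spanG_gen _ (inr (true, k, [::]))).
have := gen_wt (inr (true, k, [::])); rewrite /= scale1r /rsum big_seq1.
by [].
Qed.

(** Conjugating a reflection by an isometry gives the reflection in the image root. The coroots
    match because the isometry preserves the squared length, so [dsym k = dsym a]. *)
Lemma conj_reflection p k a : weyl_word (rev p) (alpha k) = alpha a ->
  forall mu : hdual,
  weyl_word (rev p) (reflection k (weyl_word p mu)) = reflection a mu.
Proof.
move=> pk mu; rewrite {1}/reflection weyl_wordB weyl_wordZ pk weyl_word_revK.
suff E : (weyl_word p mu (coroot k) : K) = mu (coroot a) by rewrite E.
have kE : alpha k = weyl_word p (alpha a) by rewrite -pk weyl_wordK.
have da : (dsym k)%:R = (dsym a)%:R :> K.
  have n2 : (2 : K) != 0 by rewrite pnatr_eq0.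
  by apply: (mulfI n2); rewrite -!dual_form_alpha kE weyl_isometry.
by rewrite !eval_coroot da kE weyl_isometry.
Qed.

Lemma weyl_word_neq0 s (b : hdual) : b != 0 -> weyl_word s b != 0.
Proof.
apply: contra => /eqP E; rewrite -(weyl_word_revK s b) E.
by have := weyl_wordZ (rev s) 0 (0 : hdual); rewrite !scale0r => ->.
Qed.

Lemma alpha_neq0 k : alpha k != 0 :> hdual.
Proof. by case: (alphaP L) => /(_ k) []. Qed.

(* [s_1 ... s_m] is shortened by [s_k] at the step where the images of [alpha k]
   change sign, since there the image is a simple root. *)
Lemma exchange k s p : groot (alpha k) ->
  posr (weyl_word (rev p) (alpha k)) ->
  posr (- weyl_word (rev s) (weyl_word (rev p) (alpha k))) ->
  exists2 s', (size s' < size s)%N & forall mu : hdual,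
  weyl_word (rev p) (reflection k (weyl_word p (weyl_word s mu))) = weyl_word s' mu.
Proof.
move=> gk; elim: s p => [|a s IH] p pp; first by move/(posr_asym pp).
rewrite rev_cons -cats1 weyl_word_cat /= => ns.
have Ip := integral_weyl (rev p) (integral_alpha k).
have gp := groot_weyl (rev p) (integral_alpha k) gk.
have ga : groot (reflection a (weyl_word (rev p) (alpha k))).
  exact: (@groot_weyl _ [:: a]).
have a0 : reflection a (weyl_word (rev p) (alpha k)) != 0.
  by apply: (@weyl_word_neq0 [:: a]); apply: weyl_word_neq0; apply: alpha_neq0.
have [pa|na] := groot_sign ga a0.
  have := IH (p ++ [:: a]); rewrite rev_cat /= => /(_ pa ns) [s' ss' E].
  exists (a :: s') => // mu /=; rewrite -E.
  by rewrite [weyl_word (p ++ _) _]weyl_word_cat /= reflectionK.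
exists s => [|mu] //=.
rewrite (conj_reflection (groot_simple gp Ip pp na)).
by rewrite /= reflectionK.
Qed.

Lemma eq_weyl_word_rev (s t : seq 'I_n) : @weyl_word K L s =1 weyl_word t ->
  @weyl_word K L (rev s) =1 weyl_word (rev t).
Proof.
by move=> st mu; rewrite -{1}(weyl_wordK t mu) -st weyl_word_revK.
Qed.

(** Otherwise let [s] be a shortest word for the [k]-th reflection times [w0]. Its inverse makes
    [alpha k] negative, so [exchange] expresses [w0] by a word shorter than [s]. Since [w0] is
    reduced, [s] would be a reduced word longer than [w0]. *)
Lemma longest_word_neg w0 k : longest_word w0 -> groot (alpha k) ->
  posr (- weyl_word (rev w0) (alpha k) : hdual).
Proof.
move=> [red0 longest] gk.
have gw := groot_weyl (rev w0) (integral_alpha k) gk.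
have [pw|//] := groot_sign gw (weyl_word_neq0 _ (alpha_neq0 k)).
have exm : exists m, `[< exists2 s, size s = m & weyl_word s =1 @weyl_word K L (k :: w0) >].
  by exists (size w0).+1; apply/asboolP; exists (k :: w0).
have [m /asboolP [s sm sE] mmin] := ex_minnP exm.
have reds : reduced_word s.
  move=> s' s'E; rewrite sm; apply: mmin; apply/asboolP; exists s' => // mu.
  by rewrite s'E sE.
have [||s'' s''s E] := @exchange k s [::] gk.
- by exists [:: k]; rewrite //= /rsum big_seq1.
- rewrite /= (eq_weyl_word_rev sE) rev_cons -cats1 weyl_word_cat /=.
  by rewrite reflection_alpha weyl_wordN opprK.
have : (size w0 <= size s'')%N.
  by apply: red0 => mu; rewrite -E /= sE /= reflectionK.
by move=> /leq_ltn_trans/(_ s''s); rewrite ltnNge longest.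
Qed.

End Roots.

(** * Highest and lowest weight vectors *)

Section HighestWeight.
Variables (K : numClosedFieldType) (L : simple_lie K) (hbar : K) (N : nat).
Notation n := (rank L).
Notation h := (csa L).
Notation hdual := 'Hom(subvs_of h, K^o).
Variable V : yangian_rep L hbar N.
Hypothesis k2_neq0 : kappa2 L != 0%N.
Variables (Omega : 'cV[K]_N) (lambda : hdual).
Hypothesis Omega_neq0 : Omega != 0.
Hypothesis Omega_x : forall i r, xpm V true i r *m Omega = 0.
Hypothesis Omega_xi : exists m : 'I_n -> nat -> K, forall i r, xi V i r *m Omega = m i r *: Omega.
Hypothesis Omega_gen : forall U : {vspace 'cV[K]_N}, Omega \in U ->
  (forall i r v, v \in U -> xi V i r *m v \in U) ->
  (forall e i r v, v \in U -> xpm V e i r *m v \in U) -> U = fullv.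
Hypothesis Omega_wt : wt_space V lambda Omega.

Lemma hw_ind (Q : 'cV[K]_N -> Prop) : Q Omega ->
  (forall a v w, Q v -> Q w -> Q (a *: v + w)) ->
  (forall k r v, Q v -> Q (xpm V false k r *m v)) -> forall v, Q v.
Proof.
move=> *; apply: (@generated_ind _ _ _ _ V k2_neq0 false Omega) => //.
by move=> k r; have [m mE] := Omega_xi; exists (m k r).
Qed.

Section Graded.
Variable H : {ffun 'I_n -> nat} -> 'cV[K]_N -> Prop.
Hypothesis Hwt : forall m v, H m v -> wt_space V (lambda - qsum m) v.
Hypothesis H0 : H [ffun=> 0%N] Omega.
Hypothesis Hlin : forall m a v w, H m v -> H m w -> H m (a *: v + w).
Hypothesis Hx : forall m k r v, H m v -> H (incr m k) (xpm V false k r *m v).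

Lemma hw_decomposition v : exists2 s : seq ({ffun 'I_n -> nat} * 'cV[K]_N),
  (forall x, x \in s -> H x.1 x.2) & v = \sum_(x <- s) x.2.
Proof.
elim/hw_ind: v => [|a u w [s sH ->] [s' s'H ->]|k r u [s sH ->]].
- by exists [:: ([ffun=> 0%N], Omega)] => [x|]; rewrite ?inE ?big_seq1 // => /eqP ->.
- exists ([seq (x.1, a *: x.2) | x <- s] ++ s') => [x|].
    rewrite mem_cat => /orP[/mapP[y ys ->] /=|/s'H //].
    have Hy := sH _ ys; have Hz : H y.1 0.
      by have := Hlin (-1) Hy Hy; rewrite scaleN1r addNr.
    by rewrite -[_ *: _]addr0; apply: Hlin.
  by rewrite big_cat big_map /= scaler_sumr.
- exists [seq (incr x.1 k, xpm V false k r *m x.2) | x <- s] => [x|].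
    by move=> /mapP[y /sH Hy ->]; apply: Hx.
  by rewrite big_map mulmx_sumr.
Qed.

(** In a decomposition into words, the terms of weight other than [mu] add up to zero. The rest
    share one degree by [qsum_inj], and [H] is closed under sums there. The predicate [H] is
    instantiated by membership in the weight space alone, by the multiples of [Omega] in degree
    zero, and by [monic_at]. *)
Lemma hw_graded mu v : wt_space V mu v -> v != 0 ->
  exists2 m, mu = lambda - qsum m & H m v.
Proof.
move=> muv v0; have [s sH vE] := hw_decomposition v.
pose P (x : {ffun 'I_n -> nat} * 'cV[K]_N) := lambda - qsum x.1 == mu.
have Hs0 : v - \sum_(x <- s | P x) x.2 = 0.
  apply: (@weight_vectors_independent _ _ _ (fun t => mulmx (cartan_act V t)) _
    [seq x <- s | ~~ P x] (fun x t => (lambda - qsum x.1) t) (fun x => x.2)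
    (fun t => mu t)).
  - by move=> x; rewrite mem_filter => /andP[_ /sH/Hwt].
  - by move=> x; rewrite mem_filter => /andP[/lfunPn[t tP] _]; exists t.
  - move=> t; rewrite linearB linear_sum /= scalerBr scaler_sumr muv; congr (_ - _).
    rewrite big_seq_cond [RHS]big_seq_cond; apply: eq_bigr => x /andP[xs /eqP <-].
    exact: (Hwt (sH _ xs)).
  - by rewrite big_filter vE [X in X - _](bigID P) /= addrAC subrr add0r.
move/eqP: Hs0; rewrite subr_eq0 => /eqP {}vE.
have [[x xs Px]|Nx] := pselect (exists2 x, x \in s & P x); last first.
  move: v0; rewrite vE big_seq_cond big1 ?eqxx // => x /andP[xs Px].
  by case: Nx; exists x.
exists x.1; first by rewrite (eqP Px).
have Hz : H x.1 0.
  by have := Hlin (-1) (sH _ xs) (sH _ xs); rewrite scaleN1r addNr.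
rewrite vE big_seq_cond; apply: (big_ind (H x.1)) => // [y z Hy' Hz'|y /andP[ys]].
  by rewrite -[y]scale1r; apply: Hlin.
rewrite /P -(eqP Px) => /eqP/addrI/oppr_inj/qsum_inj <-; exact: sH.
Qed.

End Graded.

Lemma x_false_weight m k r v : wt_space V (lambda - qsum m) v ->
  wt_space V (lambda - qsum (incr m k)) (xpm V false k r *m v).
Proof.
move=> wv; have := x_weight k2_neq0 false k r wv.
by rewrite scaleN1r qsum_incr opprD addrA.
Qed.

Lemma wt_space_lin mu a v w : wt_space V mu v -> wt_space V mu w ->
  wt_space V mu (a *: v + w).
Proof.
by move=> wv ww t; rewrite mulmxDr -scalemxAr wv ww scalerDr !scalerA mulrC.
Qed.

Lemma hw_weight mu v : wt_space V mu v -> v != 0 -> exists m, mu = lambda - qsum m.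
Proof.
move=> muv v0.
have [||||m] := @hw_graded (fun m => wt_space V (lambda - qsum m)) _ _ _ _ mu v muv v0.
- by [].
- by rewrite qsum0 subr0.
- by move=> m a u w; apply: wt_space_lin.
- by move=> m k r u; apply: x_false_weight.
- by exists m.
Qed.

(** The graded property constrains degree zero only, and no [x^-] leads into degree zero. *)
Lemma hw_line v : wt_space V lambda v -> exists a, v = a *: Omega.
Proof.
move=> lv; have [->|v0] := eqVneq v 0; first by exists 0; rewrite scale0r.
have [||||m] := @hw_graded (fun m v => wt_space V (lambda - qsum m) v /\
   (m = [ffun=> 0%N] -> exists a, v = a *: Omega)) _ _ _ _ lambda v lv v0.
- by move=> m u [].
- by rewrite qsum0 subr0; split => // _; exists 1; rewrite scale1r.
- move=> m a u w [wu mu] [ww mw]; split; first exact: wt_space_lin.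
  move=> m0; have [b ->] := mu m0; have [b' ->] := mw m0.
  by exists (a * b + b'); rewrite scalerA scalerDl.
- move=> m k r u [wu mu]; split; first exact: x_false_weight.
  by move/ffunP/(_ k); rewrite !ffunE eqxx addn1.
- move=> mE [_]; apply; apply: qsum_inj; rewrite qsum0.
  by apply/eqP; rewrite -oppr_eq0 -(inj_eq (addrI lambda)) -mE addr0.
Qed.

Definition vx e k : {linear 'cV[K]_N -> 'cV[K]_N} := mulmx (xpm V e k 0).
Definition vh t : {linear 'cV[K]_N -> 'cV[K]_N} := mulmx (cartan_act V t).

Lemma vh_vx t e k v :
  vh t (vx e k v) = vx e k (vh t v) + (sgnb K e * (alpha k t : K)) *: vx e k v.
Proof.
by rewrite /vh /vx /= !mulmxA cartan_act_x // mulmxDl -scalemxAl.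
Qed.

Lemma vx_vx k v :
  vx true k (vx false k v) = vx false k (vx true k v) + vh (sharp (alpha k)) v.
Proof.
rewrite /vx /vh /= !mulmxA cartan_act_sharp // -mulmxDl; congr (_ *m _).
by have /eqP := xp_xm V k k 0 0; rewrite eqxx subr_eq addrC => /eqP.
Qed.

Lemma vx_ops_closed l (U : {vspace 'cV[K]_N}) v :
  (forall e i r v, v \in U -> xpm V e i r *m v \in U) -> v \in U ->
  ops vx l v \in U.
Proof. by move=> Ux vU; elim: l => [|ek l IH] //=; apply: Ux. Qed.

(** With [p + 1] the first power of [F] that kills [Omega], applying [x^+_{k,0}] to
    [F^(p+1) Omega = 0] gives a multiple of [F^p Omega] with coefficient
    [(p + 1) (lambda (sharp (alpha k)) - d p)], so [lambda (coroot k) = p]. *)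
Lemma lambda_integral : integral_weight lambda.
Proof.
move=> k; pose H := vh (sharp (alpha k)); pose F := vx false k.
have d0 := dsym_neq0 k.
have HF p : H (iter p F Omega) =
    ((lambda (sharp (alpha k)) : K) + (- (2 * dsym k)%:R) * p%:R) *: iter p F Omega.
  elim: p => [|p IH]; first by rewrite mulr0 addr0; apply: Omega_wt.
  rewrite iterS [H _]vh_vx -/H IH linearZ -scalerDl /sgnb alpha_sharp cartan_diag.
  rewrite -/F; congr (_ *: _); rewrite -[p.+1%:R]natr1 natrM -[2%:~R]/(2%:R).
  by ring.
have ex : exists p, iter p F Omega == 0.
  have [|p pE] := iter_weight_nilpotent _ HF; last by exists p; apply/eqP.
  by rewrite oppr_eq0 natrM mulf_neq0 // pnatr_eq0.
have [[|p] /eqP pE pmin] := ex_minnP ex; first by move: Omega_neq0; rewrite (pE : Omega = 0) eqxx.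
have EF q : vx true k (iter q.+1 F Omega) =
    (q.+1%:R * ((lambda (sharp (alpha k)) : K) - (dsym k * q)%:R)) *: iter q F Omega.
  elim: q => [|q IH].
    rewrite /= [vx true k _]vx_vx [vx true k _]Omega_x linear0 add0r.
    by rewrite muln0 subr0 mul1r; apply: Omega_wt.
  rewrite iterS [vx true k _]vx_vx IH linearZ -/H HF -scalerDl; congr (_ *: _).
  rewrite !natrM -[q.+2%:R]natr1 -[q.+1%:R]natr1; ring.
have := EF p; rewrite pE linear0 => /esym/eqP.
rewrite scaler_eq0 mulf_eq0 pnatr_eq0 /= subr_eq0 => /orP[/eqP lE|/eqP p0]; last first.
  by have := pmin p; rewrite p0 eqxx ltnn => /(_ isT).
by exists (Posz p); rewrite linearZ /= lE natrM; apply: mulKf.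
Qed.

Lemma wt_hw_integral mu v : wt_space V mu v -> v != 0 -> integral_weight mu.
Proof.
move=> muv v0; have [m ->] := hw_weight muv v0.
apply: integral_weightD; first exact: lambda_integral.
rewrite -[- _]scaleN1r; apply: (@integral_weightZ _ _ (-1)).
rewrite /qsum; apply: (big_ind (@integral_weight K L)) => [k|x y|i _].
- by exists 0; rewrite lfunE.
- exact: integral_weightD.
- rewrite -scaler_nat; apply: (@integral_weightZ _ _ (Posz (m i))).
  exact: integral_alpha.
Qed.

Section Lowest.
Variable w0 : seq 'I_n.
Hypothesis w0P : longest_word w0.
Notation low := (weyl_word w0 lambda).

Lemma low_exists : exists2 v, wt_space V low v & v != 0.
Proof.
have [l lP] := wt_weyl vh_vx vx_vx w0 lambda_integral.
have [wl li] := lP _ Omega_wt; exists (ops vx l Omega) => //.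
by apply: contraNneq Omega_neq0 => /li ->.
Qed.

Lemma low_to_hw : exists l, forall v, wt_space V low v ->
  exists2 a, ops vx l v = a *: Omega & (a = 0 -> v = 0).
Proof.
have [l lP] := wt_weyl vh_vx vx_vx (rev w0) (integral_weyl w0 lambda_integral).
exists l => v /lP[]; rewrite weyl_word_revK => /hw_line[a aE] li.
by exists a => // a0; apply: li; rewrite aE a0 scale0r.
Qed.

(** A word lifting the inverse of [w0] maps the lowest weight space injectively into the line of
    [Omega]. *)
Lemma low_line u v : wt_space V low u -> wt_space V low v -> u != 0 ->
  exists a, v = a *: u.
Proof.
move=> wu wv u0; have [l lP] := low_to_hw.
have [a aE a0] := lP _ wu; have [b bE _] := lP _ wv.
have an0 : a != 0 by apply: contra u0 => /eqP/a0 ->.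
exists (b / a); apply/eqP; rewrite -subr_eq0 -scaleNr addrC; apply/eqP.
have := lP _ (wt_space_lin (- (b / a)) wu wv) => -[c cE]; apply.
move: cE; rewrite ops_is_linear aE bE scalerA mulNr divfK // -scalerDl addNr scale0r.
by move/esym/eqP; rewrite scaler_eq0 (negPf Omega_neq0) orbF => /eqP.
Qed.

(** A nonzero image would have weight [low - alpha k]. The inverse of [w0] carries this to [lambda]
    plus a nonempty sum of simple roots, whereas all weights are [lambda] minus such sums. *)
Lemma low_killed v k r : wt_space V low v -> xpm V false k r *m v = 0.
Proof.
(* [longest_word_neg] requires [alpha k] to occur as a root in the endomorphisms. If
   [x^+_{k,0} = 0], then [xi_{k,0} = 0], and [x^-_{k,r}], of weight [-2 d_k] under [xi_{k,0}],
   vanishes altogether. *)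
move=> wv; have [x0|x0] := eqVneq (xpm V true k 0) 0.
  suff -> : xpm V false k r = 0 by rewrite mul0mx.
  have xi0 : xi V k 0 = 0.
    have := xp_xm V k k 0 0; rewrite eqxx x0 => <-.
    by rewrite /comm_mx_bracket mulmx0 mul0mx subrr.
  have := xi0_x V false k k r; rewrite xi0 /comm_mx_bracket mulmx0 mul0mx subrr.
  move/esym/eqP; rewrite scaler_eq0 cartan_diag => /orP[|/eqP //].
  rewrite !mulf_eq0 (negPf (dsym_neq0 k)) orbF oppr_eq0 oner_eq0 /=.
  by rewrite pnatr_eq0.
apply/eqP/negPn/negP => xv0.
have wxv := x_weight k2_neq0 false k r wv.
have [s s0 sE] := longest_word_neg k2_neq0 w0P (groot_alpha k2_neq0 x0).
have Ix := wt_hw_integral wxv xv0.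
have [l /(_ _ wxv) [wl li]] := wt_weyl vh_vx vx_vx (rev w0) Ix.
have y0 : ops vx l (xpm V false k r *m v) != 0.
  by apply: contra xv0 => /eqP/li ->.
have [m] := hw_weight wl y0.
rewrite scaleN1r weyl_wordB weyl_word_revK -[- weyl_word _ _]opprK -scaleN1r.
rewrite scaleN1r opprK sE => /addrI mE.
case: s s0 mE {sE} => [//|i s] _ mE.
have : (rsum (i :: s) + qsum m) (varpi i) = 0 :> K by rewrite mE addNr lfunE.
by rewrite add_lfunE rsum_varpi qsum_varpi -natrD /= eqxx => /eqP; rewrite pnatr_eq0.
Qed.

(** A submodule containing [v0] contains [Omega], because some word maps [v0] to a nonzero multiple
    of [Omega]; so [v0] is cyclic, and the mirror case of [generated_ind] applies. *)
Lemma low_ind v0 (Q : 'cV[K]_N -> Prop) : wt_space V low v0 -> v0 != 0 -> Q v0 ->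
  (forall a v w, Q v -> Q w -> Q (a *: v + w)) ->
  (forall k r v, Q v -> Q (xpm V true k r *m v)) -> forall v, Q v.
Proof.
move=> wv0 v00 Qv0 Ql Qx; apply: (@generated_ind _ _ _ _ V k2_neq0 true v0) => //.
- by move=> k r; apply: low_killed.
- move=> k r; apply: (low_line wv0 _ v00) => t.
  by rewrite mulmxA cartan_act_xi -mulmxA wv0 -scalemxAr.
- move=> U v0U Uxi Ux; apply: Omega_gen => //.
  have [l /(_ _ wv0) [a opE a0]] := low_to_hw.
  have an0 : a != 0 by apply: contra v00 => /eqP/a0 ->.
  have -> : Omega = a^-1 *: ops vx l v0 by rewrite opE scalerA mulVf // scale1r.
  by apply: rpredZ; apply: vx_ops_closed.
Qed.

End Lowest.

End HighestWeight.

(** * Rational matrix functions *)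

Section Generic.
Variable K : numFieldType.

(** All but finitely many points; such a property holds in a punctured neighbourhood of every point
    and on a half-plane far enough to the right. *)
Definition generic (Q : K -> Prop) :=
  exists2 B : {poly K}, B != 0 & forall u, B.[u] != 0 -> Q u.

Lemma generic_imp (P Q : K -> Prop) : (forall u, P u -> Q u) -> generic P -> generic Q.
Proof. by move=> PQ [B B0 BP]; exists B => // u /BP/PQ. Qed.

Lemma generic_and P Q : generic P -> generic Q -> generic (fun u => P u /\ Q u).
Proof.
move=> [B B0 BP] [D D0 DQ]; exists (B * D); first by rewrite mulf_neq0.
by move=> u; rewrite hornerM mulf_eq0 negb_or => /andP[/BP Pu /DQ Qu].
Qed.

Lemma generic_true (P : K -> Prop) : (forall u, P u) -> generic P.
Proof. by move=> H; exists 1; rewrite ?oner_eq0. Qed.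

Lemma generic_all (I : eqType) (s : seq I) (P : I -> K -> Prop) :
  (forall i, i \in s -> generic (P i)) ->
  generic (fun u => forall i, i \in s -> P i u).
Proof.
elim: s => [|j s IH] H; first exact: generic_true.
have /generic_and : generic (P j) by apply: H; apply: mem_head.
move=> /(_ (fun u => forall i, i \in s -> P i u)) [|B B0 BP].
  by apply: IH => i si; apply: H; rewrite in_cons si orbT.
exists B => // u /BP [Pj Ps] i; rewrite in_cons => /predU1P [->|] //.
exact: Ps.
Qed.

Lemma generic_forall (I : finType) (P : I -> K -> Prop) :
  (forall i, generic (P i)) -> generic (fun u => forall i, P i u).
Proof.
move=> H; have [|B B0 BP] := @generic_all _ (enum I) P; first by move=> i _; apply: H.
by exists B => // u /BP Pu i; apply: Pu; rewrite mem_enum.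
Qed.

Lemma generic_shift (P : K -> Prop) s : generic P -> generic (fun u => P (u + s)).
Proof.
move=> [B B0 BP]; exists (B \Po ('X + s%:P)).
  by rewrite comp_poly_eq0 // size_XaddC.
by move=> u; rewrite horner_comp !hornerE => /BP.
Qed.

Lemma generic_root (B : {poly K}) : B != 0 -> generic (fun u => B.[u] != 0).
Proof. by move=> B0; exists B. Qed.

Lemma poly_zero_fun (B : {poly K}) : (forall u, B.[u] = 0) -> B = 0.
Proof.
move=> B0; apply/eqP/negPn/negP => Bn0.
have u : uniq [seq (i%:R : K) | i <- iota 0 (size B)].
  by rewrite map_inj_uniq ?iota_uniq //; apply: (mulrIn (@oner_neq0 K)).
have r : all (root B) [seq (i%:R : K) | i <- iota 0 (size B)].
  by apply/allP => x _; rewrite /root B0.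
by have := max_poly_roots Bn0 r u; rewrite size_map size_iota ltnn.
Qed.

End Generic.

Section EvalMx.
Variables (K : numClosedFieldType) (N : nat).
Implicit Types P Q : 'M[{poly K}]_N.

Lemma evalmxM P Q u : evalmx (P *m Q) u = evalmx P u *m evalmx Q u.
Proof. exact: map_mxM. Qed.

Lemma evalmxZ (d : {poly K}) P u : evalmx (d *: P) u = d.[u] *: evalmx P u.
Proof. exact: map_mxZ. Qed.

Lemma evalmxB P Q u : evalmx (P - Q) u = evalmx P u - evalmx Q u.
Proof. exact: map_mxB. Qed.

Lemma evalmx_polyC (M : 'M[K]_N) u : evalmx (map_mx polyC M) u = M.
Proof. by apply/matrixP => p q; rewrite !mxE /= /horner_eval hornerC. Qed.

Lemma det_evalmx P u : \det (evalmx P u) = (\det P).[u].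
Proof. exact: (det_map_mx (horner_eval u)). Qed.

Lemma adj_evalmx P u : \adj (evalmx P u) = evalmx (\adj P) u.
Proof. by rewrite /evalmx map_mx_adj. Qed.

Lemma evalmx_coef P u n : (forall m, (n <= m)%N -> coefmx P m = 0) ->
  evalmx P u = \sum_(m < n) u ^+ m *: coefmx P m.
Proof.
move=> Pn; apply/matrixP => p q; rewrite !mxE summxE /horner_eval.
rewrite (@horner_coef_wide _ n); last first.
  apply/leq_sizeP => m nm; have /matrixP/(_ p q) := Pn m nm.
  by rewrite !mxE.
by apply: eq_bigr => m _; rewrite !mxE mulrC.
Qed.

Definition rational_mx (F : K -> 'M[K]_N) := exists Num : 'M[{poly K}]_N,
  exists2 Den : {poly K}, Den != 0 & generic (fun u => F u = Den.[u]^-1 *: evalmx Num u).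

Lemma rational1 : rational_mx (fun=> 1%:M).
Proof.
exists 1%:M, 1; rewrite ?oner_eq0 //; apply: generic_true => u.
by rewrite hornerE invr1 scale1r /evalmx map_mx1.
Qed.

Lemma rationalM F G : rational_mx F -> rational_mx G -> rational_mx (fun u => F u *m G u).
Proof.
move=> [P [D D0 FE]] [Q [B B0 GE]]; exists (P *m Q), (D * B); first by rewrite mulf_neq0.
apply: generic_imp (generic_and FE GE) => u [-> ->].
by rewrite -scalemxAl -scalemxAr scalerA -invfM hornerM evalmxM.
Qed.

Lemma rational_prod (I : Type) (s : seq I) (F : I -> K -> 'M[K]_N) :
  (forall i, rational_mx (F i)) -> rational_mx (fun u => \prod_(i <- s) F i u).
Proof.
move=> RF; elim: s => [|i s IH].
  have [P [D D0 E]] := rational1; exists P, D => //.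
  by apply: generic_imp E => u <-; rewrite big_nil.
have [P [D D0 E]] := rationalM (RF i) IH; exists P, D => //.
by apply: generic_imp E => u <-; rewrite big_cons.
Qed.

Lemma rationalX F k : rational_mx F -> rational_mx (fun u => F u ^+ k).
Proof.
move=> RF; elim: k => [|k IH].
  have [P [D D0 E]] := rational1; exists P, D => //.
have [P [D D0 E]] := rationalM RF IH; exists P, D => //.
by apply: generic_imp E => u <-; rewrite exprS.
Qed.

Lemma rational_inv F : rational_mx F -> generic (fun u => F u \in unitmx) ->
  rational_mx (fun u => invmx (F u)).
Proof.
move=> [P [D D0 FE]] Fu; have [B B0 BP] := generic_and FE Fu.
have detP : \det P != 0.
  apply/eqP => dP; have : B * D != 0 by rewrite mulf_neq0.
  have [u] : exists u, (B * D).[u] != 0.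
    apply: contrapT => /forallNP N0; move: (mulf_neq0 B0 D0).
    have BD u : (B * D).[u] = 0 by apply/eqP/negPn/negP; exact: N0.
    by rewrite (poly_zero_fun BD) eqxx.
  rewrite hornerM mulf_eq0 negb_or => /andP[/BP[FP uF] Du] _.
  move: uF; rewrite FP unitmxE detZ det_evalmx dP horner0 mulr0 unitr0 //.
exists (D *: \adj P), (\det P) => //.
apply: generic_imp (generic_and (generic_and FE Fu) (generic_root D0)) => u.
move=> [[FP uF] Du]; move: (uF); rewrite FP => Pun.
have Pu : evalmx P u \in unitmx.
  by move: Pun; rewrite unitmxZ // unitfE invr_eq0.
by rewrite invmxZ // invrK evalmxZ -adj_evalmx /invmx Pu -det_evalmx !scalerA mulrC.
Qed.

Lemma rational_shift F s : rational_mx F -> rational_mx (fun u => F (u + s)).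
Proof.
move=> [P [D D0 FE]]; exists (map_mx (comp_poly ('X + s%:P)) P), (D \Po ('X + s%:P)).
  by rewrite comp_poly_eq0 // size_XaddC.
apply: generic_imp (generic_shift s FE) => u ->.
congr (_ *: _); first by rewrite horner_comp !hornerE.
by apply/matrixP => p q; rewrite !mxE /horner_eval horner_comp !hornerE.
Qed.

End EvalMx.

(** * Denominators of power series at infinity *)

Section Expansion.
Variables (K : numClosedFieldType) (N : nat).
Implicit Types (F : nat -> 'M[K]_N) (P : 'M[{poly K}]_N) (D : {poly K}).

Definition expands F P D : Prop :=
  (forall m : nat, \sum_(m <= j < size D) D`_j *: F (j - m)%N = coefmx P m) /\
  (forall k : nat, \sum_(j < size D) D`_j *: F (j + k.+1)%N = 0).

Lemma expands_exists F D :
  (forall k : nat, \sum_(j < size D) D`_j *: F (j + k.+1)%N = 0) ->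
  exists P, expands F P D.
Proof.
move=> H; exists (\matrix_(p, q) \poly_(m < size D)
  (\sum_(m <= j < size D) D`_j *: F (j - m)%N) p q); split=> // m.
apply/matrixP => p q; rewrite /coefmx !mxE /= coef_poly; case: ltnP => // mD.
by rewrite big_geq // mxE.
Qed.

(** The polynomial part of [w^j] times the series, in Horner form. *)
Fixpoint psum F (w : K) (j : nat) : 'M[K]_N :=
  if j is j'.+1 then w *: psum F w j' + F j'.+1 else F 0%N.

Lemma psumE F w j : psum F w j = \sum_(m < j.+1) w ^+ m *: F (j - m)%N.
Proof.
elim: j => [|j IH] /=; first by rewrite big_ord1 scale1r.
rewrite [RHS]big_ord_recl scale1r subn0 addrC IH scaler_sumr; congr (_ + _).
by apply: eq_bigr => m _; rewrite scalerA -exprS.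
Qed.

Lemma expands_eval F P D w : expands F P D ->
  evalmx P w = \sum_(j < size D) D`_j *: psum F w j.
Proof.
move=> [PE _]; rewrite (@evalmx_coef _ _ _ _ (size D)); last first.
  by move=> m Dm; rewrite -PE big_geq.
transitivity (\sum_(m < size D) \sum_(j < size D | (m <= j)%N)
    w ^+ m *: (D`_j *: F (j - m)%N)).
  apply: eq_bigr => m _; rewrite -PE scaler_sumr.
  by rewrite (big_geq_mkord m (size D) xpredT (fun j => w ^+ m *: (D`_j *: F (j - m)%N))).
rewrite (exchange_big_dep xpredT) //=; apply: eq_bigr => j _.
rewrite psumE (big_ord_widen (size D) (fun m => w ^+ m *: F (j - m)%N)) ?ltn_ord //.
rewrite scaler_sumr.
by apply: eq_big => [m|m _]; rewrite ?ltnS // !scalerA mulrC.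
Qed.

(** Each further factor [w] replaces [psum] by its successor up to a coefficient of the series;
    these coefficients, weighted by [D], add up to zero by the second half of [expands]. *)
Lemma expands_psum_shift F P D w l : expands F P D ->
  w ^+ l *: evalmx P w = \sum_(j < size D) D`_j *: psum F w (j + l).
Proof.
move=> FPD; elim: l => [|l IH].
  by rewrite scale1r (expands_eval w FPD); apply: eq_bigr => j _; rewrite addn0.
rewrite exprS -scalerA IH scaler_sumr.
have E := proj2 FPD l; rewrite -[LHS]addr0 -[X in _ + X]E -big_split /=; apply: eq_bigr => j _.
by rewrite addnS /= scalerDr !scalerA mulrC.
Qed.

(** Both sides equal one double sum over the coefficients of [D] and [D'] that is symmetric in the
    two expansions. *)
Lemma expands_unique F P D P' D' w : expands F P D -> expands F P' D' ->
  D'.[w] *: evalmx P w = D.[w] *: evalmx P' w.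
Proof.
move=> FPD FPD'.
have E P0 D0 D1 : expands F P0 D0 -> D1.[w] *: evalmx P0 w =
    \sum_(l < size D1) \sum_(j < size D0) (D1`_l * D0`_j) *: psum F w (l + j).
  move=> H; rewrite horner_coef scaler_suml; apply: eq_bigr => l _.
  rewrite -scalerA (expands_psum_shift w l H) scaler_sumr; apply: eq_bigr => j _.
  by rewrite scalerA addnC.
rewrite (E _ _ _ FPD) (E _ _ _ FPD') exchange_big /=; apply: eq_bigr => l _.
by apply: eq_bigr => j _; rewrite mulrC addnC.
Qed.

(** The top coefficient of [P] is the leading coefficient of [D] times the identity, so [P] is
    invertible near infinity. *)
Lemma expands_det F P D : F 0%N = 1%:M -> D != 0 -> expands F P D -> \det P != 0.
Proof.
move=> F0 D0 [PE _]; pose d := (size D).-1.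
have dD : size D = d.+1 by rewrite prednK // lt0n size_poly_eq0.
have Pd : coefmx P d = lead_coef D *: 1%:M.
  by rewrite -PE dD big_nat1 subnn F0 lead_coefE.
have Pgt m : (d < m)%N -> coefmx P m = 0 by move=> dm; rewrite -PE big_geq // dD.
(* The reversed polynomial [t^d P(1/t)], whose value at zero is the top coefficient of [P]. *)
pose Pr : 'M[{poly K}]_N := \sum_(m < d.+1) 'X^(d - m) *: map_mx polyC (coefmx P m).
have Pr0 : \det Pr != 0.
  have : (\det Pr).[0] != 0.
    rewrite -det_evalmx /evalmx raddf_sum /= big_ord_recr /= big1 ?add0r.
      rewrite subnn scale1r Pd (_ : map_mx _ _ = lead_coef D *: 1%:M).
        by rewrite detZ det1 mulr1 expf_neq0 // lead_coef_eq0.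
      by apply/matrixP => p q; rewrite !mxE /horner_eval hornerC.
    move=> m _; apply/matrixP => p q.
    by rewrite !mxE /horner_eval hornerM hornerXn hornerC expr0n subn_eq0 leqNgt ltn_ord mul0r.
  by apply: contraNneq => ->; rewrite horner0.
apply/eqP => dP0.
have root_all t : t != 0 -> (\det Pr).[t] = 0.
  move=> t0; rewrite -det_evalmx.
  have -> : evalmx Pr t = t ^+ d *: evalmx P t^-1.
    rewrite (@evalmx_coef _ _ P _ d.+1) // scaler_sumr /evalmx raddf_sum /=.
    apply: eq_bigr => m _; apply/matrixP => p q.
    rewrite !mxE /horner_eval hornerM hornerXn hornerC mulrA; congr (_ * _).
    have md : (m <= d)%N by rewrite -ltnS.
    have -> : t ^+ d = t ^+ (d - m) * t ^+ m by rewrite -exprD subnK.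
    by rewrite exprVn mulfK // expf_neq0.
  by rewrite detZ det_evalmx dP0 horner0 mulr0.
pose B := \det Pr * 'X.
have : B = 0.
  apply: poly_zero_fun => x; rewrite /B hornerM hornerX.
  by have [->|x0] := eqVneq x 0; rewrite ?mulr0 // root_all // mul0r.
by move/eqP; rewrite mulf_eq0 polyX_eq0 (negPf Pr0).
Qed.

End Expansion.

Lemma inverse_qnumbers (F : fieldType) (q : F) n (b : 'I_n -> 'I_n -> int) (m : int)
    (c : 'I_n -> 'I_n -> {fsfun int -> nat with 0%N})
    (qn := fun m : int => (q ^ m - q ^ (- m)) / (q - q^-1))
    (B := \matrix_(i, j) qn (b i j)) :
  q != 0 -> q - q^-1 != 0 -> B \in unitmx ->
  invmx B = (qn m)^-1 *:
    \matrix_(i, j) \sum_(r <- finsupp (c i j)) q ^ r *+ c i j r ->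
  forall i k, \sum_j \sum_(r <- finsupp (c i j))
    (q ^ (r + b j k) - q ^ (r - b j k)) *+ c i j r =
    (q ^ m - q ^ (- m)) *+ (i == k).
Proof.
move=> q0 qq0 uB iB i k.
have qi0 : qn m != 0.
  apply/eqP => qE; have := mulmxV uB; rewrite iB qE invr0 scale0r mulmx0.
  by move=> /matrixP/(_ i i); rewrite !mxE eqxx => /eqP; rewrite eq_sym oner_eq0.
have /matrixP/(_ i k) : (\matrix_(i, j) \sum_(r <- finsupp (c i j)) q ^ r *+ c i j r)
    *m B = qn m *: 1%:M.
  by rewrite -(mulVmx uB) iB -scalemxAl scalerA mulfV // scale1r.
rewrite !mxE /= => /(congr1 (fun z => z * (q - q^-1))).
have -> : qn m * (i == k)%:R * (q - q^-1) = (q ^ m - q ^ (- m)) *+ (i == k).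
  by rewrite mulrAC mulr_natr /qn divfK.
move=> <-; rewrite mulr_suml; apply: eq_bigr => j _.
rewrite !mxE /qn -mulrA divfK // mulr_suml; apply: eq_bigr => r _.
by rewrite mulrnAl !expfzDr // mulrBr.
Qed.

(** * Annihilators and commutation of [xi_j(w)] with the generators [x_k] *)

Section Relations.
Variables (K : numClosedFieldType) (L : simple_lie K) (hbar : K) (N : nat).
Notation n := (rank L).
Variable V : yangian_rep L hbar N.
Hypothesis k2_neq0 : kappa2 L != 0%N.
Notation xs := (xs V).
Notation ac := (@ac K L hbar).

Lemma xs_polyC e k a (p : {poly K}) : xs e k (a%:P * p) = a *: xs e k p.
Proof. by rewrite mul_polyC; exact: (linearZ_LR (xs e k)). Qed.

Lemma xs_mulXD e k a (p : {poly K}) :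
  xs e k (('X + a%:P) * p) = xs e k ('X * p) + a *: xs e k p.
Proof. by rewrite mulrDl (linearD (xs e k)) /= xs_polyC. Qed.

Lemma xs_mulXB e k a (p : {poly K}) :
  xs e k (('X - a%:P) * p) = xs e k ('X * p) - a *: xs e k p.
Proof. by rewrite mulrBl (linearB (xs e k)) /= xs_polyC. Qed.

Lemma xs_mulBX e k a (p : {poly K}) :
  xs e k ((a%:P - 'X) * p) = a *: xs e k p - xs e k ('X * p).
Proof. by rewrite mulrBl (linearB (xs e k)) /= xs_polyC. Qed.

(** In [xi_xs] with [r = 0] only the commutator of [xi_{k,0}] with [x_k[X p]] survives, and it
    equals [x_k[X p]] times [2 d_k] up to sign. Thus the kernel of [xs e k] is an ideal. *)
Lemma xs_mulX_eq0 e k p : xs e k p = 0 -> xs e k ('X * p) = 0.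
Proof.
move=> p0; have := xi_xs V e k k 0 p.
rewrite xs_mulXD xs_mulXB p0.
rewrite scaler0 addr0 subr0 mulmx0 mul0mx subrr (xi0_xs V k2_neq0).
rewrite addrAC subrr add0r cartan_diag => /esym/eqP.
rewrite scaler_eq0 => /orP[|/eqP //].
rewrite !mulf_eq0 (negPf (dsym_neq0 k)) orbF -[2%:~R]/(2%:R) pnatr_eq0 orbF.
by case: (e); rewrite /= ?oppr_eq0 oner_eq0.
Qed.

Lemma xs_mul_eq0 e k p : xs e k p = 0 -> forall q, xs e k (p * q) = 0.
Proof.
move=> p0 q; elim/poly_lin_ind: q => [a q r Eq Er|s].
  have -> : p * (a *: q + r) = a *: (p * q) + p * r by rewrite mulrDr -scalerAr.
  by rewrite (linearP (xs e k)) /= Eq Er scaler0 addr0.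
elim: s => [|s IH]; first by rewrite mulr1.
by rewrite exprS mulrCA xs_mulX_eq0.
Qed.

(** Finite dimension gives a linear relation among the [x_{k,s}], and the kernel is an ideal. *)
Lemma xs_annihilator e k : exists2 chi, chi != 0 & forall q, xs e k (chi * q) = 0.
Proof.
suff [chi c0 xc] : exists2 chi, chi != 0 & xs e k chi = 0.
  by exists chi => //; apply: xs_mul_eq0.
apply: contrapT => Nchi; pose D := \dim {: 'M[K]_N}.
suff : free [tuple xpm V e k s | s < D.+1].
  rewrite /free size_tuple => /eqP E.
  by have := dimvS (subvf <<[tuple xpm V e k s | s < D.+1]>>%VS); rewrite E ltnn.
apply: free_mktuple => c E s.
pose p := \poly_(s < D.+1) c (inord s).
have pE : p = \sum_(s < D.+1) c s *: 'X^s.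
  by rewrite /p poly_def; apply: eq_bigr => i _; rewrite inord_val.
have xp : xs e k p = 0.
  rewrite pE linear_sum -[RHS]E; apply: eq_bigr => i _.
  by rewrite (linearZ_LR (xs e k)) /= xsXn.
have p0 : p = 0 by apply/eqP/negPn/negP => p0; apply: Nchi; exists p.
have : p`_s = 0 by rewrite p0 coef0.
by rewrite coef_poly ltn_ord inord_val.
Qed.

(** Commutation of [S] with [x_k] up to the rational factor [r / l], denominators cleared; the
    factors multiply under products of the [S] and are inverted with [S]. *)
Definition xs_rel e k (S : 'M[K]_N) (l r : {poly K}) :=
  forall p, S *m xs e k (l * p) = xs e k (r * p) *m S.

Lemma rel1 e k : xs_rel e k 1 1 1.
Proof. by move=> p; rewrite [1 *m _]mul1mx [_ *m 1]mulmx1. Qed.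

Lemma relM e k S S' l l' r r' : xs_rel e k S l r -> xs_rel e k S' l' r' ->
  xs_rel e k (S *m S') (l * l') (r * r').
Proof.
move=> Sr S'r p; have -> : l * l' * p = l' * (l * p) by rewrite mulrA [l' * l]mulrC.
have -> : r * r' * p = r * (r' * p) by rewrite mulrA.
by rewrite -mulmxA S'r mulrCA mulmxA Sr -mulmxA.
Qed.

Lemma rel_inv e k S l r : S \in unitmx -> xs_rel e k S l r -> xs_rel e k (invmx S) r l.
Proof.
move=> Su Sr p; apply: (can_inj (mulKmx Su)); rewrite mulKVmx // mulmxA Sr.
by rewrite -mulmxA mulmxV // mulmx1.
Qed.

Lemma rel_prod e k (I : Type) (s : seq I) (S : I -> 'M[K]_N) l r :
  (forall i, xs_rel e k (S i) (l i) (r i)) ->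
  xs_rel e k (\prod_(i <- s) S i) (\prod_(i <- s) l i) (\prod_(i <- s) r i).
Proof.
move=> H; elim: s => [|i s IH]; first by rewrite !big_nil; apply: rel1.
by rewrite !big_cons; apply: relM.
Qed.

Lemma rel_prod_in e k (I : eqType) (s : seq I) (S : I -> 'M[K]_N) l r :
  (forall i, i \in s -> xs_rel e k (S i) (l i) (r i)) ->
  xs_rel e k (\prod_(i <- s) S i) (\prod_(i <- s) l i) (\prod_(i <- s) r i).
Proof.
elim: s => [|i s IH] H; first by rewrite !big_nil; apply: rel1.
rewrite !big_cons; apply: relM; first by apply: H; apply: mem_head.
by apply: IH => j js; apply: H; rewrite in_cons js orbT.
Qed.

Lemma relX e k S l r m : xs_rel e k S l r -> xs_rel e k (S ^+ m) (l ^+ m) (r ^+ m).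
Proof.
move=> H; elim: m => [|m IH]; first exact: rel1.
by rewrite !exprS; apply: relM.
Qed.

(** Modulo the annihilator [chi] the polynomial [l] is invertible, so every argument of [xs] can be
    taken divisible by [l]; then [r / l] may be replaced by the equal fraction [g / f]. *)
Lemma rel_cancel e k S l r f g chi : xs_rel e k S l r -> r * f = l * g ->
  coprimep l chi -> (forall q, xs e k (chi * q) = 0) -> xs_rel e k S f g.
Proof.
move=> Sr rf /Bezout_coprimepP [[a b] /= ab] xchi p.
have [c c0 cE] : exists2 c, c != 0 & a * l + b * chi = c%:P.
  by move: ab; rewrite -size_poly_eq1 => /size_poly1P.
have xE q : xs e k q = c^-1 *: xs e k (l * (a * q)).
  have E : c%:P * q = l * (a * q) + chi * (b * q).
    by rewrite -cE mulrDl !mulrA [a * l]mulrC [b * chi]mulrC.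
  have := congr1 (xs e k) E; rewrite xs_polyC (linearD (xs e k)) /= xchi addr0 => <-.
  by rewrite scalerA mulVf // scale1r.
rewrite xE -scalemxAr Sr [xs e k (g * p)]xE -scalemxAl; congr (_ *: (xs e k _ *m _)).
by rewrite !(mulrCA _ a) ![_ * (_ * p)]mulrA rf.
Qed.

Definition xi_ser j r : 'M[K]_N := if r is r'.+1 then hbar *: xi V j r' else 1%:M.

Definition brac (A B Y : 'M[K]_N) : 'M[K]_N := Y *m A - B *m Y.

Lemma brac_is_linear A B : linear (brac A B).
Proof.
by move=> a x y; rewrite /brac mulmxDr mulmxDl -scalemxAr -scalemxAl scaler_combB.
Qed.

HB.instance Definition _ A B :=
  GRing.isLinear.Build K 'M[K]_N 'M[K]_N *:%R (brac A B) (brac_is_linear A B).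

(** With the constant term 1 of the series included, the relation for [xi_{j,0}] becomes the case
    [r = 0] of the general recursion: both sides are then [2 a x_k[p]]. *)
Lemma xi_ser_brac e j k p r (a := ac e j k) :
  brac (xs e k p) (xs e k p) (xi_ser j r.+1) =
  brac (xs e k (('X + a%:P) * p)) (xs e k (('X - a%:P) * p)) (xi_ser j r).
Proof.
case: r => [|r] /=.
  rewrite /brac mul1mx mulmx1 -scalemxAl -scalemxAr -scalerBr (xi0_xs V k2_neq0).
  rewrite addrAC subrr add0r scalerA xs_mulXD xs_mulXB.
  rewrite opprB [RHS](AC (2*2) ((1*4)*(2*3))) /= subrr add0r -scalerDl.
  congr (_ *: _); rewrite /a /ac -mulr2n -mulr_natr.
  by field.
rewrite !(linearZ_LR (brac _ _)) /=; congr (_ *: _).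
exact: xi_xs.
Qed.

Lemma psum_brac e j k p w m (a := ac e j k) :
  brac (xs e k p) (xs e k p) (psum (xi_ser j) w m.+1) =
  brac (xs e k (('X + a%:P) * p)) (xs e k (('X - a%:P) * p)) (psum (xi_ser j) w m).
Proof.
elim: m => [|m IH].
  rewrite [psum _ _ 1]/(w *: xi_ser j 0 + xi_ser j 1) brac_is_linear xi_ser_brac.
  by rewrite [brac _ _ (xi_ser j 0)]/brac /= mul1mx mulmx1 subrr scaler0 add0r.
rewrite [psum _ _ m.+2]/(w *: psum (xi_ser j) w m.+1 + xi_ser j m.+2).
by rewrite brac_is_linear IH xi_ser_brac -brac_is_linear.
Qed.

(** Multiplication by [w] shifts the partial sums by one index, where [psum_brac] applies. The
    outcome says that [xi_j(w)] commutes with [x_k] up to the factor [(w + a - X) / (w - a - X)]. *)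
Lemma rel_xi e j k P D w (a := ac e j k) : expands (xi_ser j) P D ->
  xs_rel e k (evalmx P w) ((w - a)%:P - 'X) ((w + a)%:P - 'X).
Proof.
move=> PD p; set Y := evalmx P w.
have : w *: brac (xs e k p) (xs e k p) Y =
    brac (xs e k (('X + a%:P) * p)) (xs e k (('X - a%:P) * p)) Y.
  rewrite -(linearZ_LR (brac _ _)) /= -[w]expr1 (expands_psum_shift w 1 PD).
  rewrite /Y (expands_eval w PD) !linear_sum; apply: eq_bigr => m _.
  by rewrite !(linearZ_LR (brac _ _)) /= addn1 psum_brac.
rewrite /brac xs_mulXD xs_mulXB !xs_mulBX.
rewrite !mulmxDr !mulmxDl !mulmxN !mulNmx -!scalemxAr -!scalemxAl scalerBr.
rewrite !scalerBl !scalerDl.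
set A := Y *m xs e k p; set B := xs e k p *m Y.
set A' := Y *m xs _ _ _; set B' := xs _ _ _ *m Y => /eqP.
rewrite -subr_eq0 => /eqP E; apply/eqP; rewrite -subr_eq0 -[X in _ == X]E.
apply/eqP; rewrite !opprD !opprK.
by rewrite [LHS](AC (3*3) ((1*4)*(3*2)*(6*5))) [RHS](AC (2*(2*2)) ((1*2)*(3*4)*(5*6))).
Qed.

Variable c : 'I_n -> 'I_n -> {fsfun int -> nat with 0%N}.
Hypothesis hc : inverse_qcartan c.

Notation b := (fun j k : 'I_n => ((dsym j)%:Z * cartan j k)%R).

(** The exponents, with multiplicity, of the sum over [j] of [c_ij(q) q^(e b_jk)]. They index the
    linear factors in the relation between [A_i(u)] and [x^-_k]: sign [-1] on the left, sign [1] on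
    the right. *)
Definition shifts (e : int) i k : seq int :=
  flatten [seq flatten [seq nseq (c i j r) (r + e * b j k)%R | r <- finsupp (c i j)]
          | j <- index_enum 'I_n].

Lemma big_shifts (M : Type) (idx : M) (op : Monoid.com_law idx) e i k (F : int -> M) :
  \big[op/idx]_(x <- shifts e i k) F x =
  \big[op/idx]_(j < n) \big[op/idx]_(r <- finsupp (c i j))
     iterop (c i j r) op (F (r + e * b j k)%R) idx.
Proof.
rewrite /shifts big_flatten big_map; apply: eq_bigr => j _.
rewrite big_flatten big_map; apply: eq_bigr => r _.
by rewrite big_nseq_cond /= Monoid.iteropE.
Qed.

Lemma qvar_neq0 : qvar != 0.
Proof. by rewrite tofrac_eq0 polyX_eq0. Qed.

Lemma qvar_sub_neq0 : qvar - qvar^-1 != 0.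
Proof.
apply/eqP => /eqP; rewrite subr_eq0 => /eqP qq.
have : qvar * qvar = 1 by rewrite {2}qq mulfV // qvar_neq0.
rewrite /qvar -tofracM -tofrac1 => /eqP; rewrite tofrac_eq.
by move/eqP/(congr1 (fun p : {poly rat} => p`_2)); rewrite -expr2 coefXn coef1.
Qed.

(* Entry [(i, k)] of the identity [c B = [2 kappa]_q], cleared of denominators. *)
Lemma qcartan_identity i k :
  \sum_(x <- shifts 1 i k) qvar ^ x - \sum_(x <- shifts (-1) i k) qvar ^ x =
  (qvar ^ (kappa2 L)%:Z - qvar ^ (- (kappa2 L)%:Z)) *+ (i == k).
Proof.
have [uB iB] := hc.
rewrite -(inverse_qnumbers qvar_neq0 qvar_sub_neq0 uB iB i k).
rewrite !big_shifts -sumrB; apply: eq_bigr => j _.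
rewrite -sumrB; apply: eq_bigr => r _.
rewrite -[iterop _ _ _ _]/(_ *+ _) -[X in _ - X]/(_ *+ _) -mulrnBl.
by rewrite mul1r mulN1r.
Qed.

End Relations.

(** The coefficients of these Laurent polynomials are multiplicities, and characteristic zero lets
    them be compared as natural numbers. *)
Lemma laurent_perm (s1 s2 : seq int) :
  \sum_(x <- s1) qvar ^ x = \sum_(x <- s2) qvar ^ x -> perm_eq s1 s2.
Proof.
(* Multiplying by [q^M] makes every exponent nonnegative, which turns the identity into one of
   polynomials. *)
move=> E; pose M := \sum_(x <- s1 ++ s2) `|x|%N.
have xM x : x \in s1 ++ s2 -> 0 <= x + M%:Z.
  move=> xs; have : (`|x| <= M)%N by rewrite /M (big_rem _ xs) /= leq_addr.
  by lia.
pose t (x : int) := absz (x + M%:Z).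
have sumE s : {subset s <= s1 ++ s2} ->
    (\sum_(x <- s) qvar ^ x) * qvar ^ M%:Z = tofrac (\sum_(x <- s) 'X^(t x)).
  elim: s => [|x s IH] sub; first by rewrite !big_nil mul0r tofrac0.
  rewrite !big_cons mulrDl tofracD -IH => [|y ys]; last by apply: sub; rewrite in_cons ys orbT.
  congr (_ + _); have xM0 := xM _ (sub _ (mem_head _ _)).
  by rewrite -expfzDr ?qvar_neq0 // -(gez0_abs xM0) -/(t x) tofracXn.
have coefE s k : (\sum_(x <- s) 'X^(t x) : {poly rat})`_k = (count (fun x => t x == k) s)%:R.
  rewrite coef_sum; elim: s => [|x s IH]; first by rewrite big_nil.
  by rewrite big_cons IH coefXn /= natrD eq_sym.
have /eqP := congr1 (fun z => z * qvar ^ M%:Z) E.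
rewrite !sumE => [|x xs|x xs]; rewrite ?mem_cat ?xs ?orbT //.
rewrite tofrac_eq => /eqP pE; apply/allP => x xs /=; apply/eqP.
have /eqP := congr1 (fun p : {poly rat} => p`_(t x)) pE.
rewrite !coefE eqr_nat => /eqP cE.
have tE s : {subset s <= s1 ++ s2} -> count (fun y => t y == t x) s = count_mem x s.
  move=> sub; apply: eq_in_count => y /sub/xM yM0 /=; move: yM0 (xM _ xs).
  rewrite /t => y0 x0; apply/eqP/eqP => [E2|-> //]; lia.
by rewrite -!tE // => y ys; rewrite mem_cat ys ?orbT.
Qed.

Lemma subr_eq_add (Z : zmodType) (x y p m : Z) : x - y = p - m -> m + x = p + y.
Proof. by move/eqP; rewrite subr_eq => /eqP ->; rewrite addrA [m + _]addrC subrK. Qed.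

(** * The operator [A_i(u)] *)

Section AOperator.
Variables (K : numClosedFieldType) (L : simple_lie K) (hbar : K) (N : nat).
Notation n := (rank L).
Variable V : yangian_rep L hbar N.
Hypothesis k2_neq0 : kappa2 L != 0%N.
Variable c : 'I_n -> 'I_n -> {fsfun int -> nat with 0%N}.
Hypothesis hc : inverse_qcartan c.
Variable X : 'I_n -> K -> 'M[K]_N.
Hypothesis XE : forall j, exists P D, [/\ D != 0, expands (xi_ser V j) P D &
  forall w, D.[w] != 0 -> X j w = D.[w]^-1 *: evalmx P w].

Definition Aop i u : 'M[K]_N :=
  \prod_(j < n) \prod_(r <- finsupp (c i j))
    invmx (X j (u + kappa L * hbar + hbar / 2 * r%:~R)) ^+ c i j r.

(** Since [kappa] is half of [kappa2] and [ac] is [hbar / 2] times an integer, every shift occurring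
    in [A_i(u)] has this form for some integer [x]. *)
Definition phi u (x : int) : {poly K} :=
  (u + hbar / 2 * ((kappa2 L)%:R + x%:~R))%:P - 'X.

Lemma X_rational j : rational_mx (X j).
Proof.
have [P [D [D0 _ PE]]] := XE j; exists P, D => //.
by apply: generic_imp (generic_root D0) => u /PE.
Qed.

Lemma X_generic j : generic (fun w => X j w \in unitmx /\
  forall k, xs_rel V false k (X j w) ((w - @ac K L hbar false j k)%:P - 'X)
    ((w + @ac K L hbar false j k)%:P - 'X)).
Proof.
have [P [D [D0 PD PE]]] := XE j.
have dP := expands_det (erefl : xi_ser V j 0 = 1%:M) D0 PD.
apply: generic_imp (generic_and (generic_root D0) (generic_root dP)) => w [Dw dPw].
rewrite PE //; split.
  by rewrite unitmxZ ?unitfE ?invr_eq0 // unitmxE det_evalmx unitfE.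
move=> k p; rewrite -scalemxAl -scalemxAr; congr (_ *: _).
exact: (rel_xi k2_neq0 false k w PD).
Qed.

Lemma Aop_rational i : rational_mx (Aop i).
Proof.
apply: rational_prod => j; apply: rational_prod => r; apply: rationalX.
have H : rational_mx (fun w => invmx (X j w)).
  apply: rational_inv; first exact: X_rational.
  by apply: generic_imp (X_generic j) => w [].
have := rational_shift (kappa L * hbar + hbar / 2 * r%:~R) H.
by move=> [P [D D0 E]]; exists P, D => //; apply: generic_imp E => u <-; rewrite addrA.
Qed.

Lemma coprimep_phi u x chi :
  coprimep (phi u x) chi = (chi.[u + hbar / 2 * ((kappa2 L)%:R + x%:~R)] != 0).
Proof.
rewrite /phi -opprB -scaleN1r coprimepZl ?oppr_eq0 ?oner_eq0 //.
by rewrite coprimep_sym coprimep_XsubC.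
Qed.

(** Multiplying the relations of the inverted factors gives products of [phi] over [shifts]. By the
    q-Cartan identity the two multisets agree for [k != i], and for [k = i] they differ only in the
    exponents plus and minus [kappa2], which produce [u + p - X] and [u - X]. *)
Lemma Aop_generic i : generic (fun u => Aop i u \in unitmx /\
  forall k, xs_rel V false k (Aop i u)
    (if k == i then u%:P - 'X else 1)
    (if k == i then (u + (kappa2 L)%:R * hbar)%:P - 'X else 1)).
Proof.
have G1 : generic (fun u => forall j, forall r, r \in finsupp (c i j) ->
    X j (u + kappa L * hbar + hbar / 2 * r%:~R) \in unitmx /\
    forall k, xs_rel V false k (X j (u + kappa L * hbar + hbar / 2 * r%:~R))
      (phi u (r + 1 * ((dsym j)%:Z * cartan j k))%R)
      (phi u (r + (-1) * ((dsym j)%:Z * cartan j k))%R)).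
  apply: generic_forall => j; apply: generic_all => r _.
  have := generic_shift (kappa L * hbar + hbar / 2 * r%:~R) (X_generic j).
  apply: generic_imp => u; rewrite addrA => -[Xu Xr]; split => // k p.
  have -> : phi u (r + 1 * ((dsym j)%:Z * cartan j k))%R =
      (u + kappa L * hbar + hbar / 2 * r%:~R - @ac K L hbar false j k)%:P - 'X.
    rewrite /phi /ac /kappa /sgnb; congr (_%:P - _).
    by rewrite intrD intrM [(_ * cartan j k)%:~R]intrM -pmulrn; field.
  have -> : phi u (r + (-1) * ((dsym j)%:Z * cartan j k))%R =
      (u + kappa L * hbar + hbar / 2 * r%:~R + @ac K L hbar false j k)%:P - 'X.
    rewrite /phi /ac /kappa /sgnb; congr (_%:P - _).
    by rewrite intrD intrM [(_ * cartan j k)%:~R]intrM -pmulrn; field.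
  exact: Xr.
(* Common factors are cancelled by [rel_cancel], which asks the left product to be coprime to an
   annihilator; this excludes finitely many [u]. *)
have G2 : generic (fun u => forall k, exists2 chi, (forall q, xs V false k (chi * q) = 0) &
    coprimep (\prod_(x <- shifts c (-1) i k) phi u x) chi).
  apply: generic_forall => k.
  have [chi chi0 xchi] := xs_annihilator V k2_neq0 false k.
  have := @generic_all _ _ (shifts c (-1) i k)
    (fun x u => chi.[u + hbar / 2 * ((kappa2 L)%:R + x%:~R)] != 0).
  move=> /(_ (fun x _ => generic_shift _ (generic_root chi0))).
  apply: generic_imp => u H; exists chi => //.
  elim: (shifts c (-1) i k) H => [|x s IH] H; first by rewrite big_nil coprime1p.
  rewrite big_cons coprimepMl coprimep_phi H ?mem_head //=.
  by apply: IH => y ys; apply: H; rewrite in_cons ys orbT.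
apply: generic_imp (generic_and G1 G2) => u [H1 H2]; split.
  apply: (big_ind (fun M : 'M[K]_N => M \in unitmx)) => [|A B uA uB|j _].
  - exact: unitmx1.
  - by rewrite unitmx_mul uA uB.
  rewrite big_seq; apply: (big_ind (fun M : 'M[K]_N => M \in unitmx)) => [|A B uA uB|r rj].
  - exact: unitmx1.
  - by rewrite unitmx_mul uA uB.
  elim: (c i j r) => [|m IH]; first exact: unitmx1.
  by rewrite exprS unitmx_mul IH unitmx_inv; have [-> _] := H1 j r rj.
move=> k.
have Arel : xs_rel V false k (Aop i u) (\prod_(x <- shifts c (-1) i k) phi u x)
    (\prod_(x <- shifts c 1 i k) phi u x).
  rewrite !big_shifts; apply: rel_prod => j; apply: rel_prod_in => r rj.
  by apply: relX; have [uX rX] := H1 j r rj; apply: rel_inv.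
have [chi xchi cop] := H2 k.
apply: rel_cancel Arel _ cop xchi.
have id := qcartan_identity hc i k.
have [ki|ki] := eqVneq k i.
  (* The negative terms are moved across, so that both sides have nonnegative coefficients. *)
  have /laurent_perm H : \sum_(x <- (- (kappa2 L)%:Z)%R :: shifts c 1 i k) qvar ^ x =
      \sum_(x <- (kappa2 L)%:Z :: shifts c (-1) i k) qvar ^ x.
    by rewrite !big_cons; apply: subr_eq_add; rewrite id ki eqxx mulr1n.
  have : \prod_(x <- (- (kappa2 L)%:Z)%R :: shifts c 1 i k) phi u x =
      \prod_(x <- (kappa2 L)%:Z :: shifts c (-1) i k) phi u x by apply: perm_big.
  rewrite !big_cons.
  have -> : phi u (kappa2 L)%:Z = (u + (kappa2 L)%:R * hbar)%:P - 'X.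
    by rewrite /phi; congr (_%:P - _); field.
  have -> : phi u (- (kappa2 L)%:Z) = u%:P - 'X.
    by rewrite /phi rmorphN /= subrr mulr0 addr0.
  by rewrite mulrC => ->; rewrite mulrC.
have /laurent_perm H : \sum_(x <- shifts c 1 i k) qvar ^ x =
    \sum_(x <- shifts c (-1) i k) qvar ^ x.
  by apply/eqP; rewrite -subr_eq0 id [i == k]eq_sym (negPf ki) mulr0n.
by rewrite (perm_big _ H).
Qed.

End AOperator.

(** * Polynomial solutions of the intertwining relation *)

Lemma mulmx_trig (R : pzRingType) n (A B : 'M[R]_n) :
  is_trig_mx A -> is_trig_mx B ->
  is_trig_mx (A *m B) /\ forall i, (A *m B) i i = A i i * B i i.
Proof.
move=> /is_trig_mxP tA /is_trig_mxP tB; split.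
  apply/is_trig_mxP => i j ij; rewrite mxE big1 // => k _.
  have [ik|ki] := ltnP i k; first by rewrite tA // mul0r.
  by rewrite tB ?mulr0 // (leq_ltn_trans ki).
move=> i; rewrite mxE (bigD1 i) //= big1 ?addr0 // => k ki.
have [ik|lt_ki|/val_inj E] := ltngtP i k.
- by rewrite tA // mul0r.
- by rewrite tB ?mulr0.
- by rewrite E eqxx in ki.
Qed.

Section CoefMx.
Variables (K : numClosedFieldType) (N : nat).
Implicit Types (P Q : 'M[{poly K}]_N) (M : 'M[K]_N).
Notation pc := (map_mx polyC).

Lemma coefmx_mulr P M m : coefmx (P *m pc M) m = coefmx P m *m M.
Proof.
apply/matrixP => p q; rewrite !mxE raddf_sum /=; apply: eq_bigr => j _.
by rewrite !mxE coefMC.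
Qed.

Lemma coefmx_mull P M m : coefmx (pc M *m P) m = M *m coefmx P m.
Proof.
apply/matrixP => p q; rewrite !mxE raddf_sum /=; apply: eq_bigr => j _.
by rewrite !mxE coefCM.
Qed.

Lemma coefmxB P Q m : coefmx (P - Q) m = coefmx P m - coefmx Q m.
Proof. by apply/matrixP => p q; rewrite !mxE /= coefB. Qed.

Lemma coefmx_X P m : coefmx ('X *: P) m = if m is m'.+1 then coefmx P m' else 0.
Proof. by apply/matrixP => p q; case: m => [|m]; rewrite !mxE /= coefXM. Qed.

Lemma coefmx_bound P : exists D, forall m, (D <= m)%N -> coefmx P m = 0.
Proof.
exists (\max_p \max_q size (P p q)) => m Dm; apply/matrixP => p q; rewrite !mxE /=.
apply: nth_default; apply: leq_trans Dm.
by apply: leq_trans (leq_bigmax (F := fun p => \max_q size (P p q)) p); apply: (leq_bigmax (F := fun q => size (P p q))).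
Qed.

Lemma polymx_coef D P : (forall m, (D <= m)%N -> coefmx P m = 0) ->
  P = \sum_(m < D) 'X^m *: pc (coefmx P m).
Proof.
move=> PD; apply/matrixP => p q; rewrite summxE; apply/polyP => k.
rewrite coef_sum; have [kD|Dk] := ltnP k D.
  rewrite (bigD1 (Ordinal kD)) //= big1 ?addr0.
    by rewrite !mxE coefMC coefXn eqxx mul1r.
  move=> m mk; rewrite !mxE coefMC coefXn.
  have -> : (k == m) = false by apply: contraNF mk => /eqP km; apply/eqP/val_inj.
  by rewrite mul0r.
rewrite big1 => [|m _]; last first.
  by rewrite !mxE coefMC coefXn gtn_eqF ?mul0r // (leq_trans (ltn_ord m)).
by have /matrixP/(_ p q) := PD k Dk; rewrite !mxE.
Qed.

Lemma evalmx_mulr P M u : evalmx (P *m pc M) u = evalmx P u *m M.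
Proof. by rewrite evalmxM evalmx_polyC. Qed.

Lemma evalmx_mull P M u : evalmx (pc M *m P) u = M *m evalmx P u.
Proof. by rewrite evalmxM evalmx_polyC. Qed.

Lemma char_poly_conj (U U' : 'M[K]_N) P : U *m U' = 1%:M ->
  char_poly (pc U *m P *m pc U') = char_poly P.
Proof.
move=> UU'; have U'U : U' *m U = 1%:M by apply: mulmx1C.
pose c2 (A : 'M[K]_N) : 'M[{poly {poly K}}]_N := pc (pc A).
have c2M A B : c2 (A *m B) = c2 A *m c2 B by rewrite /c2 !map_mxM.
have c21 : c2 1%:M = 1%:M by rewrite /c2 !map_mx1.
rewrite /char_poly.
have -> : char_poly_mx (pc U *m P *m pc U') = c2 U *m char_poly_mx P *m c2 U'.
  rewrite /char_poly_mx mulmxBr mulmxBl !map_mxM.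
  have XE : c2 U *m 'X%:M *m c2 U' = 'X%:M.
    by rewrite scalar_mxC -mulmxA -c2M UU' c21 mulmx1.
  by rewrite XE.
rewrite !det_mulmx mulrC mulrA -det_mulmx -c2M U'U c21 det1 mul1r.
by [].
Qed.

Lemma matrix_eq0_cV (M : 'M[K]_N) : (forall v : 'cV[K]_N, M *m v = 0) -> M = 0.
Proof.
move=> M0; apply/matrixP => p q; have := M0 (delta_mx q 0).
by rewrite -colE => /matrixP/(_ p 0); rewrite !mxE.
Qed.

Lemma surjective_unitmx (A : 'M[K]_N) :
  (forall v : 'cV[K]_N, exists w, v = A *m w) -> A \in unitmx.
Proof.
move=> /choice[f fP]; pose W := \matrix_(p, q) f (delta_mx q 0) p 0.
suff /mulmx1_unit[] : A *m W = 1%:M by [].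
apply/matrixP => p q; have /matrixP/(_ p 0) := fP (delta_mx q 0).
rewrite !mxE eqxx andbT => ->; apply: eq_bigr => j _; by rewrite !mxE.
Qed.

End CoefMx.

(** * Consequences of the relation with the [x^-] *)

Section Intertwiner.
Variables (K : numClosedFieldType) (L : simple_lie K) (hbar : K) (N : nat).
Notation n := (rank L).
Notation h := (csa L).
Notation hdual := 'Hom(subvs_of h, K^o).
Variable V : yangian_rep L hbar N.
Hypothesis k2_neq0 : kappa2 L != 0%N.
Variables (Omega : 'cV[K]_N) (lambda : hdual).
Hypothesis Omega_neq0 : Omega != 0.
Hypothesis Omega_x : forall i r, xpm V true i r *m Omega = 0.
Hypothesis Omega_xi : exists m : 'I_n -> nat -> K, forall i r, xi V i r *m Omega = m i r *: Omega.
Hypothesis Omega_gen : forall U : {vspace 'cV[K]_N}, Omega \in U ->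
  (forall i r v, v \in U -> xi V i r *m v \in U) ->
  (forall e i r v, v \in U -> xpm V e i r *m v \in U) -> U = fullv.
Hypothesis Omega_wt : wt_space V lambda Omega.
Notation xs := (xs V).
Notation xis := (xis V).
Notation xs_rel := (xs_rel V).
Notation ac := (@ac K L hbar).
Variable i : 'I_n.

Definition lpoly (u : K) k : {poly K} := if k == i then u%:P - 'X else 1.

Section AtPoint.
Variables (u : K) (S : 'M[K]_N).
Hypothesis S_x : forall k, xs_rel false k S 1 (lpoly u k).
Hypothesis S_Omega : S *m Omega = Omega.

Let Sx k p (v : 'cV[K]_N) : S *m (xs false k p *m v) = xs false k (lpoly u k * p) *m (S *m v).
Proof. by rewrite !mulmxA; have := S_x k p; rewrite mul1r => ->. Qed.

(** True on [Omega], where [xi] acts by scalars. It passes through an [x^-] because [xi_xs] only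
    multiplies the argument by [X + a] or [X - a], and these commute with [lpoly]. *)
Lemma intertwiner_xi j s : S *m xi V j s = xi V j s *m S.
Proof.
apply/eqP; rewrite -subr_eq0; apply/eqP/matrix_eq0_cV => v; move: j s.
apply: (hw_ind k2_neq0 Omega_x Omega_xi Omega_gen (Q := fun v => forall j s,
  (S *m xi V j s - xi V j s *m S) *m v = 0)) => [j s|a v' w Qv Qw j s|k r {}v Qv j s].
- have [m mE] := Omega_xi.
  by rewrite mulmxBl -!mulmxA S_Omega mE -scalemxAr S_Omega subrr.
- by rewrite mulmxDr -scalemxAr Qv Qw scaler0 addr0.
have {}Qv j' s' : S *m (xi V j' s' *m v) = xi V j' s' *m (S *m v).
  by have /eqP := Qv j' s'; rewrite mulmxBl subr_eq0 -!mulmxA => /eqP.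
suff H p : S *m (xi V j s *m (xs false k p *m v)) = xi V j s *m (S *m (xs false k p *m v)).
  by have := H 'X^r; rewrite xsXn mulmxBl -!mulmxA => ->; rewrite subrr.
elim: s p => [|s IH] p.
  rewrite [xi V j 0 *m (xs _ _ _ *m _)]mulmxA (xi0_xs V k2_neq0) mulmxDl -mulmxA.
  rewrite mulmxDr Sx Qv -scalemxAl -scalemxAr !Sx.
  by rewrite [xi V j 0 *m (xs _ _ _ *m _)]mulmxA (xi0_xs V k2_neq0) mulmxDl -mulmxA -scalemxAl.
have E q w : xi V j s.+1 *m (xs false k q *m w) =
    xs false k q *m (xi V j s.+1 *m w)
    + (xi V j s *m (xs false k (('X + (ac false j k)%:P) * q) *m w)
    - xs false k (('X - (ac false j k)%:P) * q) *m (xi V j s *m w)).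
  have /eqP := xi_xs V false j k s q; rewrite subr_eq => /eqP.
  by move/(congr1 (fun M => M *m w)); rewrite !mulmxDl mulNmx -!mulmxA addrC.
rewrite E mulmxDr mulmxBr IH !Sx !Qv E.
by rewrite ![_ * (lpoly u k * p)]mulrCA.
Qed.

Lemma intertwiner_xis j p : S *m xis j p = xis j p *m S.
Proof.
elim/poly_lin_ind: p => [a p q Ep Eq|s]; last by rewrite xisXn intertwiner_xi.
have -> : xis j (a *: p + q) = a *: xis j p + xis j q by exact: (linearP (xis j)).
by rewrite mulmxDr mulmxDl -scalemxAr -scalemxAl Ep Eq.
Qed.

(** The bracket of [x^+[q]] and [x^-[q']] depends only on [q * q'], so a factor [lpoly] attached to
    [x^-] on one side is balanced by one attached to [x^+] on the other; [S] commutes with the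
    bracket itself. *)
Lemma intertwiner_x_true k p : S *m xs true k (lpoly u k * p) = xs true k p *m S.
Proof.
apply/eqP; rewrite -subr_eq0; apply/eqP/matrix_eq0_cV => v; move: k p.
have x0 k p : xs true k p *m Omega = 0.
  elim/poly_lin_ind: p => [a p q Ep Eq|s]; last by rewrite xsXn Omega_x.
  have -> : xs true k (a *: p + q) = a *: xs true k p + xs true k q.
    exact: (linearP (xs true k)).
  by rewrite mulmxDl -scalemxAl Ep Eq scaler0 addr0.
apply: (hw_ind k2_neq0 Omega_x Omega_xi Omega_gen (Q := fun v => forall k p,
  (S *m xs true k (lpoly u k * p) - xs true k p *m S) *m v = 0))
  => [k p|a v' w Qv Qw k p|j r {}v Qv k p].
- by rewrite mulmxBl -!mulmxA S_Omega !x0 mulmx0 subrr.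
- by rewrite mulmxDr -scalemxAr Qv Qw scaler0 addr0.
have {}Qv k' p' : S *m (xs true k' (lpoly u k' * p') *m v) = xs true k' p' *m (S *m v).
  by have /eqP := Qv k' p'; rewrite mulmxBl subr_eq0 -!mulmxA => /eqP.
have E q q' w : xs true k q *m (xs false j q' *m w) =
    (if k == j then xis k (q * q') else 0) *m w + xs false j q' *m (xs true k q *m w).
  have /eqP := xs_xs_bracket V k j q q'; rewrite subr_eq => /eqP.
  by move/(congr1 (fun M => M *m w)); rewrite !mulmxDl -!mulmxA.
rewrite -xsXn mulmxBl -!mulmxA; apply/eqP; rewrite subr_eq0; apply/eqP.
rewrite E mulmxDr !Sx Qv E; congr (_ + _).
case: eqP => [<-|_]; last by rewrite !mul0mx mulmx0.
by rewrite (mulmxA S) intertwiner_xis -mulmxA [p * _]mulrCA mulrA.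
Qed.

End AtPoint.

Section PolyIntertwiner.
Variable P : 'M[{poly K}]_N.
Notation pc := (map_mx polyC).
Notation C := (coefmx P).
Hypothesis P_x : forall k p, P *m pc (xs false k p) =
  (if k == i then 'X *: pc (xs false k p) - pc (xs false k ('X * p))
   else pc (xs false k p)) *m P.
Hypothesis P_Omega : P *m pc Omega = pc Omega.

Definition pred_coef m : 'M[K]_N := if m is m'.+1 then C m' else 0.

Lemma coef_x_neq k p m : k != i -> C m *m xs false k p = xs false k p *m C m.
Proof.
move=> /negPf ki; have := congr1 (fun Q => coefmx Q m) (P_x k p).
by rewrite ki coefmx_mulr coefmx_mull.
Qed.

Lemma coef_x_eq p m : C m *m xs false i p =
  xs false i p *m pred_coef m - xs false i ('X * p) *m C m.
Proof.
have := congr1 (fun Q => coefmx Q m) (P_x i p).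
rewrite eqxx coefmx_mulr mulmxBl -scalemxAl coefmxB coefmx_X coefmx_mull => ->.
by congr (_ - _); case: m => [|m] /=; rewrite ?mulmx0 // coefmx_mull.
Qed.

Lemma coef_Omega m : C m *m Omega = if m is 0 then Omega else 0.
Proof.
apply/matrixP => p q; have /matrixP/(_ p q) := P_Omega; rewrite !mxE.
move/(congr1 (fun f : {poly K} => f`_m)); rewrite coef_sum coefC => E.
transitivity (if m == 0%N then Omega p q else 0); last by case: (m) => //; rewrite mxE.
rewrite -E; apply: eq_bigr => j _; by rewrite !mxE coefMC.
Qed.

Lemma evalmx_rel u k : xs_rel false k (evalmx P u) 1 (lpoly u k).
Proof.
move=> p; rewrite mul1r -evalmx_mulr P_x /lpoly; case: eqP => _.
  rewrite evalmxM evalmxB evalmxZ hornerX !evalmx_polyC.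
  congr (_ *m _); rewrite mulrBl.
  have -> : xs false k (u%:P * p - 'X * p) = xs false k (u%:P * p) - xs false k ('X * p).
    exact: (linearB (xs false k)).
  by rewrite xs_polyC.
by rewrite mul1r evalmx_mull.
Qed.

Lemma evalmx_Omega u : evalmx P u *m Omega = Omega.
Proof.
have [D PD] := coefmx_bound P; rewrite (@evalmx_coef _ _ _ _ D.+1) => [|m Dm]; last first.
  by apply: PD; apply: ltnW.
rewrite mulmx_suml big_ord_recl /= -scalemxAl coef_Omega scale1r big1 ?addr0 //.
by move=> j _; rewrite -scalemxAl coef_Omega scaler0.
Qed.

(** Moving two coefficients through an [x^-_i] gives an expression symmetric in [m] and [m'], up to
    commutations already known on the shorter word. *)
Lemma coef_comm m m' : C m *m C m' = C m' *m C m.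
Proof.
apply/eqP; rewrite -subr_eq0; apply/eqP/matrix_eq0_cV => v; move: m m'.
apply: (hw_ind k2_neq0 Omega_x Omega_xi Omega_gen (Q := fun v => forall m m',
  (C m *m C m' - C m' *m C m) *m v = 0)) => [m m'|a v' w Qv Qw m m'|k r {}v Qv m m'].
- rewrite mulmxBl -!mulmxA !coef_Omega.
  by case: m m' => [|m] [|m']; rewrite ?mulmx0 ?coef_Omega ?subrr.
- by rewrite mulmxDr -scalemxAr Qv Qw scaler0 addr0.
have {}Qv j j' : C j *m (C j' *m v) = C j' *m (C j *m v).
  by have /eqP := Qv j j'; rewrite mulmxBl subr_eq0 -!mulmxA => /eqP.
rewrite -xsXn mulmxBl -!mulmxA; apply/eqP; rewrite subr_eq0; apply/eqP.
have [->|ki] := eqVneq k i; last first.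
  by rewrite !(mulmxA (C _) (xs _ _ _)) !coef_x_neq // -!mulmxA
    !(mulmxA (C _) (xs _ _ _)) !coef_x_neq // -!mulmxA Qv.
have Cx j p (w : 'cV[K]_N) : C j *m (xs false i p *m w) =
    xs false i p *m (pred_coef j *m w) - xs false i ('X * p) *m (C j *m w).
  by rewrite mulmxA coef_x_eq mulmxBl -!mulmxA.
have Qp j j' : pred_coef j *m (C j' *m v) = C j' *m (pred_coef j *m v).
  by case: j => [|j] /=; rewrite ?mul0mx ?mulmx0 // Qv.
have Qpp j j' : pred_coef j *m (pred_coef j' *m v) = pred_coef j' *m (pred_coef j *m v).
  by case: j => [|j] /=; rewrite ?mul0mx ?mulmx0 // -Qp.
rewrite !Cx !mulmxBr !Cx Qpp Qv !Qp !opprB.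
by rewrite [LHS](AC (2*2) ((1*4)*(3*2))).
Qed.

Lemma cartan_act_coef t m : cartan_act V t *m C m = C m *m cartan_act V t.
Proof.
apply/eqP; rewrite -subr_eq0; apply/eqP/matrix_eq0_cV => v; move: m.
apply: (hw_ind k2_neq0 Omega_x Omega_xi Omega_gen (Q := fun v => forall m,
  (cartan_act V t *m C m - C m *m cartan_act V t) *m v = 0))
  => [m|a v' w Qv Qw m|k r {}v Qv m].
- rewrite mulmxBl -!mulmxA Omega_wt -scalemxAr coef_Omega.
  by case: m => [|m]; rewrite ?Omega_wt ?mulmx0 ?scaler0 subrr.
- by rewrite mulmxDr -scalemxAr Qv Qw scaler0 addr0.
have {}Qv j : cartan_act V t *m (C j *m v) = C j *m (cartan_act V t *m v).
  by have /eqP := Qv j; rewrite mulmxBl subr_eq0 -!mulmxA => /eqP.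
have Qp j : cartan_act V t *m (pred_coef j *m v) = pred_coef j *m (cartan_act V t *m v).
  by case: j => [|j] /=; rewrite ?mul0mx ?mulmx0 // Qv.
have hx p (w : 'cV[K]_N) : cartan_act V t *m (xs false k p *m w) =
    xs false k p *m (cartan_act V t *m w) +
    (sgnb K false * (alpha k t : K)) *: (xs false k p *m w).
  by rewrite mulmxA (cartan_act_xs V k2_neq0) mulmxDl -mulmxA -scalemxAl.
rewrite -xsXn mulmxBl -!mulmxA; apply/eqP; rewrite subr_eq0; apply/eqP.
have [ki|ki] := eqVneq k i; last first.
  rewrite hx mulmxDr -scalemxAr !(mulmxA (C _) (xs _ _ _)) !coef_x_neq //.
  by rewrite -!mulmxA hx Qv.
have Cx j p (w : 'cV[K]_N) : C j *m (xs false k p *m w) =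
    xs false k p *m (pred_coef j *m w) - xs false k ('X * p) *m (C j *m w).
  by rewrite ki mulmxA coef_x_eq mulmxBl -!mulmxA.
rewrite hx mulmxDr -scalemxAr !Cx mulmxBr !hx Qv Qp scalerBr opprD.
by rewrite addrACA.
Qed.

(** The degree is [m i] because each [x^-_i] in a word raises the degree in [u] by one, while
    [x^-_k] with [k != i] commutes with [P]. *)
Definition monic_at (m : {ffun 'I_n -> nat}) (v : 'cV[K]_N) :=
  [/\ wt_space V (lambda - qsum m) v, C (m i) *m v = v &
      forall k, (m i < k)%N -> C k *m v = 0].

Lemma monic_at_wt m v : monic_at m v -> wt_space V (lambda - qsum m) v.
Proof. by case. Qed.

Lemma monic_at_Omega : monic_at [ffun=> 0%N] Omega.
Proof.
rewrite /monic_at qsum0 subr0 ffunE coef_Omega; split => // -[//|k] _.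
by rewrite coef_Omega.
Qed.

Lemma monic_at_lin m a v w : monic_at m v -> monic_at m w -> monic_at m (a *: v + w).
Proof.
move=> [wv mv kv] [ww mw kw]; split; first exact: wt_space_lin.
  by rewrite mulmxDr -scalemxAr mv mw.
by move=> k mk; rewrite mulmxDr -scalemxAr kv // kw // scaler0 addr0.
Qed.

Lemma monic_at_x m k r v : monic_at m v -> monic_at (incr m k) (xpm V false k r *m v).
Proof.
move=> [wv mv kv]; split; first exact: x_false_weight.
  rewrite -xsXn ffunE mulmxA; have [<-|ki] := eqVneq i k.
    rewrite coef_x_eq addn1 mulmxBl -!mulmxA /= mv kv; last exact: leqnn.
    by rewrite mulmx0 subr0.
  by rewrite coef_x_neq 1?eq_sym // addn0 -mulmxA mv.
move=> k'; rewrite -xsXn ffunE mulmxA; have [<-|ki] := eqVneq i k.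
  rewrite addn1; case: k' => [//|k']; rewrite ltnS => mk.
  rewrite coef_x_eq mulmxBl -!mulmxA /= !kv; last exact: mk.
    by rewrite !mulmx0 subr0.
  exact: (ltn_trans mk).
by rewrite addn0 => mk; rewrite coef_x_neq 1?eq_sym // -mulmxA kv // mulmx0.
Qed.

Lemma hw_monic mu v : wt_space V mu v -> v != 0 ->
  exists2 m, mu = lambda - qsum m & monic_at m v.
Proof.
exact: (hw_graded k2_neq0 Omega_x Omega_xi Omega_gen monic_at_wt monic_at_Omega
  monic_at_lin monic_at_x).
Qed.

Lemma coef_wt mu v k : wt_space V mu v -> wt_space V mu (C k *m v).
Proof. by move=> wv t; rewrite mulmxA cartan_act_coef -mulmxA wv -scalemxAr. Qed.

(* The diagonal entries of the simultaneously triangularized coefficients: the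
   eigenvalue of [varpi i] at the same place singles out the weights, on which
   [P] is monic. *)
Lemma triangular_form : exists U U' : 'M[K]_N, exists s : 'I_N -> {poly K},
  [/\ U *m U' = 1%:M, is_trig_mx (pc U *m P *m pc U'),
      forall l, (pc U *m P *m pc U') l l = s l & forall l, s l \is monic].
Proof.
have [D PD] := coefmx_bound P.
pose H := cartan_act V (varpi i); pose As := H :: [seq C m | m <- iota 0 D].
have [U Uu /allP UAs] : cotrigonalizable_in (@unitarymx K N N) As.
  apply: cotrigonalization => A B; rewrite !in_cons.
  move=> /predU1P[->|/mapP[m _ ->]] /predU1P[->|/mapP[m' _ ->]] //.
  - exact: cartan_act_coef.
  - by rewrite /comm_mx cartan_act_coef.
  - exact: coef_comm.
have Uun := unitarymx_unit Uu; pose U' := invmx U.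
have UU' : U *m U' = 1%:M by rewrite mulmxV.
have U'U : U' *m U = 1%:M by rewrite mulVmx.
pose J (A : 'M[K]_N) := U *m A *m U'.
have JM A B : J (A *m B) = J A *m J B.
  by rewrite /J !mulmxA -[U *m A *m U' *m U]mulmxA U'U mulmx1.
have tH : is_trig_mx (J H) by rewrite /J -conjumx //; apply: UAs; apply: mem_head.
have tC m : is_trig_mx (J (C m)).
  have [mD|Dm] := ltnP m D; last first.
    by rewrite PD // /J mulmx0 mul0mx; apply/is_trig_mxP => p q _; rewrite mxE.
  by rewrite /J -conjumx //; apply: UAs; rewrite in_cons map_f ?orbT // mem_iota.
pose s (l : 'I_N) := \poly_(m < D) J (C m) l l.
have JP : pc U *m P *m pc U' = \sum_(m < D) 'X^m *: pc (J (C m)).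
  rewrite {1}(polymx_coef PD) mulmx_sumr mulmx_suml; apply: eq_bigr => m _.
  by rewrite -scalemxAr -scalemxAl /J !map_mxM.
exists U, U', s; split => //.
- rewrite JP; apply/is_trig_mxP => p q pq; rewrite summxE big1 // => m _.
  by rewrite [LHS]mxE [pc _ p q]mxE (is_trig_mxP (tC m)) // mulr0.
- move=> l; rewrite JP summxE /s poly_def; apply: eq_bigr => m _.
  by rewrite [LHS]mxE [pc _ l l]mxE -mul_polyC mulrC.
pose lam : K := lambda (varpi i).
(* Up to a scalar on each weight space, the projection onto the eigenvalue [lam - m] of
   [varpi i]. *)
pose Z m := \prod_(j < D | j != m :> nat) (H - (lam - j%:R)%:M) : 'M[K]_N.
have Zv m m' v : monic_at m' v -> (m' i < D)%N -> exists2 a : K, Z m *m v = a *: v &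
    (a != 0 -> m' i = m).
  move=> mv m'D; have Hv : H *m v = (lam - (m' i)%:R) *: v.
    have := monic_at_wt mv (varpi i) => ->.
    by rewrite add_lfunE opp_lfunE qsum_varpi.
  exists (\prod_(j < D | j != m :> nat) ((lam - (m' i)%:R) - (lam - j%:R))).
    rewrite /Z; elim: (index_enum _) => [|j t IH]; first by rewrite !big_nil scale1r mul1mx.
    rewrite !big_cons; case: ifP => // _; rewrite -mulmxA IH -scalemxAr mulmxBl Hv.
    by rewrite mul_scalar_mx -scalerBl scalerA mulrC.
  move=> a0; apply/eqP/negPn/negP => nm; case/eqP: a0.
  by rewrite (bigD1 (Ordinal m'D)) //= subrr mul0r.
(* Components of degree at least [D] vanish: their top coefficient fixes them, but it is zero. *)
have hwD (M : 'M[K]_N) : (forall m v, monic_at m v -> (m i < D)%N -> M *m v = 0) -> M = 0.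
  move=> M0; apply: matrix_eq0_cV => v.
  have [t tm ->] := hw_decomposition k2_neq0 Omega_x Omega_xi Omega_gen
    monic_at_Omega monic_at_lin monic_at_x v.
  rewrite mulmx_sumr big_seq big1 // => x xt; have mx := tm x xt.
  have [xD|Dx] := ltnP (x.1 i) D; first exact: (M0 x.1).
  by case: mx => _ <- _; rewrite PD // mul0mx mulmx0.
move=> l; pose hl := J H l l.
pose tr A := is_trig_mx (J A).
have trM A B : tr A -> tr B -> tr (A *m B) /\ J (A *m B) l l = J A l l * J B l l.
  by move=> tA tB; rewrite /tr JM; have [? ->] := mulmx_trig tA tB.
have trF (a : K) : tr (H - a%:M) /\ J (H - a%:M) l l = hl - a.
  have JE : J (H - a%:M) = J H - a%:M.
    by rewrite /J mulmxBr mulmxBl scalar_mxC -(mulmxA a%:M) UU' mulmx1.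
  have E p q : (J H - a%:M) p q = J H p q - a *+ (p == q).
    by rewrite mxE [X in _ + X]mxE [X in _ - X]mxE.
  rewrite /tr JE; split; last by rewrite E eqxx.
  apply/is_trig_mxP => p q pq; rewrite E (is_trig_mxP tH) // sub0r.
  by rewrite -val_eqE /= ltn_eqF // oppr0.
have tr_prod (I : Type) (r : seq I) (Q : pred I) (a : I -> K) :
    tr (\prod_(j <- r | Q j) (H - (a j)%:M)) /\
    J (\prod_(j <- r | Q j) (H - (a j)%:M)) l l = \prod_(j <- r | Q j) (hl - a j).
  elim: r => [|j r [IH1 IH2]].
    rewrite !big_nil; have JE : J 1 = 1%:M by rewrite /J mulmx1 UU'.
    by rewrite /tr JE scalar_mx_is_trig !mxE eqxx.
  rewrite !big_cons; case: ifP => // _.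
  by have [tj <-] := trF (a j); have [t1 t2] := trM _ _ tj IH1; rewrite -IH2.
(* The full product kills [V], so the diagonal entry [hl] is one of the [lam - m]. Below, the full
   product is [Z D], as no [j < D] is excluded. *)
have /eqP : \prod_(j < D) (hl - (lam - j%:R)) = 0.
  have [_ <-] := tr_prod _ (index_enum 'I_D) xpredT (fun j => lam - j%:R).
  suff -> : \prod_(j < D) (H - (lam - j%:R)%:M) = 0 by rewrite /J mulmx0 mul0mx mxE.
  apply: hwD => m v mv mD; have [a aE aP] := Zv D m v mv mD.
  have -> : \prod_(j < D) (H - (lam - j%:R)%:M) = Z D.
    by apply: eq_bigl => j; rewrite ltn_eqF.
  rewrite aE; have [->|/aP E] := eqVneq a 0; first by rewrite scale0r.
  by rewrite E ltnn in mD.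
rewrite prodf_seq_eq0 => /hasP[m _ /= /eqP hm].
have {}hm : hl = lam - m%:R by apply/eqP; rewrite -subr_eq0 hm.
have [tZ dZ] := tr_prod _ (index_enum 'I_D) (fun j : 'I_D => j != m :> nat) (fun j => lam - j%:R).
have dZ0 : J (Z m) l l != 0.
  rewrite dZ hm prodf_seq_neq0; apply/allP => j _; apply/implyP => jm.
  by rewrite opprB addrC addrA subrK subr_eq0 eqr_nat.
(* The diagonal entry of [Z m] at [l] is nonzero, so the entries of the coefficients can be read
   from [C k *m Z m = 0] and, next, from [C m *m Z m = Z m]. *)
have C0 k : (m < k)%N -> J (C k) l l = 0.
  move=> mk; apply/eqP; rewrite -[_ == 0]orbF -(negPf dZ0) -mulf_eq0.
  have [_ <-] := trM _ _ (tC k) tZ; suff -> : C k *m Z m = 0 by rewrite /J mulmx0 mul0mx mxE.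
  apply: hwD => m' v mv m'D; have [a aE aP] := Zv m m' v mv m'D.
  rewrite -mulmxA aE -scalemxAr; have [->|/aP E] := eqVneq a 0; first by rewrite scale0r.
  by case: mv => _ _ /(_ k) ->; rewrite ?scaler0 // E.
have C1 : J (C m) l l = 1.
  apply: (mulIf dZ0); rewrite mul1r; have [_ <-] := trM _ _ (tC m) tZ.
  suff -> : C m *m Z m = Z m by [].
  apply/eqP; rewrite -subr_eq0; apply/eqP; apply: hwD => m' v mv m'D.
  have [a aE aP] := Zv m m' v mv m'D.
  rewrite mulmxBl -mulmxA aE -scalemxAr -scalerBr.
  have [->|/aP E] := eqVneq a 0; first by rewrite scale0r.
  by case: mv; rewrite E => _ -> _; rewrite subrr scaler0.
have ss : size (s l) = m.+1.
  apply/eqP; rewrite eqn_leq; apply/andP; split.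
    apply/leq_sizeP => k mk; rewrite coef_poly; case: ifP => // _; exact: C0.
  rewrite ltnNge; apply/negP => sm; have := nth_default 0 sm.
  by rewrite coef_poly ltn_ord C1 => /eqP; rewrite oner_eq0.
by rewrite monicE lead_coefE ss coef_poly ltn_ord C1.
Qed.

Lemma evalmx_det_prod (U U' : 'M[K]_N) (s : 'I_N -> {poly K}) z :
  U *m U' = 1%:M -> is_trig_mx (pc U *m P *m pc U') ->
  (forall l, (pc U *m P *m pc U') l l = s l) ->
  (evalmx P z \in unitmx) = (\prod_l (s l).[z] != 0).
Proof.
move=> UU' tP sP; rewrite unitmxE unitfE det_evalmx; congr (_ != 0).
have dUU : \det U * \det U' = 1 by rewrite -det_mulmx UU' det1.
have := det_trig tP; rewrite !det_mulmx !det_map_mx mulrAC -polyCM dUU mul1r => ->.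
by rewrite horner_prod; apply: eq_bigr => l _; rewrite sP.
Qed.

Lemma char_poly_eigen (U U' : 'M[K]_N) (s : 'I_N -> {poly K}) :
  U *m U' = 1%:M -> is_trig_mx (pc U *m P *m pc U') ->
  (forall l, (pc U *m P *m pc U') l l = s l) ->
  char_poly P = \prod_l ('X - (s l)%:P).
Proof.
move=> UU' tP sP; rewrite -(char_poly_conj P UU') char_poly_trig //.
by apply: eq_bigr => l _; rewrite sP.
Qed.

Lemma evalmx_x_false z k p : evalmx P z *m xs false k p =
  xs false k (lpoly z k * p) *m evalmx P z.
Proof. by have := @evalmx_rel z k p; rewrite mul1r. Qed.

Lemma evalmx_x_true z k p : evalmx P z *m xs true k (lpoly z k * p) =
  xs true k p *m evalmx P z.
Proof. exact: (intertwiner_x_true (@evalmx_rel z) (evalmx_Omega z)). Qed.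

Lemma unit_annihilator e z : evalmx P z \in unitmx ->
  exists2 chi : {poly K}, chi.[z] != 0 & forall q, xs e i (chi * q) = 0.
Proof.
move=> Pu; have [chi0 chi00 x0] := xs_annihilator V k2_neq0 e i.
(* One factor is removed by cancelling [P(z)]: on the right for [x^+], on the left for [x^-]. *)
have step q : xs e i ((z%:P - 'X) * q) = 0 -> xs e i q = 0.
  have li : lpoly z i = z%:P - 'X by rewrite /lpoly eqxx.
  case: e x0 => [] _ E.
    have := evalmx_x_true z i q; rewrite li E mulmx0 => /(congr1 (mulmxr (invmx (evalmx P z)))).
    by rewrite /= mul0mx mulmxK.
  have := evalmx_x_false z i q; rewrite li E mul0mx => /(congr1 (mulmx (invmx (evalmx P z)))).
  by rewrite mulmx0 mulKmx.
have [m [q]] := multiplicity_XsubC chi0 z; rewrite chi00 /= => qz chiE.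
exists q => //; have {}x0 r : xs e i (q * ('X - z%:P) ^+ m * r) = 0 by rewrite -chiE.
elim: m {chiE} x0 => [|m IH] x0; first by move=> r; have := x0 r; rewrite expr0 mulr1.
apply: IH => r; apply: step; have := x0 r; rewrite exprSr.
have -> : q * (('X - z%:P) ^+ m * ('X - z%:P)) * r =
    (-1)%:P * ((z%:P - 'X) * (q * ('X - z%:P) ^+ m * r)).
  by rewrite polyCN; ring.
by rewrite xs_polyC scaleN1r => /eqP; rewrite oppr_eq0 => /eqP.
Qed.

Lemma annihilator_unit (chi : {poly K}) z : chi.[z] != 0 ->
  (forall q, xs false i (chi * q) = 0) -> evalmx P z \in unitmx.
Proof.
move=> cz xchi; apply: surjective_unitmx.
(* Modulo the annihilator, the nonzero constant [chi.[z]] is a multiple of [z - X]. So every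
   [x^-_i[p]] can be rewritten with a factor [z - X], which is what it takes to pull [P(z)] out. *)
have [q qE] : exists q, chi.[z]%:P = chi + (z%:P - 'X) * q.
  have : root (chi - chi.[z]%:P) z by rewrite /root !hornerE subrr.
  by move=> /factor_theorem [q qE]; exists q; rewrite -[X in _ = X + _](subrK chi.[z]%:P) qE; ring.
apply: (hw_ind k2_neq0 Omega_x Omega_xi Omega_gen).
- by exists Omega; rewrite evalmx_Omega.
- by move=> a v w [v' ->] [w' ->]; exists (a *: v' + w'); rewrite mulmxDr -scalemxAr.
move=> k r v [w ->]; rewrite -xsXn; move: ('X^r) => p.
have [->|ki] := eqVneq k i; last first.
  exists (xs false k p *m w); rewrite [RHS]mulmxA evalmx_x_false /lpoly (negPf ki) mul1r.
  by rewrite mulmxA.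
exists (chi.[z]^-1 *: (xs false i (q * p) *m w)).
rewrite -scalemxAr [in RHS]mulmxA evalmx_x_false /lpoly eqxx -[in RHS]mulmxA.
have E : chi.[z]%:P * p = chi * p + (z%:P - 'X) * (q * p) by rewrite qE; ring.
have := congr1 (xs false i) E; rewrite xs_polyC.
have -> : xs false i (chi * p + (z%:P - 'X) * (q * p)) =
    xs false i (chi * p) + xs false i ((z%:P - 'X) * (q * p)).
  exact: (linearD (xs false i)).
by rewrite xchi add0r => <-; rewrite -scalemxAl scalerA mulVf // scale1r.
Qed.

Section Low.
Variable w0 : seq 'I_n.
Hypothesis w0P : longest_word w0.
Notation low := (weyl_word w0 lambda).
Variables (v0 : 'cV[K]_N).
Hypothesis v0_low : wt_space V low v0.
Hypothesis v0_neq0 : v0 != 0.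

(** [intertwiner_x_true] gives [x^+[p] P(z) = P(z) x^+[(z - X) p]] for [k = i], so the image of
    [P(z)] is stable under the [x^+] at every [z]; it contains [v0] since [a] is invertible. *)
Lemma low_unit z a : a != 0 -> evalmx P z *m v0 = a *: v0 -> evalmx P z \in unitmx.
Proof.
move=> a0 v0E; apply: surjective_unitmx.
apply: (low_ind k2_neq0 Omega_neq0 Omega_x Omega_xi Omega_gen Omega_wt w0P v0_low v0_neq0).
- by exists (a^-1 *: v0); rewrite -scalemxAr v0E scalerA mulVf // scale1r.
- by move=> b v w [v' ->] [w' ->]; exists (b *: v' + w'); rewrite mulmxDr -scalemxAr.
move=> k r v [w ->]; rewrite -xsXn mulmxA -evalmx_x_true -mulmxA.
by exists (xs true k (lpoly z k * 'X^r) *m w).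
Qed.

Lemma low_poly : exists2 Q : {poly K}, Q \is monic &
  forall v, wt_space V low v -> P *m pc v = Q *: pc v.
Proof.
have [m _ [_ mv kv]] := hw_monic v0_low v0_neq0.
have /choice[a aE] k : exists a : K, C k *m v0 = a *: v0.
  by apply: (low_line k2_neq0 Omega_neq0 Omega_x Omega_xi Omega_gen Omega_wt v0_low _ v0_neq0); apply: coef_wt.
have [D PD] := coefmx_bound P.
pose Q := \poly_(k < D) a k.
have a1 : a (m i) = 1.
  apply/eqP; rewrite -subr_eq0; have := aE (m i); rewrite mv -[X in X = _]scale1r => /esym/eqP.
  by rewrite -subr_eq0 -scalerBl scaler_eq0 (negPf v0_neq0) orbF.
have a0 k : (m i < k)%N -> a k = 0.
  move=> mk; have := aE k; rewrite kv // => /esym/eqP.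
  by rewrite scaler_eq0 (negPf v0_neq0) orbF => /eqP.
have mD : (m i < D)%N.
  rewrite ltnNge; apply: contra v0_neq0 => /PD C0; by rewrite -mv C0 mul0mx.
exists Q.
  have ss : size Q = (m i).+1.
    apply/eqP; rewrite eqn_leq; apply/andP; split.
      by apply/leq_sizeP => k mk; rewrite coef_poly; case: ifP => // _; exact: a0.
    rewrite ltnNge; apply/negP => sm; have := nth_default 0 sm.
    by rewrite coef_poly mD a1 => /eqP; rewrite oner_eq0.
  by rewrite monicE lead_coefE ss coef_poly mD a1.
move=> v /(low_line k2_neq0 Omega_neq0 Omega_x Omega_xi Omega_gen Omega_wt v0_low)
  /(_ v0_neq0) [b ->].
rewrite {1}(polymx_coef PD) mulmx_suml /Q poly_def scaler_suml.
apply: eq_bigr => k _; rewrite -scalemxAl -map_mxM -scalemxAr aE.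
rewrite -mul_polyC mulrC -scalerA; congr (_ *: _).
by apply/matrixP => p q; rewrite !mxE -!polyCM; congr (_%:P); ring.
Qed.

End Low.

End PolyIntertwiner.

End Intertwiner.

(** * The complex exponential *)

Section ExpSum.
Variable K : numFieldType.

Definition expterm (k : nat) (z : K) : K := k`!%:R^-1 * z ^+ k.
Definition expsum (n : nat) (z : K) : K := \sum_(k < n) expterm k z.

Lemma expterm_add m a b :
  expterm m (a + b) = \sum_(j < m.+1) expterm j a * expterm (m - j) b.
Proof.
rewrite /expterm addrC exprDn mulr_sumr; apply: eq_bigr => j _.
have jm : (j <= m)%N by rewrite -ltnS.
have nz k : (k`!%:R : K) != 0 by rewrite pnatr_eq0 -lt0n fact_gt0.
rewrite -(bin_fact jm) !natrM -mulr_natr mulrC.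
have := nz j; have := nz (m - j)%N.
have : ('C(m, j)%:R : K) != 0 by rewrite pnatr_eq0 -lt0n bin_gt0.
by move=> *; field; rewrite ?natrM; do ?[apply/andP; split].
Qed.

Lemma expsum_add n a b : expsum n (a + b) =
  \sum_(j < n) \sum_(k < n | (j + k < n)%N) expterm j a * expterm k b.
Proof.
rewrite /expsum; under eq_bigr => m _ do rewrite expterm_add.
pose f j k := expterm j a * expterm k b.
transitivity (\sum_(m < n) \sum_(j < n) \sum_(k < n | (j + k == m)%N) f j k).
  apply: eq_bigr => m _.
  rewrite (big_ord_widen n (fun j => f j (m - j)%N)) ?ltn_ord // big_mkcond.
  apply: eq_bigr => j _; case: ifPn => jm.
    have mj : (m - j < n)%N by rewrite (leq_ltn_trans (leq_subr _ _)).
    rewrite (big_pred1 (Ordinal mj)) // => k /=; rewrite -val_eqE /=.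
    by rewrite ltnS in jm; rewrite -(eqn_add2l j k) subnKC.
  rewrite big_pred0 // => k; apply/negbTE; apply: contraNneq jm => <-.
  by rewrite ltnS leq_addr.
rewrite exchange_big /=; apply: eq_bigr => j _.
rewrite (exchange_big_dep xpredT) //= [RHS]big_mkcond; apply: eq_bigr => k _.
case: ifPn => jk.
  by rewrite (big_pred1 (Ordinal jk)) // => m /=; rewrite -val_eqE /= eq_sym.
rewrite big_pred0 // => m; apply/negbTE; apply: contraNneq jk => ->.
exact: ltn_ord.
Qed.

Lemma expsum_sub n a b : expsum n a * expsum n b - expsum n (a + b) =
  \sum_(j < n) \sum_(k < n | ~~ (j + k < n)%N) expterm j a * expterm k b.
Proof.
rewrite expsum_add /expsum mulr_suml -sumrB; apply: eq_bigr => j _.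
by rewrite mulr_sumr (bigID (fun k : 'I_n => (j + k < n)%N)) /= addrAC subrr add0r.
Qed.

Lemma expterm_norm k z : `|expterm k z| = expterm k `|z|.
Proof. by rewrite /expterm normrM normrX normfV normr_nat. Qed.

(* The remainder of the Cauchy product is dominated by the one for real arguments. *)
Lemma expsum_sub_norm n a b :
  `|expsum n a * expsum n b - expsum n (a + b)|
  <= expsum n `|a| * expsum n `|b| - expsum n (`|a| + `|b|).
Proof.
rewrite !expsum_sub (le_trans (ler_norm_sum _ _ _)) //; apply: ler_sum => j _.
rewrite (le_trans (ler_norm_sum _ _ _)) //; apply: ler_sum => k _.
by rewrite normrM !expterm_norm.
Qed.

End ExpSum.

Section ComplexExp.
Variable R : realType.
Notation C := (Cx R).
Local Open Scope complex_scope.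
Local Open Scope ring_scope.

Lemma cvg_real (u : nat -> R) (l : R) : u n @[n --> \oo] --> l ->
  ((u n)%:C : C) @[n --> \oo] --> (l%:C : C).
Proof.
move=> /cvgrPdist_lt ul; apply/cvgrPdist_lt => e.
case: e => e e' /=; rewrite ltcE /= => /andP[/eqP-> e0].
near=> n; rewrite -[X in `|X|](rmorphB (real_complex R)) normc_def /=.
rewrite expr0n addr0 sqrtr_sqr ltcR.
by near: n; exact: ul.
Unshelve. all: by end_near. Qed.

Lemma complex_split (x y : R) : (x +i* y : C) = (x%:C : C) + (0 +i* 1 : C) * (y%:C : C).
Proof. by apply/eqP; rewrite eq_complex /=; apply/andP; split; apply/eqP; ring. Qed.

Lemma cvg_complex (u v : nat -> R) (a b : R) :
  u n @[n --> \oo] --> a -> v n @[n --> \oo] --> b ->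
  (u n +i* v n : C) @[n --> \oo] --> (a +i* b : C).
Proof.
move=> ua vb; under eq_cvg => n do rewrite complex_split.
rewrite complex_split; apply: cvgD; first exact: cvg_real.
by apply: cvgM; [exact: cvg_cst | exact: cvg_real].
Qed.

Lemma expsum_real n (x : R) : expsum n (x%:C : C) = (expsum n x)%:C.
Proof.
rewrite /expsum (rmorph_sum (real_complex R)) /=; apply: eq_bigr => k _.
by rewrite /expterm (rmorphM (real_complex R)) (rmorphXn (real_complex R)) fmorphV (rmorph_nat (real_complex R)).
Qed.

Lemma expsum_expR (x : R) : expsum n x @[n --> \oo] --> expR x.
Proof.
have -> : (fun n => expsum n x) = series (exp_coeff x).
  apply/funext => n; rewrite /series /= big_mkord; apply: eq_bigr => k _.
  by rewrite /expterm /exp_coeff /= mulrC.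
exact: is_cvg_series_exp_coeff.
Qed.

Lemma expterm_imag n (y : R) : expterm n (0 +i* y : C) = (cos_coeff y n +i* sin_coeff y n : C).
Proof.
have imX k : (0 +i* 1 : C) ^+ k = (((~~ odd k)%:R * (-1) ^+ k./2) +i* ((odd k)%:R * (-1) ^+ k.-1./2) : C).
  elim: k => [|k IH]; first by apply/eqP; rewrite eq_complex /= mul1r mul0r !eqxx.
  rewrite exprS IH; apply/eqP; rewrite eq_complex; case: k IH => [|k] _.
    by apply/andP; split; apply/eqP; rewrite /=; ring.
  by apply/andP; split; apply/eqP; rewrite /= ?negbK; case: (odd k); rewrite /= ?exprS; ring.
have -> : (0 +i* y : C) = (0 +i* 1 : C) * (y%:C : C).
  by rewrite complex_split (_ : (0%:C : C) = 0) // add0r.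
rewrite /expterm exprMn imX -(rmorphXn (real_complex R)).
have -> : (n`!%:R^-1 : C) = (n`!%:R^-1)%:C by rewrite fmorphV (rmorph_nat (real_complex R)).
apply/eqP; rewrite eq_complex /= !mul0r !mulr0 ?subr0 ?addr0 ?add0r /cos_coeff /sin_coeff /=.
by apply/andP; split; apply/eqP; rewrite mulrC.
Qed.

Lemma expsum_imag n (y : R) : expsum n (0 +i* y : C) =
  (series (cos_coeff y) n +i* series (sin_coeff y) n : C).
Proof.
rewrite /series /= !big_mkord /expsum; under eq_bigr => k _ do rewrite expterm_imag.
elim: n => [|n IH]; first by rewrite !big_ord0.
by rewrite !big_ord_recr /= IH.
Qed.

Lemma expsum_cexp_imag (y : R) :
  expsum n (0 +i* y : C) @[n --> \oo] --> (cos y +i* sin y : C).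
Proof.
under eq_cvg => n do rewrite expsum_imag.
by apply: cvg_complex; rewrite unlock; [exact: is_cvg_series_cos_coeff|exact: is_cvg_series_sin_coeff].
Qed.

Lemma normc_real (z : C) : exists x : R, `|z| = x%:C.
Proof. by case: z => a b; rewrite normc_def; eexists. Qed.

(** Dominated by the same remainder at the real arguments [|a|] and [|b|], which tends to zero by
    the functional equation of [expR]. *)
Lemma expsum_sub_cvg (a b : C) :
  (expsum n a * expsum n b - expsum n (a + b)) @[n --> \oo] --> (0 : C).
Proof.
have [x xE] := normc_real a; have [y yE] := normc_real b.
have : (expsum n x * expsum n y - expsum n (x + y)) @[n --> \oo] --> (0 : R).
  rewrite -(subrr (expR (x + y))) {1}expRD; apply: cvgB; last exact: expsum_expR.
  by apply: cvgM; exact: expsum_expR.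
move=> /cvg_real /cvgrPdist_lt H; apply/cvgrPdist_lt => e e0.
have {}H := H e e0; near=> n.
rewrite sub0r normrN (le_lt_trans (expsum_sub_norm _ _ _)) //.
rewrite xE yE -(rmorphD (real_complex R)) !expsum_real.
rewrite -(rmorphM (real_complex R)) -(rmorphB (real_complex R)) /=.
apply: le_lt_trans (_ : `|0 - ((expsum n x * expsum n y - expsum n (x + y))%:C : C)| < e).
  by rewrite sub0r normrN; apply: real_ler_norm; rewrite complex_real.
by near: n.
Unshelve. all: by end_near. Qed.

(** Links [cexp], built from real functions, to the series in [expmx]: the series is evaluated at
    the real and imaginary parts, and the Cauchy product remainder tends to zero. *)
Lemma expsum_cvg (z : C) : expsum n z @[n --> \oo] --> cexp z.
Proof.
case: z => x y; pose a : C := x%:C; pose b : C := 0 +i* y.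
have -> : (x +i* y : C) = a + b by rewrite /a /b; apply/eqP; rewrite eq_complex /= addr0 add0r !eqxx.
have -> : (fun n => expsum n (a + b)) =
  (fun n => expsum n a * expsum n b - (expsum n a * expsum n b - expsum n (a + b))).
  by apply/funext => n; rewrite opprB addrCA subrr addr0.
have -> : cexp (a + b) = (expR x)%:C * (cos y +i* sin y : C) - 0.
  apply/eqP; rewrite subr0 eq_complex /= !mul0r subr0 addr0 add0r addr0; exact/andP.
apply: cvgB; last exact: expsum_sub_cvg.
apply: cvgM; last exact: expsum_cexp_imag.
under eq_cvg => n do rewrite expsum_real.
by apply: cvg_real; exact: expsum_expR.
Qed.

Lemma cexpD (a b : C) : cexp (a + b) = cexp a * cexp b.
Proof.
apply/esym/eqP; rewrite -subr_eq0; apply/eqP.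
apply: (@cvg_unique C _ ((fun n => expsum n a * expsum n b - expsum n (a + b)) @ \oo)).
- exact: norm_hausdorff.
- apply: cvgB; last exact: expsum_cvg.
  by apply: cvgM; exact: expsum_cvg.
- exact: expsum_sub_cvg.
Qed.

End ComplexExp.

(** * Limits and punctured neighbourhoods *)

Section Limits.
Variable K : numFieldType.

Lemma cvg_bigsum (I : Type) (s : seq I) (T : Type) (F : set_system T) (FF : Filter F)
    (f : I -> T -> K) (l : I -> K) :
  (forall i, f i x @[x --> F] --> l i) ->
  \sum_(i <- s) f i x @[x --> F] --> \sum_(i <- s) l i.
Proof.
move=> H; elim: s => [|i s IH].
  by rewrite big_nil; under eq_cvg => x do rewrite big_nil; exact: cvg_cst.
by rewrite big_cons; under eq_cvg => x do rewrite big_cons; exact: cvgD.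
Qed.

Lemma horner_continuous (B : {poly K}) (z : K) : B.[x] @[x --> z] --> B.[z].
Proof.
elim/poly_ind: B => [|B c IH].
  rewrite horner0 (_ : horner 0 = fun=> 0 :> K); last first.
    by apply/funext => x; rewrite horner0.
  exact (@cvg_cst K (0 : K) K (nbhs z) _).
rewrite hornerMXaddC (_ : horner _ = (horner B : K -> K) \* id \+ cst c); last first.
  by apply/funext => x; rewrite !hornerE.
exact: (cvgD (cvgM IH (@cvg_id K (nbhs z))) (@cvg_cst K c K (nbhs z) _)).
Qed.

Lemma near_dnbhsP (z : K) (P : K -> Prop) : (\forall u \near z^', P u) <->
  exists2 e : K, 0 < e & forall u, u != z -> `|u - z| < e -> P u.
Proof.
split=> [/nbhs_ballP[e /= e0 H]|[e e0 H]].
  by exists e => // u uz zu; apply: H => //=; rewrite /ball /= distrC.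
apply/nbhs_ballP; exists e => //= u; rewrite /ball /= distrC => zu uz; exact: H.
Qed.

Lemma near_dnbhs_shift (z s : K) (P : K -> Prop) :
  (\forall u \near (z + s)^', P u) -> \forall u \near z^', P (u + s).
Proof.
move=> /near_dnbhsP[e e0 H]; apply/near_dnbhsP; exists e => // u uz zu.
by apply: H; [rewrite (inj_eq (addIr s)) | rewrite opprD addrACA subrr addr0].
Qed.

Lemma near_dnbhs_poly (B : {poly K}) (z : K) : B != 0 -> \forall u \near z^', B.[u] != 0.
Proof.
move=> B0; have [m [q /implyP/(_ B0) qz BE]] := multiplicity_XsubC B z.
have : \forall u \near z^', q.[u] != 0.
  apply: nbhs_dnbhs; have := @horner_continuous q z.
  move=> /cvgrPdist_lt /(_ `|q.[z]|); rewrite normr_gt0 => /(_ qz).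
  apply: filterS => u; apply: contraTneq => ->.
  by rewrite subr0 ltxx.
move=> /near_dnbhsP[e e0 H]; apply/near_dnbhsP; exists e => // u uz zu.
by rewrite BE hornerM horner_exp !hornerE mulf_neq0 ?H // expf_neq0 // subr_eq0.
Qed.

Lemma generic_near (P : K -> Prop) z : generic P -> \forall u \near z^', P u.
Proof. by case=> B B0 BP; apply: filterS (near_dnbhs_poly z B0). Qed.

(** Turns an identity of meromorphic functions, which ignores the point itself, into an equality at
    that point. *)
Lemma dnbhs_cvg_eq (F G : K -> K) (z l m : K) :
  F x @[x --> z] --> l -> G x @[x --> z] --> m ->
  (\forall u \near z^', F u = G u) -> l = m.
Proof.
move=> Fl Gm FG; apply: (@cvg_unique K _ (F x @[x --> z^'])).
- exact: norm_hausdorff.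
- exact: cvg_trans (cvg_app _ (@nbhs_dnbhs _ z)) Fl.
- apply: cvg_trans (cvg_trans (cvg_app _ (@nbhs_dnbhs _ z)) Gm).
  by apply: near_eq_cvg; apply: filterS FG => u ->.
Qed.

Lemma derivable_cvg (F : K -> K) z : derivable F z 1 -> F x @[x --> z] --> F z.
Proof. by move=> /derivable1_diffP /differentiable_continuous. Qed.

End Limits.

(** * Exponential of a diagonalizable matrix *)

Section ExpMx.
Variables (R : realType) (N : nat).
Notation C := (Cx R).
Variable A : 'M[C]_N.
Hypothesis A_diag : forall v : 'cV[C]_N, exists2 s : seq (C * 'cV[C]_N),
  (forall x, x \in s -> A *m x.2 = x.1 *: x.2) & v = \sum_(x <- s) x.2.

Lemma exp_eigenvector a (v : 'cV[C]_N) m : A *m v = a *: v ->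
  (\sum_(k < m) (k`!%:R^-1 *: A ^+ k)) *m v = expsum m a *: v.
Proof.
move=> Av; rewrite mulmx_suml /expsum scaler_suml; apply: eq_bigr => k _.
rewrite -scalemxAl /expterm -scalerA; congr (_ *: _).
elim: (nat_of_ord k) => [|j IH]; first by rewrite !expr0 mul1mx scale1r.
by rewrite exprS -[_ * _]/(_ *m _) -mulmxA IH -scalemxAr Av scalerA exprSr.
Qed.

(** [expmx] is defined by [lim], which says something only once convergence is known. Splitting a
    basis vector into eigenvectors reduces convergence to the scalar series. *)
Lemma expmx_cvg p q :
  (\sum_(k < m) (k`!%:R^-1 * (A ^+ k) p q)) @[m --> \oo] --> expmx A p q.
Proof.
rewrite mxE; have [s sA sE] := A_diag (delta_mx q ord0).
apply: (cvgP (\sum_(x <- s) cexp x.1 * x.2 p ord0)).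
have E m : \sum_(k < m) (k`!%:R^-1 * (A ^+ k) p q) = \sum_(x <- s) expsum m x.1 * x.2 p ord0.
  transitivity (((\sum_(k < m) (k`!%:R^-1 *: A ^+ k)) *m delta_mx q (ord0 : 'I_1)) p ord0).
    rewrite [RHS]mxE (bigD1 q) //= [X in _ + X]big1 => [|j jq]; last first.
      by rewrite [delta_mx _ _ _ _]mxE (negPf jq) mulr0.
    rewrite addr0 [delta_mx _ _ _ _]mxE !eqxx mulr1 summxE.
    by apply: eq_bigr => k _; rewrite mxE.
  rewrite sE mulmx_sumr summxE big_seq [RHS]big_seq; apply: eq_bigr => x xs.
  by rewrite (exp_eigenvector _ (sA _ xs)) mxE.
under eq_cvg => m do rewrite E.
by apply: cvg_bigsum => x; apply: cvgM; [exact: expsum_cvg | exact: cvg_cst].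
Qed.

Lemma expmx_eigenvector a (v : 'cV[C]_N) : A *m v = a *: v ->
  expmx A *m v = cexp a *: v.
Proof.
move=> Av; apply/matrixP => p q; rewrite !mxE.
pose F m := ((\sum_(k < m) (k`!%:R^-1 *: A ^+ k)) *m v) p q.
have FE : F m @[m --> \oo] --> \sum_j expmx A p j * v j q.
  rewrite /F; under eq_cvg => m do rewrite mxE.
  apply: cvg_bigsum => j; apply: cvgM; last exact: cvg_cst.
  have E m : (\sum_(k < m) (k`!%:R^-1 *: A ^+ k)) p j = \sum_(k < m) (k`!%:R^-1 * (A ^+ k) p j).
    by rewrite summxE; apply: eq_bigr => k _; rewrite mxE.
  by under eq_cvg => m do rewrite E; exact: expmx_cvg.
have Fe : F m @[m --> \oo] --> cexp a * v p q.
  rewrite /F; under eq_cvg => m do rewrite (exp_eigenvector _ Av) mxE.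
  by apply: cvgM; [exact: expsum_cvg | exact: cvg_cst].
exact: cvg_unique FE Fe.
Qed.

End ExpMx.

(** * Series expansions and the normalized solution *)

Lemma peval_mulXn (K : fieldType) (W : lmodType K) (f : nat -> W) (D : {poly K}) k :
  \sum_(j < size D) D`_j *: f (j + k)%N = peval f (D * 'X^k).
Proof.
have E : D * 'X^k = \sum_(j < size D) D`_j *: 'X^(j + k).
  rewrite -[X in X * _]coefK poly_def mulr_suml; apply: eq_bigr => j _.
  by rewrite -scalerAl -exprD.
rewrite E linear_sum; apply: eq_bigr => j _.
by rewrite (linearZ_LR (peval f)) /= pevalXn.
Qed.

Section Series.
Variables (K : numClosedFieldType) (L : simple_lie K) (hbar : K) (N : nat).
Notation n := (rank L).
Variable V : yangian_rep L hbar N.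
Hypothesis k2_neq0 : kappa2 L != 0%N.
Notation xs := (xs V).
Notation xis := (xis V).

Definition x_ser e j r : 'M[K]_N := if r is r'.+1 then hbar *: xpm V e j r' else 0.

Lemma expands_x_ser e j D : (forall q, xs e j (D * q) = 0) ->
  exists P, expands (x_ser e j) P D.
Proof.
move=> xD; apply: expands_exists => k; rewrite /x_ser.
have -> : \sum_(l < size D) D`_l *: (if (l + k.+1)%N is r'.+1 then hbar *: xpm V e j r' else 0)
    = hbar *: \sum_(l < size D) D`_l *: xpm V e j (l + k).
  by rewrite scaler_sumr; apply: eq_bigr => l _; rewrite addnS !scalerA mulrC.
by rewrite peval_mulXn -/(xs e j _) xD scaler0.
Qed.

(** As [xi_j] is the bracket of [x^+_j] and [x^-_j], an annihilator of either one annihilates [xi_j]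
    and is a denominator of [xi_j(u)]. *)
Lemma expands_xi_ser e j D : (forall q, xs e j (D * q) = 0) ->
  exists P, expands (xi_ser V j) P D.
Proof.
move=> xD; apply: expands_exists => k; rewrite /xi_ser.
have -> : \sum_(l < size D) D`_l *: (if (l + k.+1)%N is r'.+1 then hbar *: xi V j r' else 1%:M)
    = hbar *: \sum_(l < size D) D`_l *: xi V j (l + k).
  by rewrite scaler_sumr; apply: eq_bigr => l _; rewrite addnS !scalerA mulrC.
rewrite peval_mulXn -/(xis j _).
suff -> : xis j (D * 'X^k) = 0 by rewrite scaler0.
have := xs_xs_bracket V j j (D * 'X^k) 1; rewrite eqxx mulr1 => <-.
case: e xD => xD; first by rewrite xD mul0mx mulmx0 subrr.
have := xs_xs_bracket V j j 1 (D * 'X^k); have := xs_xs_bracket V j j (D * 'X^k) 1.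
by rewrite eqxx mulr1 mul1r => -> <-; rewrite xD mulmx0 mul0mx subrr.
Qed.

(** The coefficient of [u^-1] already says that [D] lies in the kernel of [xs e j], and that kernel
    is an ideal. *)
Lemma expands_annihilator e j P D : hbar != 0 -> expands (x_ser e j) P D ->
  forall q, xs e j (D * q) = 0.
Proof.
move=> h0 [_ E]; apply: (xs_mul_eq0 k2_neq0).
have := E 0%N; rewrite /x_ser.
have -> : \sum_(l < size D) D`_l *: (if (l + 1)%N is r'.+1 then hbar *: xpm V e j r' else 0)
    = hbar *: \sum_(l < size D) D`_l *: xpm V e j (l + 0).
  by rewrite scaler_sumr; apply: eq_bigr => l _; rewrite addn1 addn0 !scalerA mulrC.
rewrite peval_mulXn mulr1 => /eqP; rewrite scaler_eq0 (negPf h0) => /eqP; exact.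
Qed.

End Series.

(** * Solutions of the intertwining relation at a point *)

Section Solution.
Variables (K : numClosedFieldType) (L : simple_lie K) (hbar : K) (N : nat).
Notation n := (rank L).
Notation h := (csa L).
Notation hdual := 'Hom(subvs_of h, K^o).
Variable V : yangian_rep L hbar N.
Hypothesis k2_neq0 : kappa2 L != 0%N.
Variables (Omega : 'cV[K]_N) (lambda : hdual).
Hypothesis Omega_neq0 : Omega != 0.
Hypothesis Omega_x : forall i r, xpm V true i r *m Omega = 0.
Hypothesis Omega_xi : exists m : 'I_n -> nat -> K, forall i r, xi V i r *m Omega = m i r *: Omega.
Hypothesis Omega_gen : forall U : {vspace 'cV[K]_N}, Omega \in U ->
  (forall i r v, v \in U -> xi V i r *m v \in U) ->
  (forall e i r v, v \in U -> xpm V e i r *m v \in U) -> U = fullv.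
Hypothesis Omega_wt : wt_space V lambda Omega.
Notation xs := (xs V).
Notation xs_rel := (xs_rel V).
Notation pc := (map_mx (@polyC K)).
Variable i : 'I_n.
Notation lpoly := (lpoly i).

Lemma cartan_act_diag t v : exists2 s : seq (K * 'cV[K]_N),
  (forall x, x \in s -> cartan_act V t *m x.2 = x.1 *: x.2) & v = \sum_(x <- s) x.2.
Proof.
have [|||s sH ->] := @hw_decomposition _ _ _ _ V k2_neq0 Omega Omega_x Omega_xi Omega_gen
  (fun m v => wt_space V (lambda - qsum m) v) _ _ _ v.
- by rewrite qsum0 subr0.
- by move=> m a u w; apply: wt_space_lin.
- move=> m k r u /(x_weight k2_neq0 false k r).
  by rewrite qsum_incr /= scaleN1r opprD addrA.
exists [seq ((lambda - qsum x.1) t : K, x.2) | x <- s]; last by rewrite big_map.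
by move=> _ /mapP[x /sH xs ->] /=.
Qed.

Definition defect u k q (S : 'M[K]_N) := xs false k (lpoly u k * q) *m S - S *m xs false k q.

Lemma defect_shift u s k q (A S : 'M[K]_N) :
  xs_rel false k A (lpoly u k) (lpoly (u + s) k) ->
  defect (u + s) k q (A *m S) = A *m defect u k q S.
Proof. by move=> Ax; rewrite /defect mulmxBr !mulmxA -Ax. Qed.

(** An [E] behaving like [u^(varpi_i)] turns the factor [u - X] into [1 - X / u], so every term has
    a limit at infinity when [E S] does. *)
Lemma defect_exp u k q (E S : 'M[K]_N) : u != 0 ->
  (forall q', E *m xs false k q' = (if k == i then u^-1 else 1) *: (xs false k q' *m E)) ->
  E *m defect u k q S =
  (if k == i then xs false k q *m (E *m S) - u^-1 *: (xs false k ('X * q) *m (E *m S))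
   else xs false k q *m (E *m S)) - (E *m S) *m xs false k q.
Proof.
move=> u0 Ex; rewrite /defect mulmxBr !mulmxA Ex /(lpoly _ _); congr (_ - _).
case: eqP => _; last by rewrite mul1r scale1r.
by rewrite xs_mulBX mulmxBl scalerBr -!scalemxAl scalerA mulVf // scale1r mulmxBl -scalemxAl.
Qed.

Definition intertwines u (S : 'M[K]_N) :=
  (forall k, xs_rel false k S 1 (lpoly u k)) /\ S *m Omega = Omega.

(** The relation computes [S] on a word from its value on a shorter one, with coefficients
    polynomial in [u] that do not depend on [S]; the columns of [P] come from the basis vectors. *)
Lemma intertwines_poly : exists P : 'M[{poly K}]_N,
  forall u S, intertwines u S -> S = evalmx P u.
Proof.
have H v : exists y : 'cV[{poly K}]_N, forall u S, intertwines u S ->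
    S *m v = map_mx (horner_eval u) y.
  elim/(hw_ind k2_neq0 Omega_x Omega_xi Omega_gen): v => [|a v w [y yE] [y' y'E]|k r v [y yE]].
  - exists (pc Omega) => u S [_ ->]; apply/matrixP => p q.
    by rewrite !mxE /horner_eval hornerC.
  - exists (a%:P *: y + y') => u S Su; rewrite mulmxDr -scalemxAr (yE _ _ Su) (y'E _ _ Su).
    by apply/matrixP => p q; rewrite !mxE /horner_eval !hornerE.
  - exists (if k == i then 'X *: (pc (xs false k 'X^r) *m y) - pc (xs false k ('X * 'X^r)) *m y
            else pc (xs false k 'X^r) *m y) => u S Su.
    have pcE M : map_mx (horner_eval u) (pc M *m y) = M *m map_mx (horner_eval u) y.
      rewrite map_mxM; congr (_ *m _); apply/matrixP => p q.
      by rewrite !mxE /= /horner_eval hornerC.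
    have XE (w : 'cV[{poly K}]_N) :
        map_mx (horner_eval u) ('X *: w) = u *: map_mx (horner_eval u) w.
      by apply/matrixP => p q; rewrite !mxE /horner_eval hornerM hornerX.
    have := Su.1 k 'X^r; rewrite mul1r /(lpoly _ _) -xsXn mulmxA => ->.
    case: eqP => _; last by rewrite mul1r -mulmxA (yE _ _ Su) pcE.
    rewrite xs_mulBX mulmxBl -scalemxAl mulmxBl -scalemxAl -!mulmxA (yE _ _ Su).
    rewrite map_mxB pcE; congr (_ - _).
    by rewrite -pcE; apply/esym; apply: XE.
have [y yE] := choice (fun q : 'I_N => H (delta_mx q 0)).
exists (\matrix_(p, q) y q p 0) => u S Su; apply/matrixP => p q.
have /matrixP/(_ p 0) := yE q _ _ Su; rewrite !mxE => <-.
rewrite (bigD1 q) //= big1 => [|j jq]; last by rewrite !mxE (negPf jq) mulr0.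
by rewrite !mxE !eqxx mulr1 addr0.
Qed.

Variable P : 'M[{poly K}]_N.
Hypothesis P_eval : forall u S, intertwines u S -> S = evalmx P u.

Section Dense.
Hypothesis dense : forall B : {poly K}, B != 0 ->
  exists u S, B.[u] != 0 /\ intertwines u S.

Lemma polymx_dense m (A B : 'M[{poly K}]_(N, m)) :
  (forall u S, intertwines u S -> map_mx (horner_eval u) A = map_mx (horner_eval u) B) ->
  A = B.
Proof.
move=> AB; apply/matrixP => p q; apply/eqP; rewrite -subr_eq0.
apply/negPn/negP => /dense[u [S [nz Su]]].
have /matrixP/(_ p q) := AB _ _ Su; rewrite !mxE /horner_eval => E.
by rewrite !hornerE E subrr eqxx in nz.
Qed.

Lemma solution_Omega : P *m pc Omega = pc Omega.
Proof.
apply: polymx_dense => u S Su; have := Su.2; rewrite (P_eval Su) => E.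
have pcE : map_mx (horner_eval u) (pc Omega) = Omega.
  by apply/matrixP => p q; rewrite !mxE /horner_eval hornerC.
by rewrite map_mxM pcE.
Qed.

Lemma solution_x k p : P *m pc (xs false k p) =
  (if k == i then 'X *: pc (xs false k p) - pc (xs false k ('X * p))
   else pc (xs false k p)) *m P.
Proof.
apply: polymx_dense => u S Su; rewrite -!/(evalmx _ u) !evalmxM evalmx_polyC.
have := Su.1 k p; rewrite (P_eval Su) mul1r => ->; congr (_ *m _).
rewrite /(lpoly _ _); case: eqP => _; last by rewrite mul1r evalmx_polyC.
by rewrite xs_mulBX evalmxB evalmxZ hornerX !evalmx_polyC.
Qed.

End Dense.

(** The propagation step: invertibility of [A] transports the relation from [u + s] back to [u]. The
    scalar [b] absorbs the change of normalization. *)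
Lemma intertwines_back u s A S S' b : A \in unitmx -> b != 0 ->
  (forall k, xs_rel false k A (lpoly u k) (lpoly (u + s) k)) ->
  intertwines (u + s) S' -> A *m S = b *: S' -> S *m Omega = Omega ->
  intertwines u S.
Proof.
move=> Au b0 Ax [S'x _] AS SO; split=> // k p; apply: (can_inj (mulKmx Au)).
rewrite mul1r mulmxA AS -scalemxAl; have := S'x k p; rewrite mul1r => ->.
by rewrite scalemxAr -AS mulmxA -Ax mulmxA.
Qed.

End Solution.

(** * The transfer operator *)

Section MatrixLimits.
Variable K : numFieldType.

Definition mxcvg m n (F : nat -> 'M[K]_(m, n)) (L : 'M[K]_(m, n)) : Prop :=
  forall p q, F k p q @[k --> \oo] --> L p q.

Lemma mxcvg_cst m n (L : 'M[K]_(m, n)) : mxcvg (fun=> L) L.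
Proof. by move=> p q; exact: cvg_cst. Qed.

Lemma mxcvgB m n (F G : nat -> 'M[K]_(m, n)) L M :
  mxcvg F L -> mxcvg G M -> mxcvg (fun k => F k - G k) (L - M).
Proof.
move=> FL GM p q; rewrite !mxE.
by under eq_cvg => k do rewrite !mxE; apply: cvgB.
Qed.

Lemma mxcvgM m n r (F : nat -> 'M[K]_(m, n)) (G : nat -> 'M[K]_(n, r)) L M :
  mxcvg F L -> mxcvg G M -> mxcvg (fun k => F k *m G k) (L *m M).
Proof.
move=> FL GM p q; rewrite !mxE; under eq_cvg => k do rewrite !mxE.
by apply: cvg_bigsum => j; apply: cvgM.
Qed.

Lemma mxcvgZ m n (a : nat -> K) (F : nat -> 'M[K]_(m, n)) (b : K) L :
  a k @[k --> \oo] --> b -> mxcvg F L -> mxcvg (fun k => a k *: F k) (b *: L).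
Proof.
move=> ab FL p q; rewrite !mxE; under eq_cvg => k do rewrite !mxE.
exact: cvgM.
Qed.

Lemma mxcvg_unique m n (F : nat -> 'M[K]_(m, n)) L M : mxcvg F L -> mxcvg F M -> L = M.
Proof.
move=> FL FM; apply/matrixP => p q.
exact: cvg_unique (FL p q) (FM p q).
Qed.

End MatrixLimits.

(** * The coordinate [Re(u / hbar)] *)

Section HalfPlane.
Variables (R : realType) (hbar : Cx R).
Hypothesis hbar_neq0 : hbar != 0.
Notation C := (Cx R).
Local Open Scope complex_scope.
Local Open Scope ring_scope.

Definition rho (u : C) : R := complex.Re (u / hbar).

Lemma rhoD u v : rho (u + v) = rho u + rho v.
Proof. by rewrite /rho mulrDl; case: (u / hbar); case: (v / hbar). Qed.

Lemma rhoN u : rho (- u) = - rho u.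
Proof. by rewrite /rho mulNr; case: (u / hbar). Qed.

Lemma rho_natM n : rho (n%:R * hbar) = n%:R.
Proof. by rewrite /rho mulfK // -(rmorph_nat (real_complex R)). Qed.

Lemma rho_le u : ((rho u)%:C : C) * `|hbar| <= `|u|.
Proof.
have h0 : 0 < `|hbar| by rewrite normr_gt0.
rewrite -ler_pdivlMr // -normfV -normrM.
apply: le_trans (normc_ge_Re (u / hbar)).
by rewrite lecR ler_norm.
Qed.

Lemma rho_near M z : M < rho z -> \forall u \near z, M < rho u.
Proof.
move=> Mz; have h0 : 0 < `|hbar| by rewrite normr_gt0.
apply/nbhs_ballP; exists (((rho z - M)%:C : C) * `|hbar|).
  by rewrite /= mulr_gt0 // ltcR subr_gt0.
move=> u; rewrite /ball /= => zu.
have := le_lt_trans (rho_le (z - u)) zu; rewrite ltr_pM2r // ltcR rhoD rhoN.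
by rewrite ltrD2l ltrN2.
Qed.

Lemma rho_far (u : C) (k : nat) (B : R) : 0 < rho u -> (0 < k)%N ->
  \forall n \near \oo, (B%:C : C) < `|u + n%:R * (k%:R * hbar)|.
Proof.
move=> u0 k0; have [a aE] := normc_real hbar.
have a0 : 0 < a by have : 0 < `|hbar| by [rewrite normr_gt0]; rewrite aE ltcR.
near=> n; apply: lt_le_trans (rho_le _).
rewrite rhoD mulrA -natrM rho_natM aE -(rmorphM (real_complex R)) ltcR.
rewrite -ltr_pdivrMr //; apply: (@lt_le_trans _ _ n%:R).
  by near: n; exact: nbhs_infty_gtr.
rewrite -[X in X <= _]add0r; apply: lerD; first exact: ltW.
by rewrite ler_nat leq_pmulr.
Unshelve. all: by end_near. Qed.

Lemma rho_inv_cvg (u : C) (k : nat) : 0 < rho u -> (0 < k)%N ->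
  (u + n%:R * (k%:R * hbar))^-1 @[n --> \oo] --> (0 : C).
Proof.
move=> u0 k0; apply/cvgrPdist_lt => e.
case: e => e e' /=; rewrite ltcE /= => /andP[/eqP-> e0].
near=> n; rewrite sub0r normrN normfV.
have H : ((e^-1)%:C : C) < `|u + n%:R * (k%:R * hbar)| by near: n; exact: rho_far.
have e1 : 0 < ((e^-1)%:C : C) by rewrite ltcR invr_gt0.
rewrite (_ : (e +i* 0 : C) = ((e^-1)%:C)^-1); last by rewrite -fmorphV invrK.
by rewrite ltf_pV2 ?posrE //; exact: lt_trans H.
Unshelve. all: by end_near. Qed.

Lemma generic_rho (Q : C -> Prop) : generic Q -> exists M, forall u, M < rho u -> Q u.
Proof.
move=> [B B0 BQ]; have [s sE] := closed_field_poly_normal B.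
have [M ME] : exists M, forall z, z \in s -> rho z <= M.
  elim: s {sE} => [|z s [M ME]]; first by exists 0.
  exists (Num.max (rho z) M) => x; rewrite in_cons le_max => /predU1P[->|/ME ->].
    by rewrite lexx.
  by rewrite orbT.
exists M => u Mu; apply: BQ; rewrite sE hornerZ mulf_neq0 ?lead_coef_eq0 //.
rewrite horner_prod prodf_seq_neq0; apply/allP => z /ME zM; rewrite !hornerE /=.
by apply: contraTneq Mu => /eqP; rewrite subr_eq0 => /eqP ->; rewrite -leNgt.
Qed.

End HalfPlane.

Section Bridge.
Variables (R : realType) (L : simple_lie (Cx R)) (hbar : Cx R) (N : nat).
Notation C := (Cx R).
Variable V : yangian_rep L hbar N.
Hypothesis k2_neq0 : kappa2 L != 0%N.

Lemma dcoroots_sharps : dcoroots L = sharps L.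
Proof.
apply: eq_from_tnth => i; rewrite !tnth_mktuple /coroot scalerA mulfV ?scale1r //.
exact: dsym_neq0.
Qed.

Lemma h_act_cartan t : h_act V t = cartan_act V t.
Proof. by rewrite /h_act dcoroots_sharps. Qed.

Lemma weight_space_wt mu : weight_space V mu = wt_space V mu.
Proof. by apply/seteqP; split=> v vmu t; have := vmu t; rewrite h_act_cartan. Qed.

Lemma rat_val_expansion (F : nat -> 'M[C]_N) P D z : expands F P D -> D.[z] != 0 ->
  rat_val F z = D.[z]^-1 *: evalmx P z.
Proof.
move=> FPD Dz; rewrite /rat_val; apply: xget_unique.
  by exists P, D; split.
move=> _ [P' [D' [FPD' D'z ->]]]; have := expands_unique z FPD FPD'.
move=> /(congr1 (fun M => (D.[z]^-1 * D'.[z]^-1) *: M)).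
by rewrite !scalerA mulfVK // mulrAC mulVf // mul1r => <-.
Qed.

Lemma rat_val_xi j : exists P D, [/\ D != 0, expands (xi_ser V j) P D &
  forall w, D.[w] != 0 -> rat_val (xi_series V j) w = D.[w]^-1 *: evalmx P w].
Proof.
have [D D0 DE] := xs_annihilator V k2_neq0 false j.
have [P PD] := expands_xi_ser DE.
by exists P, D; split=> // w Dw; exact: rat_val_expansion.
Qed.

End Bridge.

(** * From the difference equation to the intertwining relation *)

Section Transfer.
Variables (R : realType) (L : simple_lie (Cx R)).
Variable c : 'I_(rank L) -> 'I_(rank L) -> {fsfun int -> nat with 0%N}.
Hypothesis hc : inverse_qcartan c.
Variable hbar : Cx R.
Hypothesis hbar_neq0 : hbar != 0.
Variable lg : Cx R -> Cx R.
Hypothesis hlg : log_branch hbar lg.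
Variables (N : nat) (V : yangian_rep L hbar N).
Notation C := (Cx R).
Notation n := (rank L).
Notation hdual := 'Hom(subvs_of (csa L), C^o).
Hypothesis k2_neq0 : kappa2 L != 0%N.
Variables (Omega : 'cV[C]_N) (lambda : hdual).
Hypothesis Omega_neq0 : Omega != 0.
Hypothesis Omega_x : forall i r, xpm V true i r *m Omega = 0.
Hypothesis Omega_xi : exists m : 'I_n -> nat -> C, forall i r, xi V i r *m Omega = m i r *: Omega.
Hypothesis Omega_gen : forall U : {vspace 'cV[C]_N}, Omega \in U ->
  (forall i r v, v \in U -> xi V i r *m v \in U) ->
  (forall e i r v, v \in U -> xpm V e i r *m v \in U) -> U = fullv.
Hypothesis Omega_wt : wt_space V lambda Omega.
Variable i : 'I_n.
Notation xs := (xs V).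
Notation xs_rel := (xs_rel V).
Notation lpoly := (lpoly i).
Notation rho := (rho hbar).
Notation intertwines := (intertwines V Omega i).
Let p : C := (kappa2 L)%:R * hbar.
Let A := A_op V c i.

Let two_kappa : 2 * kappa L * hbar = p.
Proof. by rewrite /kappa mulrCA mulfV ?mulr1 // pnatr_eq0. Qed.

Lemma A_rational : rational_mx A.
Proof. exact: (Aop_rational k2_neq0 c (rat_val_xi V k2_neq0) i). Qed.

Lemma A_generic : generic (fun u => A u \in unitmx /\
  forall k, xs_rel false k (A u) (lpoly u k) (lpoly (u + p) k)).
Proof. exact: (Aop_generic k2_neq0 hc (rat_val_xi V k2_neq0) i). Qed.

Let E (u : C) : 'M[C]_N := expmx (lg u *: h_act V (varpi i)).

Lemma cexpN (z : C) : cexp (- z) = (cexp z)^-1.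
Proof.
have E0 : cexp 0 = 1 :> C.
  apply/eqP; rewrite eq_complex /=.
  by rewrite expR0 cos0 sin0 !mul1r !eqxx.
have : cexp (- z) * cexp z = 1 by rewrite -cexpD addNr E0.
move=> zz; have z0 : cexp z != 0.
  by apply/eqP => z0; move/eqP: zz; rewrite z0 mulr0 eq_sym oner_eq0.
by rewrite -[LHS](mulfK z0) zz mul1r.
Qed.

(** [x^-_k] lowers the eigenvalue of [varpi i] by one when [k = i] and preserves it otherwise. On
    eigenvectors this becomes the factor [cexp (- lg u) = u^-1]. *)
Lemma exp_varpi_x u k q : 0 < rho u ->
  E u *m xs false k q = (if k == i then u^-1 else 1) *: (xs false k q *m E u).
Proof.
move=> /hlg[cu _]; set a := if _ then _ else _.
pose H := cartan_act V (varpi i).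
have dH : forall v : 'cV[C]_N, exists2 s : seq (C * 'cV[C]_N),
    (forall x, x \in s -> (lg u *: H) *m x.2 = x.1 *: x.2) & v = \sum_(x <- s) x.2.
  move=> v; have [s sH ->] := cartan_act_diag k2_neq0 Omega_x Omega_xi Omega_gen Omega_wt (varpi i) v.
  exists [seq (lg u * x.1, x.2) | x <- s]; last by rewrite big_map.
  by move=> _ /mapP[x /sH xE ->] /=; rewrite -scalemxAl xE scalerA.
have eE b (v : 'cV[C]_N) : H *m v = b *: v -> E u *m v = cexp (lg u * b) *: v.
  move=> Hv; rewrite /E h_act_cartan //; apply: expmx_eigenvector => //.
  by rewrite -scalemxAl Hv scalerA.
apply/eqP; rewrite -subr_eq0; apply/eqP/matrix_eq0_cV => v.
have [s sH ->] := cartan_act_diag k2_neq0 Omega_x Omega_xi Omega_gen Omega_wt (varpi i) v.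
rewrite mulmx_sumr big_seq big1 // => -[b w] /sH /= Hw.
have Hxw : H *m (xs false k q *m w) = (b - (k == i)%:R) *: (xs false k q *m w).
  rewrite mulmxA cartan_act_xs // mulmxDl -mulmxA Hw -scalemxAr -scalemxAl -scalerDl.
  by rewrite varpiP /= mulN1r.
rewrite mulmxBl -mulmxA (eE _ _ Hxw) -scalemxAl -mulmxA (eE _ _ Hw) -scalemxAr.
rewrite scalerA -scalerBl.
suff -> : cexp (lg u * (b - (k == i)%:R)) = a * cexp (lg u * b) by rewrite subrr scale0r.
rewrite /a; case: eqP => _; last by rewrite subr0 mul1r.
by rewrite mulrBr mulr1 cexpD cexpN cu mulrC.
Qed.

Variable T : C -> 'M[C]_N.
Hypothesis hT : transfer_operator V c lg i T.

Lemma holomorphic_cvg (F : C -> 'M[C]_N) z r s : holomorphic_at F z ->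
  F x r s @[x --> z] --> F z r s.
Proof. by move=> /nbhs_singleton /(_ r s); exact: derivable_cvg. Qed.

Lemma transfer_half_plane : exists M, forall u, M < rho u ->
  [/\ T u \in unitmx, T (u + p) = A u *m T u, A u \in unitmx &
   forall k, xs_rel false k (A u) (lpoly u k) (lpoly (u + p) k)].
Proof.
have [_ TA [M HM] _] := hT.
have [Num [Den Den0 AE]] := A_rational.
have /(generic_rho hbar)[M' HM'] := generic_and (generic_and AE (generic_root Den0)) A_generic.
exists (Num.max M M') => u; rewrite gt_max => /andP[Mu M'u].
have [Th Tu] := HM _ Mu; have [[AuE Du] [Aunit Arel]] := HM' _ M'u.
split=> //; rewrite AuE -scalemxAl.
apply: (canRL (scalerK Du)); apply/matrixP => r s; rewrite !mxE.
have Mup : M < rho (u + p) by rewrite rhoD rho_natM // ltr_wpDr.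
have c1 : Den.[x] * T (x + p) r s @[x --> u] --> Den.[u] * T (u + p) r s.
  have c0 : (Den.[x] : C) @[x --> u] --> (Den.[u] : C) := @horner_continuous C Den u.
  apply: cvgM c0 _.
  apply: (@cvg_comp _ _ _ (fun x : C => x + p) (fun y => T y r s) (nbhs u) (nbhs (u + p))).
    by apply: cvgD; [exact: cvg_id | exact: cvg_cst].
  exact: holomorphic_cvg (HM _ Mup).1.
have c2 : \sum_j evalmx Num x r j * T x j s @[x --> u] --> \sum_j evalmx Num u r j * T u j s.
  apply: (@cvg_bigsum C _ _ _ (nbhs u) _) => j; apply: cvgM; last exact: holomorphic_cvg.
  rewrite mxE (_ : (fun x => evalmx Num x r j) = horner (Num r j)); first exact: horner_continuous.
  by apply/funext => x; rewrite mxE.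
apply: dnbhs_cvg_eq c1 c2 _.
have := generic_near u (generic_and AE (generic_root Den0)).
apply: filterS2 (TA u) => x; rewrite two_kappa => TAx [Ax Dx].
rewrite /A in Ax; by rewrite TAx Ax -scalemxAl mxE mulVKf // mxE.
Qed.

(* The defect at [u + m p] is [T (u + m p) W] with [W] independent of [m]; it is
   [o(1)] after multiplication by [E], while [E T] tends to 1. *)
Lemma transfer_intertwines : exists M, forall u, M < rho u -> T u \in unitmx /\
  forall k, xs_rel false k (T u) 1 (lpoly u k).
Proof.
have [M HM] := transfer_half_plane; have [_ _ _ [M' M'0 asym]] := hT.
exists (Num.max M M') => u; rewrite gt_max => /andP[Mu M'u].
have [Tu _ _ _] := HM _ Mu; split=> // k q; rewrite mul1r.
have u0 : 0 < rho u := lt_trans M'0 M'u.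
have k2gt0 : (0 < kappa2 L)%N by rewrite lt0n.
pose v m : C := u + m%:R * p.
have vS m : v m.+1 = v m + p by rewrite /v mulrSr mulrDl mul1r addrA.
have rv m : rho u <= rho (v m).
  by rewrite /v rhoD /p mulrA -natrM rho_natM // lerDl.
pose Y w := defect V i w k q (T w).
pose W := invmx (T u) *m Y u.
have YW m : Y (v m) = T (v m) *m W.
  elim: m => [|m IH]; first by rewrite /v mul0r addr0 /W mulKVmx.
  have [_ TS _ Arel] := HM _ (lt_le_trans Mu (rv m)).
  have YS : Y (v m + p) = A (v m) *m Y (v m).
    by rewrite /Y TS; apply: defect_shift; exact: Arel.
  rewrite vS TS YS IH; exact: mulmxA.
pose F m := E (v m) *m T (v m).
have F1 : mxcvg F 1%:M.
  move=> r s; apply/cvgrPdist_lt => e.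
  case: e => e e' /=; rewrite ltcE /= => /andP[/eqP-> e0].
  have [B HB] := asym e e0; near=> m.
  rewrite distrC; have -> : F m r s - 1%:M r s = (F m - 1%:M) r s.
    by rewrite [RHS]mxE [X in _ = _ + X]mxE.
  apply: (HB (v m) (lt_le_trans M'u (rv m))).
  by near: m; exact: rho_far.
have FW m : F m *m W = (if k == i then xs false k q *m F m - (v m)^-1 *: (xs false k ('X * q) *m F m)
    else xs false k q *m F m) - F m *m xs false k q.
  rewrite /F -mulmxA -YW; apply: defect_exp.
    apply/eqP => vm0; have := lt_le_trans u0 (rv m).
    by rewrite vm0 /(rho _) mul0r ltxx.
  by move=> q'; apply: exp_varpi_x; exact: lt_le_trans u0 (rv m).
suff W0 : W = 0.
  have := YW 0%N; rewrite /v mul0r addr0 W0 mulmx0 /Y => /eqP.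
  by rewrite subr_eq0 => /eqP.
(* As [F] tends to the identity, the sequence tends to [W]; by [FW] it also tends to [x_k[q] -
   x_k[q]], the extra term for [k = i] carrying the factor [(v m)^-1]. *)
apply: (@mxcvg_unique _ _ _ (fun m => F m *m W)).
  by rewrite -[X in mxcvg _ X]mul1mx; apply: mxcvgM; last exact: mxcvg_cst.
rewrite (funext FW).
have xF q' : mxcvg (fun m => xs false k q' *m F m) (xs false k q').
  by rewrite -[X in mxcvg _ X]mulmx1; apply: mxcvgM; first exact: mxcvg_cst.
have Fx q' : mxcvg (fun m => F m *m xs false k q') (xs false k q').
  by rewrite -[X in mxcvg _ X]mul1mx; apply: mxcvgM; last exact: mxcvg_cst.
have -> : 0 = xs false k q - xs false k q by rewrite subrr.
apply: mxcvgB (Fx q); case: eqP => _; last exact: xF.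
rewrite -[X in mxcvg _ X]subr0 -(scale0r (xs false k ('X * q))).
exact: mxcvgB (xF q) (mxcvgZ (rho_inv_cvg hbar_neq0 u0 k2gt0) (xF _)).
Unshelve. all: by end_near. Qed.

Variable f : C -> C.
Hypothesis hf : mero_eq (fun u => T u *m Omega) (fun u => f u *: Omega).

Lemma transfer_scaled u : T u \in unitmx -> T u *m Omega = f u *: Omega ->
  (forall k, xs_rel false k (T u) 1 (lpoly u k)) -> intertwines u ((f u)^-1 *: T u).
Proof.
move=> Tu TO Tx; have f0 : f u != 0.
  apply: contra_neq Omega_neq0 => f0; move: TO; rewrite f0 scale0r => TO.
  by rewrite -(mulKmx Tu Omega) TO mulmx0.
split=> [k q|]; last by rewrite -scalemxAl TO scalerA mulVf // scale1r.
by rewrite -scalemxAl -scalemxAr Tx.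
Qed.

Lemma intertwines_f_neq0 u : intertwines u ((f u)^-1 *: T u) -> f u != 0.
Proof.
move=> [_ TO]; apply: contra_neq Omega_neq0 => f0.
by rewrite -TO f0 invr0 scale0r mul0mx.
Qed.

Lemma transfer_near z : \forall u \near z^', intertwines u ((f u)^-1 *: T u).
Proof.
have [M HM] := transfer_intertwines; have [_ TA _ _] := hT.
have base w : M < rho w -> \forall u \near w^', intertwines u ((f u)^-1 *: T u).
  move=> Mw; have := nbhs_dnbhs (rho_near hbar_neq0 Mw).
  by apply: filterS2 (hf w) => u TO /HM[Tu Tx]; exact: transfer_scaled.
have [m mM] : exists m, M < rho (z + m%:R * p).
  have [m mM] := filter_ex (nbhs_infty_gtr (M - rho z)); exists m.
  rewrite rhoD /p mulrA -natrM rho_natM // -ltrBlDl (lt_le_trans mM) // ler_nat.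
  by rewrite leq_pmulr // lt0n.
elim: m z mM => [|m IH] z; first by rewrite mul0r addr0; exact: base.
rewrite mulrSr mulrDl mul1r [_ + p]addrC addrA => /IH/near_dnbhs_shift H.
near=> u.
have TAu : T (u + p) = A u *m T u by rewrite -two_kappa; near: u; exact: TA.
have TO : T u *m Omega = f u *: Omega by near: u; exact: hf.
have TOp : T (u + p) *m Omega = f (u + p) *: Omega.
  by near: u; exact: (near_dnbhs_shift (hf (z + p))).
have Iup : intertwines (u + p) ((f (u + p))^-1 *: T (u + p)) by near: u.
have [Au Arel] : A u \in unitmx /\
    forall k, xs_rel false k (A u) (lpoly u k) (lpoly (u + p) k).
  by near: u; exact: generic_near A_generic.
have fp0 := intertwines_f_neq0 Iup.
(* Comparing the values on [Omega] shows that [f] cannot vanish at [u] and that the normalization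
   changes by [f (u + p) / f u]. *)
have AO : f u *: (A u *m Omega) = f (u + p) *: Omega.
  by rewrite scalemxAr -TO mulmxA -TAu TOp.
have f0 : f u != 0.
  apply: contra_neq Omega_neq0 => f0; move: AO; rewrite f0 scale0r => /esym/eqP.
  by rewrite scaler_eq0 (negPf fp0) => /eqP.
apply: (intertwines_back (b := f (u + p) / f u) Au _ Arel Iup).
- by rewrite mulf_neq0 // invr_eq0.
- by rewrite -scalemxAr -TAu scalerA mulrAC mulfV // mul1r.
- by rewrite -scalemxAl TO scalerA mulVf // scale1r.
Unshelve. all: by end_near. Qed.

Lemma transfer_dense (B : {poly C}) : B != 0 ->
  exists u S, B.[u] != 0 /\ intertwines u S.
Proof.
move=> B0; have [u [Bu Iu]] := filter_ex (filterI (near_dnbhs_poly 0 B0) (transfer_near 0)).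
by exists u, ((f u)^-1 *: T u).
Qed.

End Transfer.

(** * Eigenvalues, degrees and poles of the normalized operator *)

Section NormalizedTransfer.
Variables (K : numClosedFieldType) (L : simple_lie K) (hbar : K) (N : nat).
Notation n := (rank L).
Notation hdual := 'Hom(subvs_of (csa L), K^o).
Variable V : yangian_rep L hbar N.
Hypothesis k2_neq0 : kappa2 L != 0%N.
Hypothesis hbar_neq0 : hbar != 0.
Variables (Omega : 'cV[K]_N) (lambda : hdual).
Hypothesis Omega_neq0 : Omega != 0.
Hypothesis Omega_x : forall i r, xpm V true i r *m Omega = 0.
Hypothesis Omega_xi : exists m : 'I_n -> nat -> K, forall i r, xi V i r *m Omega = m i r *: Omega.
Hypothesis Omega_gen : forall U : {vspace 'cV[K]_N}, Omega \in U ->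
  (forall i r v, v \in U -> xi V i r *m v \in U) ->
  (forall e i r v, v \in U -> xpm V e i r *m v \in U) -> U = fullv.
Hypothesis Omega_wt : wt_space V lambda Omega.
Variable i : 'I_n.
Notation pc := (map_mx (@polyC K)).
Variable P : 'M[{poly K}]_N.
Hypothesis P_x : forall k p, P *m pc (xs V false k p) =
  (if k == i then 'X *: pc (xs V false k p) - pc (xs V false k ('X * p))
   else pc (xs V false k p)) *m P.
Hypothesis P_Omega : P *m pc Omega = pc Omega.

Lemma normalized_monic_eigenvalues : monic_eigenvalues P.
Proof.
have [U [U' [s [UU' tri diag mon]]]] :=
  triangular_form k2_neq0 Omega_x Omega_xi Omega_gen Omega_wt P_x P_Omega.
exists [seq s l | l <- enum 'I_N]; first by apply/allP => _ /mapP[l _ ->].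
by rewrite big_map big_enum (char_poly_eigen UU' tri diag).
Qed.

Lemma normalized_eigenvalue_zeros :
  eigenvalue_zeros P = [set z | evalmx P z \notin unitmx].
Proof.
have [U [U' [s [UU' tri diag mon]]]] :=
  triangular_form k2_neq0 Omega_x Omega_xi Omega_gen Omega_wt P_x P_Omega.
apply/seteqP; split=> z /=; rewrite (evalmx_det_prod z UU' tri diag) negbK /eigenvalue_zeros /=.
  rewrite (char_poly_eigen UU' tri diag) => -[p + pz].
  rewrite -[\prod_l _](big_map s xpredT (fun q => 'X - q%:P)) root_prod_XsubC.
  by move=> /mapP[l _ pE]; rewrite (bigD1 l) //= -pE (eqP pz) mul0r.
rewrite prodf_seq_eq0 => /hasP[l _ /= sz]; exists (s l) => //.
rewrite (char_poly_eigen UU' tri diag).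
rewrite -[\prod_l _](big_map s xpredT (fun q => 'X - q%:P)) root_prod_XsubC.
by apply: map_f; exact: mem_index_enum.
Qed.

Lemma normalized_monic_on mu v : wt_space V mu v -> v != 0 ->
  exists2 deg : nat, (lambda - mu) (varpi i) = deg%:R
                   & monic_on (wt_space V mu) P deg.
Proof.
have hw := hw_monic k2_neq0 Omega_x Omega_xi Omega_gen Omega_wt P_x P_Omega.
have deg m : ((lambda - (lambda - qsum m)) (varpi i) : K) = (m i)%:R.
  by rewrite opprB addrC subrK qsum_varpi.
move=> muv /(hw _ _ muv)[m muE _]; exists (m i); first by rewrite muE deg.
move=> w muw; split=> [k||k].
- exact: (coef_wt k2_neq0 Omega_x Omega_xi Omega_gen Omega_wt P_x P_Omega).
(* Each vector of the weight space comes with its own [m']; evaluating the weight at [varpi i] shows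
   that [m' i] agrees with [m i]. *)
- have [->|w0] := eqVneq w 0; first by rewrite mulmx0.
  have [m' mu'E [_ m'w _]] := hw _ _ muw w0.
  by have /eqP := deg m; rewrite -muE mu'E deg eqr_nat => /eqP <-.
- have [->|w0] := eqVneq w 0; first by rewrite mulmx0.
  have [m' mu'E [_ _ m'w]] := hw _ _ muw w0 => mk; apply: m'w.
  by have /eqP := deg m; rewrite -muE mu'E deg eqr_nat => /eqP ->.
Qed.

Lemma normalized_lowest (w0 : seq 'I_n) : longest_word w0 ->
  exists Q : {poly K}, [/\ Q \is monic,
    poly_eigenvalue_on (wt_space V (weyl_word w0 lambda)) P Q
    & [set z | root Q z] = [set z | evalmx P z \notin unitmx]].
Proof.
move=> w0P; have [v0 v0_low v0_neq0] := low_exists k2_neq0 Omega_neq0 Omega_x Omega_wt w0.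
have [Q Qmon QE] := low_poly k2_neq0 Omega_neq0 Omega_x Omega_xi Omega_gen Omega_wt
  P_x P_Omega v0_low v0_neq0.
exists Q; split=> //; first by split=> //; exists v0.
have Qz z : evalmx P z *m v0 = Q.[z] *: v0.
  apply/matrixP => p q; have /matrixP/(_ p q) := QE _ v0_low.
  move=> /(congr1 (horner_eval z)); rewrite !mxE /horner_eval horner_sum hornerM hornerC => <-.
  by apply: eq_bigr => j _; rewrite !mxE hornerM hornerC.
apply/seteqP; split=> z /=.
  move=> /eqP Q0; apply/negP => /mulKmx Pu; move: (v0_neq0).
  by rewrite -(Pu _ v0) Qz Q0 scale0r mulmx0 eqxx.
apply: contraNT => Q0.
exact: (low_unit k2_neq0 Omega_neq0 Omega_x Omega_xi Omega_gen Omega_wt P_x P_Omega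
  w0P v0_low v0_neq0 Q0 (Qz z)).
Qed.

Definition poles (F : nat -> 'M[K]_N) : set K :=
  [set z | forall P D, expands F P D -> root D z].

(** Where [P(z)] is invertible, annihilators nonvanishing at [z] are denominators for all three
    series. Where it is not, [x^-_i(u)] itself has a pole, since a denominator nonvanishing at [z]
    would be an annihilator and force invertibility. *)
Lemma poles_notin_unitmx :
  poles (xi_ser V i) `|` poles (x_ser V true i) `|` poles (x_ser V false i) =
  [set z | evalmx P z \notin unitmx].
Proof.
have ann e z := unit_annihilator k2_neq0 Omega_x Omega_xi Omega_gen P_x P_Omega e (z := z).
apply/seteqP; split=> z /=; last first.
  move=> Pz; right=> P' D PD; apply: contraNT Pz => Dz.
  apply: (annihilator_unit k2_neq0 Omega_x Omega_xi Omega_gen P_x P_Omega Dz).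
  exact: (expands_annihilator k2_neq0 hbar_neq0 PD).
move=> + ; apply: contraPN => Pz.
move=> [[|]|] pole.
- have [D Dz /expands_xi_ser[P' PD]] := ann true z Pz.
  by have := pole _ _ PD; rewrite /root (negPf Dz).
- have [D Dz /expands_x_ser[P' PD]] := ann true z Pz.
  by have := pole _ _ PD; rewrite /root (negPf Dz).
- have [D Dz /expands_x_ser[P' PD]] := ann false z Pz.
  by have := pole _ _ PD; rewrite /root (negPf Dz).
Qed.

End NormalizedTransfer.

Theorem theorem4p4 (R : realType) (L : simple_lie (Cx R))
    (c : 'I_(rank L) -> 'I_(rank L) -> {fsfun int -> nat with 0%N})
    (hc : inverse_qcartan c)
    (w0 : seq 'I_(rank L)) (hw0 : longest_word w0)
    (hbar : Cx R) (hbar_neq0 : hbar != 0)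
    (lg : Cx R -> Cx R) (hlg : log_branch hbar lg)
    (N : nat) (V : yangian_rep L hbar N)
    (Omega : 'cV[Cx R]_N) (hOmega : highest_weight_vector V Omega)
    (lambda : 'Hom(subvs_of (csa L), (Cx R)^o))
    (hlambda : weight_space V lambda Omega)
    (i : 'I_(rank L))
    (T : Cx R -> 'M[Cx R]_N) (hT : transfer_operator V c lg i T)
    (f : Cx R -> Cx R)
    (hf : forall v, weight_space V lambda v ->
            mero_eq (fun u => T u *m v) (fun u => f u *: v)) :
  exists2 P : 'M[{poly Cx R}]_N,
    mero_eq (fun u => (f u)^-1 *: T u) (fun u => evalmx P u)
  & [/\ monic_eigenvalues P,
        (forall mu, is_weight V mu ->
           exists2 deg : nat, (lambda - mu) (varpi i) = deg%:R
                            & monic_on (weight_space V mu) P deg),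
        eigenvalue_zeros P = sigma V i
      & exists Q : {poly Cx R},
          [/\ Q \is monic,
              poly_eigenvalue_on (weight_space V (weyl_word w0 lambda)) P Q
            & [set z | root Q z] = sigma V i]].
Proof.
have k2_neq0 := kappa2_neq0 hc i.
have [ Omega_neq0 Omega_x Omega_xi Omega_gen] := hOmega.
have Omega_wt : wt_space V lambda Omega by rewrite -weight_space_wt.
have hfO := hf Omega hlambda.
have nearT := transfer_near hc hbar_neq0 hlg k2_neq0 Omega_neq0 Omega_x Omega_xi Omega_gen Omega_wt hT hfO.
have denseT := @transfer_dense _ _ _ hc _ hbar_neq0 _ hlg _ _ k2_neq0 _ _ Omega_neq0
  Omega_x Omega_xi Omega_gen Omega_wt _ _ hT _ hfO.
have [P PE] := intertwines_poly k2_neq0 Omega_x Omega_xi Omega_gen i.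
have P_x := solution_x PE denseT; have P_Omega := solution_Omega PE denseT.
(* [sigma] is convertible to the union of the [poles] of the restated series. *)
have sigmaE : sigma V i = [set z | evalmx P z \notin unitmx].
  exact: (poles_notin_unitmx k2_neq0 hbar_neq0 Omega_x Omega_xi Omega_gen P_x P_Omega).
exists P; first by move=> z; apply: filterS (nearT z) => u /PE.
split.
- exact: (normalized_monic_eigenvalues k2_neq0 Omega_x Omega_xi Omega_gen Omega_wt P_x P_Omega).
- move=> mu [v]; rewrite weight_space_wt // => muv v0.
  exact: (normalized_monic_on k2_neq0 Omega_x Omega_xi Omega_gen Omega_wt P_x P_Omega muv v0).
- rewrite sigmaE.
  exact: (normalized_eigenvalue_zeros k2_neq0 Omega_x Omega_xi Omega_gen Omega_wt P_x P_Omega).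
- rewrite weight_space_wt // sigmaE.
  exact: (normalized_lowest k2_neq0 Omega_neq0 Omega_x Omega_xi Omega_gen Omega_wt P_x P_Omega hw0).
Qed.
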